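(* Let $\Bbbk$ be a commutative ring and $n$ a positive integer. Let $S$ and $T$ be covariant $\Omega_n^{epi}$-diagrams in dg-modules, both dg-cofibrant. Then $$\mathrm{Ext}_{\Omega_n^{epi}}^*(S,T)=H_*\bigl(\mathrm{Hom}_{\Omega_n^{epi}}(K(\Omega_n^{epi},\Omega_n^{epi},S),T)\bigr).$$
   Context: Category of pruned trees. Write $\underline{\mathsf r}=\{1<\dots<r\}$. An object $\underline{\tau}$ of $\Omega_n^{epi}$ is a sequence of weakly increasing surjections $\underline{\mathsf t}_0\xrightarrow{\tau_1}\underline{\mathsf t}_1\xrightarrow{\tau_2}\cdots\xrightarrow{\tau_n}\underline{\mathsf t}_n=\underline{\mathsf 1}$ (a planar tree; $\underline{\mathsf t}_i$ is the ordered set of vertices of level $i$, the root is at level $n$). A morphism $u:\underline{\tau}\to\underline{\sigma}$ is a sequence of surjections $u:\underline{\mathsf t}_i\to\underline{\mathsf s}_i$, $0\le i\le n$, commuting with the maps $\tau_i,\sigma_i$, and such that $u:\underline{\mathsf t}_i\to\underline{\mathsf s}_i$ is weakly increasing on each fiber $\tau_{i+1}^{-1}(x)$, $x\in\underline{\mathsf t}_{i+1}$. Composition is levelwise. Degrees: $\deg(\underline{\tau})=t_0+\dots+t_{n-1}$, and $\deg(u)=\deg(\underline{\tau})-\deg(\underline{\sigma})$ for $u:\underline{\tau}\to\underline{\sigma}$. Write $\Omega_n^{epi}(\underline{\tau},\underline{\sigma})$ for the free $\Bbbk$-module on the set of morphisms $\underline{\tau}\to\underline{\sigma}$. Signs.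 A morphism $u:\underline{\tau}\to\underline{\sigma}$ of degree $1$ merges exactly two vertices $x_i,x_j$, consecutive in one fiber $\tau_{k+1}^{-1}(b)$ at some level $k<n$, and is bijective on all other vertices. Assign a symbol of degree $1$ to each vertex of level $<n$, and order the vertices of a tree by depth-first order from the root (from bottom to top, then left to right). Then $\mathrm{sgn}(u)$ is the product of two Koszul signs: the sign of the permutation of degree $1$ symbols bringing $x_i\otimes x_j$ ($x_i$ preceding $x_j$) to the front of the ordered tensor of the vertices of $\underline{\tau}$, the other symbols keeping their order; and, after replacing $x_i\otimes x_j$ by one symbol $x_{ij}$ of degree $1$, the sign of the permutation putting the resulting tensor in the depth-first order of the vertices of $\underline{\sigma}$. dg-modules are $\mathbb Z$-graded with differential $\delta$ lowering degree by $1$, with the projective model structure (weak equivalences: homology isomorphisms; fibrations: degreewise surjections). A diagram is dg-cofibrant if each of its values is a cofibrant dg-module. Koszul complex with coefficients. For $S'$ contravariant and $T'$ covariant, $K(S',\Omega_n^{epi},T')=\bigoplus_{u:\underline{\tau}\to\underline{\sigma}}S'(\underline{\sigma})\otimes\Bbbk\{u\}\otimes T'(\underline{\tau})$ (sum over all morphisms $u$, with $\{u\}$ of degree $\deg u$). Its differential is the usual tensor product differential coming from the internal differentials of $S'$ and $T'$, plus the twisting term $$\partial(x\otimes\{u\}\otimes y)=(-1)^{\deg x}\sum_{\substack{u=vw\\ \deg v=1}}\mathrm{sgn}(v)\,v^*(x)\otimes\{w\}\otimes y+(-1)^{\deg x+\deg u}\sum_{\substack{u=vw\\ \deg w=1}}\mathrm{sgn}(w)\,x\otimes\{v\}\otimes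 w_*(y).$$ $K(\Omega_n^{epi},\Omega_n^{epi},S)$ denotes the covariant diagram $\underline{\phi}\mapsto K(\Omega_n^{epi}(-,\underline{\phi}),\Omega_n^{epi},S)$, functorial in $\underline{\phi}$ by composition on the left. Ext. For covariant diagrams $S,T$, $\mathrm{Hom}_{\Omega_n^{epi}}(S,T)=\int_{\underline{\tau}}\mathrm{Hom}_{dg}(S(\underline{\tau}),T(\underline{\tau}))$ (end), where $\mathrm{Hom}_{dg}(C,D)$ is the internal hom of dg-modules, with differential $\delta(f)=\delta f-(-1)^{\deg f}f\delta$. $\mathrm{Ext}_{\Omega_n^{epi}}^*(S,T)$ is the homology of $\mathrm{Hom}_{\Omega_n^{epi}}(Q_S,T)$, where $Q_S\xrightarrow{\sim}S$ is a cofibrant replacement in the projective model category of covariant $\Omega_n^{epi}$-diagrams in dg-modules (cohomological degree $d$ corresponds to homological degree $-d$). *)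

(* Defs.v *)
From HB Require Import structures.
From mathcomp Require Import all_boot all_order all_algebra.
From mathcomp Require Import finmap.
From mathcomp Require Import boolp classical_sets functions cardinality fsbigop.
From mathcomp Require Import zify.
Set Implicit Arguments. Unset Strict Implicit. Unset Printing Implicit Defensive.
Import Order.TTheory GRing.Theory Num.Theory.
Local Open Scope ring_scope.

Section PiModule.
Context (k : comPzRingType) (I : Type) (M : I -> lmodType k).

Definition pi_mod := forall i, M i.
HB.instance Definition _ := gen_eqMixin pi_mod.
HB.instance Definition _ := gen_choiceMixin pi_mod.

Definition pi0 : pi_mod := fun i => 0.
Definition piN (f : pi_mod) : pi_mod := fun i => - f i.
Definition piD (f g : pi_mod) : pi_mod := fun i => f i + g i.
Definition piZ (a : k) (f : pi_mod) : pi_mod := fun i => a *: f i.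

Fact pi_addA : associative piD.
Proof. by move=> f g h; apply: functional_extensionality_dep => i; exact: addrA. Qed.
Fact pi_addC : commutative piD.
Proof. by move=> f g; apply: functional_extensionality_dep => i; exact: addrC. Qed.
Fact pi_add0 : left_id pi0 piD.
Proof. by move=> f; apply: functional_extensionality_dep => i; exact: add0r. Qed.
Fact pi_addN : left_inverse pi0 piN piD.
Proof. by move=> f; apply: functional_extensionality_dep => i; exact: addNr. Qed.
HB.instance Definition _ :=
  GRing.isZmodule.Build pi_mod pi_addA pi_addC pi_add0 pi_addN.

Fact pi_scaleA a b f : piZ a (piZ b f) = piZ (a * b) f.
Proof. by apply: functional_extensionality_dep => i; exact: scalerA. Qed.
Fact pi_scale1 : left_id 1 piZ.
Proof. by move=> f; apply: functional_extensionality_dep => i; exact: scale1r. Qed.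
Fact pi_scaleDr : right_distributive piZ +%R.
Proof. by move=> a f g; apply: functional_extensionality_dep => i; exact: scalerDr. Qed.
Fact pi_scaleDl f : {morph piZ^~ f : a b / a + b}.
Proof. by move=> a b; apply: functional_extensionality_dep => i; exact: scalerDl. Qed.
HB.instance Definition _ := GRing.Zmodule_isLmodule.Build k pi_mod
  pi_scaleA pi_scale1 pi_scaleDr pi_scaleDl.

Lemma pi_zeroE i : (0 : pi_mod) i = 0. Proof. by []. Qed.
Lemma pi_addE (f g : pi_mod) i : (f + g) i = f i + g i. Proof. by []. Qed.
Lemma pi_scaleE a (f : pi_mod) i : (a *: f) i = a *: f i. Proof. by []. Qed.

End PiModule.

Record submodule (k : comPzRingType) (V : lmodType k) := Submodule {
  in_sub :> V -> Prop;
  in_sub0 : in_sub 0;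
  in_subD : forall x y, in_sub x -> in_sub y -> in_sub (x + y);
  in_subZ : forall a x, in_sub x -> in_sub (a *: x) }.

Section Submodule.
Context (k : comPzRingType) (V : lmodType k) (W : submodule V).

Definition sub_pred : {pred V} := fun x => `[< W x >].

Fact sub_pred_closed : submod_closed sub_pred.
Proof.
split=> [|a x y /asboolP Wx /asboolP Wy]; apply/asboolP; first exact: in_sub0.
by apply: in_subD => //; apply: in_subZ.
Qed.
HB.instance Definition _ := GRing.isSubmodClosed.Build k V sub_pred sub_pred_closed.

Record sub_mod := SubMod { sub_val : V; _ : sub_val \in sub_pred }.
HB.instance Definition _ := [isSub for sub_val].
HB.instance Definition _ := [Choice of sub_mod by <:].
HB.instance Definition _ := [SubChoice_isSubLmodule of sub_mod by <:].

Lemma sub_valP (x : sub_mod) : W (sub_val x).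
Proof. by case: x => x /= /asboolP. Qed.

Definition mk_sub (x : V) (Wx : W x) : sub_mod := SubMod (asboolT Wx).


Definition quot_mod := Quotient.quot (sub_pred : zmodClosed V).
HB.instance Definition _ := Choice.on quot_mod.
HB.instance Definition _ := GRing.Zmodule.on quot_mod.
HB.instance Definition _ := @EqQuotient.on quot_mod.

Fact quot_eqP (x y : V) : \pi_quot_mod%qT x = \pi_quot_mod%qT y <-> W (x - y).
Proof.
split=> [/eqP|Wxy]; last first.
  by apply/eqP; rewrite -Quotient.idealrBE; apply/asboolP.
by rewrite -Quotient.idealrBE => /asboolP.
Qed.

Fact quot_piD : {morph \pi_quot_mod%qT : x y / x + y}.
Proof. exact: Quotient.pi_add. Qed.

Definition quot_scale (a : k) (x : quot_mod) : quot_mod :=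
  \pi_quot_mod%qT (a *: repr x).

Fact quot_piZ a x : \pi_quot_mod%qT (a *: x) = quot_scale a (\pi_quot_mod%qT x).
Proof.
apply/quot_eqP; rewrite -scalerBr; apply: in_subZ.
by apply/quot_eqP; rewrite reprK.
Qed.

Fact quot_scaleA a b x : quot_scale a (quot_scale b x) = quot_scale (a * b) x.
Proof. by rewrite -[x](@reprK _ quot_mod) -!quot_piZ scalerA. Qed.
Fact quot_scale1 : left_id 1 quot_scale.
Proof. by move=> x; rewrite -[x](@reprK _ quot_mod) -!quot_piZ scale1r. Qed.
Fact quot_scaleDr : right_distributive quot_scale +%R.
Proof.
move=> a x y; rewrite -[x](@reprK _ quot_mod) -[y](@reprK _ quot_mod).
by rewrite -quot_piD -!quot_piZ -quot_piD scalerDr.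
Qed.
Fact quot_scaleDl x : {morph quot_scale^~ x : a b / a + b}.
Proof.
move=> a b; rewrite -[x](@reprK _ quot_mod).
by rewrite -!quot_piZ -quot_piD scalerDl.
Qed.
HB.instance Definition _ := GRing.Zmodule_isLmodule.Build k quot_mod
  quot_scaleA quot_scale1 quot_scaleDr quot_scaleDl.

End Submodule.

Section Lin.
Context (k : comPzRingType) (U V : lmodType k).

(* Linear maps are carried by a submodule of the product module V^U, so that
   [lin U V] is itself a k-module; it coerces to functions. *)
Definition is_linear (f : pi_mod (fun _ : U => V)) : Prop :=
  forall a x y, f (a *: x + y) = a *: f x + f y.

Fact is_linear0 : is_linear 0.
Proof. by move=> a x y; rewrite scaler0 addr0. Qed.
Fact is_linearD f g : is_linear f -> is_linear g -> is_linear (f + g).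
Proof. by move=> lf lg a x y; rewrite !pi_addE lf lg scalerDr addrACA. Qed.
Fact is_linearZ b f : is_linear f -> is_linear (b *: f).
Proof.
by move=> lf a x y; rewrite !pi_scaleE lf scalerDr !scalerA mulrC.
Qed.
Definition lin := sub_mod (Submodule is_linear0 is_linearD is_linearZ).
HB.instance Definition _ := GRing.Lmodule.on lin.

Definition lin_fun (f : lin) : U -> V := sub_val f.
Coercion lin_fun : lin >-> Funclass.

Fact lin_fun_linear (f : lin) : linear (lin_fun f).
Proof. exact: (sub_valP f). Qed.
HB.instance Definition _ (f : lin) :=
  GRing.isLinear.Build k U V *:%R (lin_fun f) (lin_fun_linear f).

Definition mklin (f : U -> V) (lf : linear f) : lin :=
  @mk_sub _ _ (Submodule is_linear0 is_linearD is_linearZ) f lf.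

Lemma linE f lf x : @mklin f lf x = f x. Proof. by []. Qed.

Lemma lin_ext (f g : lin) : f =1 g -> f = g.
Proof. by move=> fg; apply: val_inj; apply: funext. Qed.

Lemma lin0E x : (0 : lin) x = 0. Proof. by []. Qed.
Lemma linDE (f g : lin) x : (f + g : lin) x = f x + g x. Proof. by []. Qed.
Lemma linZE a (f : lin) x : (a *: f : lin) x = a *: f x. Proof. by []. Qed.
Lemma linNE (f : lin) x : (- f : lin) x = - f x. Proof. by []. Qed.

Lemma lin_app0 (f : lin) : f 0 = 0. Proof. exact: linear0. Qed.
Lemma lin_appD (f : lin) x y : f (x + y) = f x + f y. Proof. exact: linearD. Qed.
Lemma lin_appZ (f : lin) a x : f (a *: x) = a *: f x. Proof. exact: linearZZ. Qed.
Lemma lin_appP (f : lin) a x y : f (a *: x + y) = a *: f x + f y.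
Proof. exact: linearP. Qed.

End Lin.

Section LinComp.
Context (k : comPzRingType).
Implicit Types U V W : lmodType k.

Definition lid U : lin U U := @mklin _ U U id (fun a x y => erefl).

Definition lcomp U V W (g : lin V W) (f : lin U V) : lin U W :=
  mklin (f := g \o f) (linearP (g \o f)).

Lemma lcompE U V W (g : lin V W) (f : lin U V) x : lcomp g f x = g (f x).
Proof. by []. Qed.

Lemma lcompDl U V W (g h : lin V W) (f : lin U V) :
  lcomp (g + h) f = lcomp g f + lcomp h f.
Proof. exact: lin_ext. Qed.
Lemma lcompZl U V W a (g : lin V W) (f : lin U V) :
  lcomp (a *: g) f = a *: lcomp g f.
Proof. exact: lin_ext. Qed.
Lemma lcompDr U V W (g : lin V W) (f h : lin U V) :
  lcomp g (f + h) = lcomp g f + lcomp g h.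
Proof. by apply: lin_ext => x; rewrite !lcompE linDE linearD. Qed.
Lemma lcompZr U V W a (g : lin V W) (f : lin U V) :
  lcomp g (a *: f) = a *: lcomp g f.
Proof. by apply: lin_ext => x; rewrite !lcompE linZE linearZ. Qed.
Lemma lcomp0l U V W (f : lin U V) : lcomp (0 : lin V W) f = 0.
Proof. exact: lin_ext. Qed.
Lemma lcomp0r U V W (g : lin V W) : lcomp g (0 : lin U V) = 0.
Proof. by apply: lin_ext => x; rewrite !lcompE lin0E linear0. Qed.
Lemma lcompA U V W X (h : lin W X) (g : lin V W) (f : lin U V) :
  lcomp h (lcomp g f) = lcomp (lcomp h g) f.
Proof. exact: lin_ext. Qed.
Lemma lcomp_idl U V (f : lin U V) : lcomp (lid V) f = f.
Proof. exact: lin_ext. Qed.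
Lemma lcomp_idr U V (f : lin U V) : lcomp f (lid U) = f.
Proof. exact: lin_ext. Qed.

Lemma lcomp_suml U V W (I : Type) (r : seq I) (g : I -> lin V W) (f : lin U V) :
  lcomp (\sum_(i <- r) g i) f = \sum_(i <- r) lcomp (g i) f.
Proof.
by elim/big_ind2: _ => [|h1 g1 h2 g2 <- <-|//]; rewrite ?lcomp0l ?lcompDl.
Qed.
Lemma lcomp_sumr U V W (I : Type) (r : seq I) (g : lin V W) (f : I -> lin U V) :
  lcomp g (\sum_(i <- r) f i) = \sum_(i <- r) lcomp g (f i).
Proof.
by elim/big_ind2: _ => [|h1 g1 h2 g2 <- <-|//]; rewrite ?lcomp0r ?lcompDr.
Qed.

Definition lmod_iso U V : Prop := exists f : lin U V, bijective f.

End LinComp.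

Section Quotient.
Context (k : comPzRingType) (V : lmodType k) (W : submodule V).

Fact sub_val_linear : linear (@sub_val k V W).
Proof. by []. Qed.
Definition sub_inj : lin (sub_mod W) V := mklin sub_val_linear.

Fact quot_pi_linear : linear (\pi_(quot_mod W)%qT : V -> quot_mod W).
Proof. by move=> a x y; rewrite quot_piD quot_piZ. Qed.
Definition quot_pi : lin V (quot_mod W) := mklin quot_pi_linear.

Section Lift.
Context (U : lmodType k) (f : lin V U) (Wf : forall x, W x -> f x = 0).
Fact quot_lift_pi (x : V) : f (repr (quot_pi x)) = f x.
Proof.
apply/eqP; rewrite -subr_eq0 -linearB; apply/eqP/Wf/quot_eqP.
by rewrite reprK.
Qed.
Fact quot_lift_linear : linear (fun x : quot_mod W => f (repr x)).
Proof.
move=> a x y; rewrite -[x](@reprK _ (quot_mod W)) -[y](@reprK _ (quot_mod W)).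
rewrite -[\pi_(quot_mod W)%qT (repr x)]/(quot_pi (repr x)).
rewrite -[\pi_(quot_mod W)%qT (repr y)]/(quot_pi (repr y)).
by rewrite -linearP !quot_lift_pi linearP.
Qed.
Definition quot_lift : lin (quot_mod W) U := mklin quot_lift_linear.
Lemma quot_liftE x : quot_lift (quot_pi x) = f x.
Proof. exact: quot_lift_pi. Qed.
End Lift.

Lemma quot_ext (U : lmodType k) (f g : lin (quot_mod W) U) :
  (forall x, f (quot_pi x) = g (quot_pi x)) -> f = g.
Proof.
by move=> fg; apply: lin_ext => x; rewrite -[x](@reprK _ (quot_mod W)); exact: fg.
Qed.
End Quotient.

Section DirectSum.
Context (k : comPzRingType) (I : choiceType) (M : I -> lmodType k).
Local Open Scope classical_set_scope.

Definition finsupp_fam (f : pi_mod M) : Prop := finite_set [set i | f i <> 0].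

Fact finsupp0 : finsupp_fam 0.
Proof. by apply: (sub_finite_set _ (@finite_set0 I)) => i /=. Qed.
Fact finsuppD f g : finsupp_fam f -> finsupp_fam g -> finsupp_fam (f + g).
Proof.
move=> ff fg; have fU : finite_set ([set i | f i <> 0] `|` [set i | g i <> 0]).
  by rewrite finite_setU.
apply: (sub_finite_set _ fU) => i /= fgi; rewrite pi_addE in fgi.
case: (EM (f i = 0)) => fi; last by left.
by right => gi; apply: fgi; rewrite fi gi addr0.
Qed.
Fact finsuppZ a f : finsupp_fam f -> finsupp_fam (a *: f).
Proof.
apply: sub_finite_set => i /= afi fi; apply: afi.
by rewrite pi_scaleE fi scaler0.
Qed.
Definition dsum := sub_mod (Submodule finsupp0 finsuppD finsuppZ).
HB.instance Definition _ := GRing.Lmodule.on dsum.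

Definition dsum_at (i : I) (x : M i) : pi_mod M :=
  fun j => if i =P j is ReflectT e then ecast j (M j) e x else 0.

Lemma dsum_at_eq i x : dsum_at x i = x :> M i.
Proof. by rewrite /dsum_at; case: eqP => // e; rewrite eq_axiomK. Qed.
Lemma dsum_at_neq i (x : M i) j : i <> j -> dsum_at x j = 0.
Proof. by rewrite /dsum_at; case: eqP. Qed.

Fact dsum_at_fin i (x : M i) : finsupp_fam (dsum_at x).
Proof.
apply: (sub_finite_set _ (finite_set1 i)) => j /= xj.
by apply: contrapT => ji; apply: xj; apply: dsum_at_neq => ij; apply: ji.
Qed.

Definition dsum_mk (f : pi_mod M) (ff : finsupp_fam f) : dsum :=
  @mk_sub _ _ (Submodule finsupp0 finsuppD finsuppZ) f ff.

Fact dsum_in_linear i : linear (fun x : M i => dsum_mk (dsum_at_fin x)).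
Proof.
move=> a x y; apply: val_inj; apply: functional_extensionality_dep => j /=.
rewrite pi_addE pi_scaleE; case: (EM (i = j)) => [<-|ij].
  by rewrite !dsum_at_eq.
by rewrite !dsum_at_neq// scaler0 addr0.
Qed.
Definition dsum_in i : lin (M i) dsum := mklin (@dsum_in_linear i).

Lemma dsum_finsupp (x : dsum) : finite_set [set i | sub_val x i <> 0].
Proof. exact: (sub_valP x). Qed.


Lemma dsum_fset (x : dsum) : exists A : {fset I}, forall i, i \notin A -> sub_val x i = 0.
Proof.
exists (fset_set [set i | sub_val x i <> 0]) => i.
by rewrite in_fset_set ?mem_setE; [move=> /asboolPn/= /contrapT|exact: dsum_finsupp].
Qed.

Section Lift.
Context (U : lmodType k) (g : forall i, lin (M i) U).

Definition dsum_lift_fun (x : dsum) : U := \sum_(i \in [set: I]) g i (sub_val x i).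

Lemma dsum_lift_fset (x : dsum) (A : {fset I}) :
  (forall i, i \notin A -> sub_val x i = 0) ->
  dsum_lift_fun x = \sum_(i <- A) g i (sub_val x i).
Proof. by move=> xA; apply: fsbigTE => i /xA ->; rewrite linear0. Qed.

Fact dsum_lift_linear : linear dsum_lift_fun.
Proof.
move=> a x y; have [A xA] := dsum_fset x; have [B yB] := dsum_fset y.
pose C := (A `|` B)%fset.
have xC i : i \notin C -> sub_val x i = 0 by rewrite in_fsetU negb_or => /andP[/xA].
have yC i : i \notin C -> sub_val y i = 0.
  by rewrite in_fsetU negb_or => /andP[_ /yB].
rewrite (@dsum_lift_fset _ C); last first.
  by move=> i iC; rewrite /= pi_addE pi_scaleE xC// yC// scaler0 addr0.
rewrite (dsum_lift_fset xC) (dsum_lift_fset yC) scaler_sumr -big_split/=.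
by apply: eq_bigr => i _; rewrite pi_addE pi_scaleE linearP.
Qed.
Definition dsum_lift : lin dsum U := mklin dsum_lift_linear.

Lemma dsum_liftE i (x : M i) : dsum_lift (dsum_in i x) = g i x.
Proof.
rewrite linE (@dsum_lift_fset _ [fset i]%fset) ?big_seq_fset1 /= ?dsum_at_eq//.
by move=> j; rewrite inE /= => ji; apply: dsum_at_neq => ij; rewrite ij eqxx in ji.
Qed.
End Lift.

Lemma dsum_sum (x : dsum) (A : {fset I}) :
  (forall i, i \notin A -> sub_val x i = 0) ->
  x = \sum_(i <- A) dsum_in i (sub_val x i).
Proof.
move=> xA; apply: val_inj; apply: functional_extensionality_dep => j.
have val_sum (r : seq I) (F : I -> dsum) :
    sub_val (\sum_(i <- r) F i) j = \sum_(i <- r) sub_val (F i) j.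
  by elim/big_ind2: _ => // f1 y1 f2 y2 <- <-.
transitivity (\sum_(i <- A) sub_val (dsum_in i (sub_val x i)) j); last by rewrite -val_sum.
case: (boolP (j \in A)) => [jA|jA]; last first.
  rewrite [LHS](xA j jA) big_seq big1// => i iA; apply: dsum_at_neq => ij.
  by rewrite -ij iA in jA.
rewrite (big_fsetD1 j)//= dsum_at_eq big_seq big1 ?addr0// => i.
by rewrite !inE => /andP[/eqP ij _]; apply: dsum_at_neq.
Qed.

Lemma dsum_ext (U : lmodType k) (f g : lin dsum U) :
  (forall i x, f (dsum_in i x) = g (dsum_in i x)) -> f = g.
Proof.
move=> fg; apply: lin_ext => x; have [A /dsum_sum->] := dsum_fset x.
by rewrite !linear_sum; apply: eq_bigr => i _; apply: fg.
Qed.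

Lemma dsum_lift_in (U : lmodType k) (g : forall i, lin (M i) U) i :
  lcomp (dsum_lift g) (dsum_in i) = g i.
Proof. by apply: lin_ext => x; rewrite lcompE dsum_liftE. Qed.

Lemma dsum_lin_ext (U : lmodType k) (f g : lin dsum U) :
  (forall i, lcomp f (dsum_in i) = lcomp g (dsum_in i)) -> f = g.
Proof.
move=> fg; apply: dsum_ext => i x.
exact: (congr1 (fun h : lin _ _ => h x) (fg i)).
Qed.
End DirectSum.

Section Tensor.
Context (k : comPzRingType).

Definition free_mod (X : choiceType) : lmodType k := dsum (fun _ : X => k^o).
Definition free_gen (X : choiceType) (x : X) : free_mod X :=
  dsum_in (fun _ : X => k^o) x 1.

Lemma free_ext (X : choiceType) (U : lmodType k) (f g : lin (free_mod X) U) :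
  (forall x, f (free_gen x) = g (free_gen x)) -> f = g.
Proof.
move=> fg; apply: dsum_ext => x a.
rewrite -[a]mulr1 -[a * 1]/(a *: (1 : k^o)) !linearZ.
by congr (_ *: _); apply: fg.
Qed.

Fact scale_linear (U : lmodType k) (u : U) : linear (fun a : k^o => a *: u).
Proof. by move=> a x y; rewrite scalerDl scalerA. Qed.
Definition free_lift (X : choiceType) (U : lmodType k) (f : X -> U) :
  lin (free_mod X) U := dsum_lift (fun x => mklin (scale_linear (f x))).
Lemma free_liftE (X : choiceType) (U : lmodType k) (f : X -> U) x :
  free_lift f (free_gen x) = f x.
Proof. by rewrite /free_lift dsum_liftE linE scale1r. Qed.

Definition free_map (X Y : choiceType) (f : X -> Y) :
  lin (free_mod X) (free_mod Y) := free_lift (fun x => free_gen (f x)).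

Definition lin_span (V : lmodType k) (A : V -> Prop) (x : V) : Prop :=
  forall W : submodule V, (forall a, A a -> W a) -> W x.

Fact lin_span0 (V : lmodType k) (A : V -> Prop) : lin_span A 0.
Proof. by move=> W _; apply: in_sub0. Qed.
Fact lin_spanD (V : lmodType k) (A : V -> Prop) x y :
  lin_span A x -> lin_span A y -> lin_span A (x + y).
Proof. by move=> sx sy W AW; apply: in_subD; [apply: sx|apply: sy]. Qed.
Fact lin_spanZ (V : lmodType k) (A : V -> Prop) a x : lin_span A x -> lin_span A (a *: x).
Proof. by move=> sx W AW; apply: in_subZ; apply: sx. Qed.
Definition lin_span_sub (V : lmodType k) (A : V -> Prop) : submodule V :=
  Submodule (@lin_span0 V A) (@lin_spanD V A) (@lin_spanZ V A).

Section Def.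
Context (M N : lmodType k).
Local Notation free := (free_mod (M * N)%type).
Local Notation "{ x , y }" := (free_gen (x, y)).

Inductive tens_rel : free -> Prop :=
| TensL a x x' y : tens_rel ({a *: x + x', y} - (a *: {x, y} + {x', y}))
| TensR a x y y' : tens_rel ({x, a *: y + y'} - (a *: {x, y} + {x, y'})).

Definition tensor := quot_mod (lin_span_sub tens_rel).
HB.instance Definition _ := GRing.Lmodule.on tensor.

Definition tens (x : M) (y : N) : tensor := quot_pi (lin_span_sub tens_rel) {x, y}.

Lemma tensPl a x x' y : tens (a *: x + x') y = a *: tens x y + tens x' y.
Proof.
rewrite /tens -linearP; apply/quot_eqP => W; apply.
exact: TensL.
Qed.
Lemma tensPr a x y y' : tens x (a *: y + y') = a *: tens x y + tens x y'.
Proof.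
rewrite /tens -linearP; apply/quot_eqP => W; apply.
exact: TensR.
Qed.

Lemma tens_ext (U : lmodType k) (f g : lin tensor U) :
  (forall x y, f (tens x y) = g (tens x y)) -> f = g.
Proof.
move=> fg; apply: quot_ext => z; have := @free_ext _ _
  (lcomp f (quot_pi (lin_span_sub tens_rel))) (lcomp g (quot_pi (lin_span_sub tens_rel))).
by move=> /(_ _) e; rewrite -[LHS]lcompE e// => -[x y]; apply: fg.
Qed.

Section Lift.
Context (U : lmodType k) (b : M -> N -> U).
Hypothesis bl : forall a x x' y, b (a *: x + x') y = a *: b x y + b x' y.
Hypothesis br : forall a x y y', b x (a *: y + y') = a *: b x y + b x y'.

Let B : lin free U := free_lift (fun z => b z.1 z.2).
Fact tens_lift_rel z : lin_span_sub tens_rel z -> B z = 0.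
Proof.
have K0 : B 0 = 0 by rewrite linear0.
have KD x y : B x = 0 -> B y = 0 -> B (x + y) = 0.
  
  by move=> Bx By; transitivity (B x + B y); [exact: linearD|rewrite Bx By addr0].
have KZ a x : B x = 0 -> B (a *: x) = 0 
  by move=> Bx; transitivity (a *: B x); [exact: linearZZ|rewrite Bx scaler0].
have BP a u v w : B (u - (a *: v + w)) = B u - (a *: B v + B w).
  transitivity (B u - B (a *: v + w)); first exact: linearB.
  by congr (_ - _); exact: linearP.
move=> sz; apply: (sz (Submodule K0 KD KZ)) => _ [a x x' y|a x y y'];
  apply: (etrans (BP _ _ _ _)); rewrite /B !free_liftE /= ?bl ?br subrr; exact: erefl.
Qed.
Definition tens_lift : lin tensor U := quot_lift tens_lift_rel.
Lemma tens_liftE x y : tens_lift (tens x y) = b x y.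
Proof. by rewrite /tens_lift /tens quot_liftE /B free_liftE. Qed.
End Lift.
End Def.

Section Map.
Context (M N M' N' : lmodType k) (f : lin M M') (g : lin N N').
Fact tens_mapl a x x' y :
  tens (f (a *: x + x')) (g y) = a *: tens (f x) (g y) + tens (f x') (g y).
Proof. by rewrite linearP tensPl. Qed.
Fact tens_mapr a x y y' :
  tens (f x) (g (a *: y + y')) = a *: tens (f x) (g y) + tens (f x) (g y').
Proof. by rewrite linearP tensPr. Qed.
Definition tens_map : lin (tensor M N) (tensor M' N') :=
  tens_lift tens_mapl tens_mapr.
Lemma tens_mapE x y : tens_map (tens x y) = tens (f x) (g y).
Proof. exact: tens_liftE. Qed.
End Map.

Lemma tens_map0l (M M' N N' : lmodType k) (g : lin N N') :
  tens_map (0 : lin M M') g = 0.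
Proof.
apply: tens_ext => x y; rewrite tens_mapE.
have := @tensPl M' N' (- 1) 0 0 (g y).
by rewrite scaler0 add0r scaleN1r addNr lin0E.
Qed.
Lemma tens_map0r (M M' N N' : lmodType k) (f : lin M M') :
  tens_map f (0 : lin N N') = 0.
Proof.
apply: tens_ext => x y; rewrite tens_mapE.
have := @tensPr M' N' (- 1) (f x) 0 0.
by rewrite scaler0 add0r scaleN1r addNr lin0E.
Qed.

Lemma tens_map_comp (M M' M'' N N' N'' : lmodType k) (f' : lin M' M'')
    (f : lin M M') (g' : lin N' N'') (g : lin N N') :
  lcomp (tens_map f' g') (tens_map f g) = tens_map (lcomp f' f) (lcomp g' g).
Proof. by apply: tens_ext => x y; rewrite lcompE !tens_mapE. Qed.
Lemma tens_map_id (M N : lmodType k) : tens_map (lid M) (lid N) = lid (tensor M N).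
Proof. by apply: tens_ext => x y; rewrite tens_mapE. Qed.

Lemma free_mapE (X Y : choiceType) (f : X -> Y) x :
  free_map f (free_gen x) = free_gen (f x).
Proof. exact: free_liftE. Qed.

End Tensor.

Section DgModules.
Context (k : comPzRingType).

Definition sg (i : int) : k := (-1) ^+ `|i|%N.

(* A graded module with a degree -1 operator. The operator is given by
   components [dif i j] for all pairs of degrees, zero unless i = j + 1, so that
   no transport along equalities of integers is needed. The condition d d = 0 is
   kept separate ([is_complex], [dgmod]): the Koszul construction below is
   defined by a formula on generators, whose square vanishes because of a
   cancellation between factorizations that is not needed to write it down. *)
Record dmod := DMod {
  gr :> int -> lmodType k;
  dif : forall i j, lin (gr i) (gr j);
  dif_shape : forall i j, i != j + 1 -> dif i j = 0 }.

Definition is_complex (C : dmod) : Prop :=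
  forall i j l, lcomp (dif C j l) (dif C i j) = 0.

Record dgmod := DGMod { dg_dmod :> dmod; dg_sq0 : is_complex dg_dmod }.

Record dhom (C D : dmod) := DHom {
  dh :> forall i, lin (C i) (D i);
  dh_dif : forall i j, lcomp (dh j) (dif C i j) = lcomp (dif D i j) (dh i) }.

Lemma dhom_ext (C D : dmod) (f g : dhom C D) :
  (forall i, f i = g i) -> f = g.
Proof.
case: f g => [f hf] [g hg] /= fg.
have {}fg : f = g by apply: functional_extensionality_dep.
by case: _ / fg hg => hg; congr DHom; apply: Prop_irrelevance.
Qed.

Fact did_dif (C : dmod) i j :
  lcomp (lid (C j)) (dif C i j) = lcomp (dif C i j) (lid (C i)).
Proof. by rewrite lcomp_idl lcomp_idr. Qed.
Definition did (C : dmod) : dhom C C := DHom (@did_dif C).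

Fact dcomp_dif (C D E : dmod) (g : dhom D E) (f : dhom C D) i j :
  lcomp (lcomp (g j) (f j)) (dif C i j) = lcomp (dif E i j) (lcomp (g i) (f i)).
Proof. by rewrite -lcompA dh_dif lcompA dh_dif lcompA. Qed.
Definition dcomp (C D E : dmod) (g : dhom D E) (f : dhom C D) : dhom C E :=
  DHom (dcomp_dif g f).

Section Homology.
Context (C : dmod) (i : int).

Fact cycles0 : forall j, dif C i j 0 = 0.
Proof. by move=> j; rewrite lin_app0. Qed.
Fact cyclesD (x y : C i) : (forall j, dif C i j x = 0) ->
  (forall j, dif C i j y = 0) -> forall j, dif C i j (x + y) = 0.
Proof. by move=> dx dy j; rewrite lin_appD dx dy addr0. Qed.
Fact cyclesZ a (x : C i) :
  (forall j, dif C i j x = 0) -> forall j, dif C i j (a *: x) = 0.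
Proof. by move=> dx j; rewrite lin_appZ dx scaler0. Qed.
Definition cycles : submodule (C i) := Submodule cycles0 cyclesD cyclesZ.

(* Boundaries are taken inside the module of cycles: homology is
   ker / (ker /\ im), which is ker / im as soon as d d = 0. *)
Definition is_boundary (z : sub_mod cycles) : Prop :=
  exists y : C (i + 1), sub_val z = dif C (i + 1) i y.
Fact boundary0 : is_boundary 0.
Proof. by exists 0; rewrite lin_app0. Qed.
Fact boundaryD z w : is_boundary z -> is_boundary w -> is_boundary (z + w).
Proof. by move=> [x zx] [y wy]; exists (x + y); rewrite lin_appD -zx -wy. Qed.
Fact boundaryZ a z : is_boundary z -> is_boundary (a *: z).
Proof. by move=> [x zx]; exists (a *: x); rewrite lin_appZ -zx. Qed.
Definition boundaries : submodule (sub_mod cycles) :=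
  Submodule boundary0 boundaryD boundaryZ.

Definition homology := quot_mod boundaries.
HB.instance Definition _ := GRing.Lmodule.on homology.
End Homology.

Section HomologyMap.
Context (C D : dmod) (f : dhom C D) (i : int).

Fact cycles_map_sub (z : sub_mod (cycles C i)) : cycles D i (f i (sub_val z)).
Proof.
move=> j; have /(congr1 (fun h : lin _ _ => h (sub_val z))) := dh_dif f i j.
by rewrite !lcompE => <-; rewrite (sub_valP z) lin_app0.
Qed.
Fact cycles_map_linear : linear (fun z => mk_sub (cycles_map_sub z)).
Proof. by move=> a z w; apply: val_inj => /=; rewrite lin_appP. Qed.
Definition cycles_map : lin (sub_mod (cycles C i)) (sub_mod (cycles D i)) :=
  mklin cycles_map_linear.

Fact homology_map_sub z : boundaries C i z ->
  lcomp (quot_pi (boundaries D i)) cycles_map z = 0.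
Proof.
move=> [y zy]; rewrite lcompE -[RHS](lin_app0 (quot_pi (boundaries D i))).
apply/quot_eqP; rewrite subr0; exists (f (i + 1) y).
have /(congr1 (fun h : lin _ _ => h y)) := dh_dif f (i + 1) i.
by rewrite !lcompE => <-; rewrite -zy.
Qed.
Definition homology_map : lin (homology C i) (homology D i) :=
  quot_lift homology_map_sub.
End HomologyMap.

Definition quasi_iso (C D : dmod) (f : dhom C D) : Prop :=
  forall i, bijective (homology_map f i).

Definition fibration (C D : dmod) (f : dhom C D) : Prop :=
  forall i y, exists x, f i x = y.

(* Cofibrations are the maps with the left lifting property against acyclic
   fibrations; for 0 -> C this is the lifting of maps out of C. *)
Definition cofibrant (C : dgmod) : Prop :=
  forall (X Y : dgmod) (p : dhom X Y), fibration p -> quasi_iso p ->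
  forall g : dhom C Y, exists h : dhom C X, dcomp p h = g.

(* The identity of C_i = C_j if i = j, and zero otherwise. *)
Definition gcast (C : int -> lmodType k) (i j : int) : lin (C i) (C j) :=
  if i =P j is ReflectT e then ecast j (lin (C i) (C j)) e (lid (C i)) else 0.

Lemma gcast_neq (C : int -> lmodType k) i j : i != j -> gcast C i j = 0.
Proof. by rewrite /gcast; case: eqP. Qed.

Lemma gcast_id (C : int -> lmodType k) i : gcast C i i = lid (C i).
Proof. by rewrite /gcast; case: eqP => // e; rewrite eq_axiomK. Qed.

Section Internal.
Context (C D : dmod).

Definition hom_fam : lmodType k :=
  pi_mod (fun p : int => (pi_mod (fun q : int =>
    (lin (C p) (D q) : lmodType k)) : lmodType k)).

Section Degree.
Context (d : int).
(* Hom(C, D)_d is the product over p of Hom(C_p, D_(p+d)); as for [dif], a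
   homogeneous map is stored by its components C_p -> D_q for all p and q. *)
Definition hom_deg (f : hom_fam) : Prop := forall p q, q != p + d -> f p q = 0.
Fact hom_deg0 : hom_deg 0. Proof. by []. Qed.
Fact hom_degD f g : hom_deg f -> hom_deg g -> hom_deg (f + g).
Proof. by move=> f0 g0 p q pq; rewrite !pi_addE f0// g0// addr0. Qed.
Fact hom_degZ a f : hom_deg f -> hom_deg (a *: f).
Proof. by move=> f0 p q pq; rewrite !pi_scaleE f0// scaler0. Qed.
Definition hom_gr := sub_mod (Submodule hom_deg0 hom_degD hom_degZ).
HB.instance Definition _ := GRing.Lmodule.on hom_gr.
Definition hom_at (f : hom_gr) p q : lin (C p) (D q) := sub_val f p q.
Lemma hom_at0 (f : hom_gr) p q : q != p + d -> hom_at f p q = 0.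
Proof. exact: (sub_valP f). Qed.
Lemma hom_ext (f g : hom_gr) : (forall p q, hom_at f p q = hom_at g p q) -> f = g.
Proof.
move=> fg; apply: val_inj; apply: functional_extensionality_dep => p.
by apply: functional_extensionality_dep => q; apply: fg.
Qed.
Definition hom_mk (f : hom_fam) (hf : hom_deg f) : hom_gr :=
  @mk_sub _ _ (Submodule hom_deg0 hom_degD hom_degZ) f hf.
End Degree.

Definition hom_dif_fam (d e : int) (f : hom_gr d) : hom_fam := fun p q =>
  if d == e + 1 then
    lcomp (dif D (q + 1) q) (hom_at f p (q + 1))
    - sg d *: lcomp (hom_at f (p - 1) q) (dif C p (p - 1))
  else 0.

Fact hom_dif_deg d e (f : hom_gr d) : hom_deg e (hom_dif_fam e f).
Proof.
move=> p q pq; rewrite /hom_dif_fam; case: eqP => // de.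
rewrite !hom_at0 ?lcomp0l ?lcomp0r ?scaler0 ?subr0//; lia.
Qed.
Fact hom_dif_linear d e : linear (fun f : hom_gr d => hom_mk (@hom_dif_deg d e f)).
Proof.
move=> a f g; apply: hom_ext => p q.
rewrite /hom_at /= !pi_addE !pi_scaleE /hom_dif_fam; case: eqP => _; last first.
  by rewrite scaler0 addr0.
rewrite /hom_at /= !pi_addE !pi_scaleE lcompDl lcompDr lcompZl lcompZr.
by rewrite !scalerDr scalerN opprD !scalerA [a * _]mulrC addrACA.
Qed.
Definition hom_dif d e : lin (hom_gr d) (hom_gr e) := mklin (@hom_dif_linear d e).

Fact hom_dif_shape d e : d != e + 1 -> hom_dif d e = 0.
Proof.
move=> /negbTE de; apply: lin_ext => f; apply: hom_ext => p q.
by rewrite /hom_at /= /hom_dif_fam de.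
Qed.
Definition hom_dg : dmod := DMod (gr := fun d => hom_gr d : lmodType k) hom_dif_shape.
End Internal.

Section Concentrated.
Definition conc_gr (M : lmodType k) (i : int) : lmodType k :=
  match i with Posz 0 => M | _ => 'rV[k]_0 end.
Definition conc (M : lmodType k) : dmod :=
  @DMod (conc_gr M) (fun i j => 0) (fun i j _ => erefl).

Definition conc_map_gr (M N : lmodType k) (f : lin M N) (i : int) :
    lin (conc_gr M i) (conc_gr N i) :=
  match i with Posz 0 => f | _ => lid _ end.
Fact conc_map_dif (M N : lmodType k) (f : lin M N) i j :
  lcomp (conc_map_gr f j) (dif (conc M) i j) =
  lcomp (dif (conc N) i j) (conc_map_gr f i).
Proof. by rewrite lcomp0l lcomp0r. Qed.
Definition conc_map (M N : lmodType k) (f : lin M N) : dhom (conc M) (conc N) :=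
  @DHom (conc M) (conc N) (conc_map_gr f) (conc_map_dif f).
End Concentrated.

End DgModules.

(* t_0 -> t_1 -> ... -> t_n = 1, where t_i is 'I_(lvl i), prolonged by the
   identities of 1 in the levels above n. Levels i >= n have a unique vertex and
   carry no information, hence trees of height n and their morphisms are
   counted exactly once. *)
Record tree (n : nat) := Tree {
  lvl : nat -> nat;
  par : forall i, 'I_(lvl i) -> 'I_(lvl i.+1);
  par_mono : forall i (x y : 'I_(lvl i)), (x <= y)%N -> (par x <= par y)%N;
  par_surj : forall i (y : 'I_(lvl i.+1)), exists x, par x = y;
  lvl_root : forall i, (n <= i)%N -> lvl i = 1%N }.

Section Trees.
Context (n : nat).
HB.instance Definition _ := gen_eqMixin (tree n).
HB.instance Definition _ := gen_choiceMixin (tree n).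

Record thom (t s : tree n) := THom {
  tmap :> forall i, 'I_(lvl t i) -> 'I_(lvl s i);
  tmap_surj : forall i (y : 'I_(lvl s i)), exists x, tmap x = y;
  tmap_par : forall i (x : 'I_(lvl t i)), par (tmap x) = tmap (par x);
  tmap_mono : forall i (x y : 'I_(lvl t i)),
    par x = par y -> (x <= y)%N -> (tmap x <= tmap y)%N }.
Arguments tmap {t s} _ i x.
HB.instance Definition _ t s := gen_eqMixin (thom t s).
HB.instance Definition _ t s := gen_choiceMixin (thom t s).

Lemma thom_ext t s (u v : thom t s) : (forall i x, u i x = v i x) -> u = v.
Proof.
case: u v => [u us up um] [v vs vp vm] /= uv.
have {}uv : u = v.
  by apply: functional_extensionality_dep => i; apply: funext => x; apply: uv.
by case: _ / uv vs vp vm => vs vp vm; congr THom; apply: Prop_irrelevance.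
Qed.

Fact tid_surj (t : tree n) i (y : 'I_(lvl t i)) : exists x, x = y.
Proof. by exists y. Qed.
Definition tid (t : tree n) : thom t t :=
  @THom t t (fun i x => x) (@tid_surj t) (fun i x => erefl)
    (fun i x y _ xy => xy).

Section Comp.
Context (t s r : tree n) (v : thom s r) (u : thom t s).
Fact tcomp_surj i (y : 'I_(lvl r i)) : exists x, v i (u i x) = y.
Proof.
by have [z <-] := tmap_surj v y; have [x <-] := tmap_surj u z; exists x.
Qed.
Fact tcomp_par i (x : 'I_(lvl t i)) : par (v i (u i x)) = v i.+1 (u i.+1 (par x)).
Proof. by rewrite !tmap_par. Qed.
Fact tcomp_mono i (x y : 'I_(lvl t i)) :
  par x = par y -> (x <= y)%N -> (v i (u i x) <= v i (u i y))%N.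
Proof.
move=> pxy xy; apply: tmap_mono; first by rewrite !tmap_par pxy.
exact: tmap_mono.
Qed.
Definition tcomp : thom t r :=
  @THom t r (fun i x => v i (u i x)) tcomp_surj tcomp_par tcomp_mono.
End Comp.

Lemma tcompA t s r q (w : thom r q) (v : thom s r) (u : thom t s) :
  tcomp w (tcomp v u) = tcomp (tcomp w v) u.
Proof. exact: thom_ext. Qed.
Lemma tcomp_idl t s (u : thom t s) : tcomp (tid s) u = u.
Proof. exact: thom_ext. Qed.
Lemma tcomp_idr t s (u : thom t s) : tcomp u (tid t) = u.
Proof. exact: thom_ext. Qed.

Definition tdeg (t : tree n) : nat := (\sum_(i < n) lvl t i)%N.
Definition hdeg t s (u : thom t s) : int := (tdeg t)%:Z - (tdeg s)%:Z.

Lemma hdeg_comp t s r (v : thom s r) (u : thom t s) :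
  hdeg (tcomp v u) = hdeg v + hdeg u.
Proof. by rewrite /hdeg [RHS]addrC addrA subrK. Qed.

Definition vtx (t : tree n) := {i : nat & 'I_(lvl t i)}.

(* The subtree above x in preorder: x, then its children from left to right, each
   followed by its own subtree. *)
Fixpoint dfs (t : tree n) (i : nat) : 'I_(lvl t i) -> seq (vtx t) :=
  match i with
  | 0 => fun x => [:: Tagged (fun i => 'I_(lvl t i)) x]
  | i'.+1 => fun x => Tagged (fun i => 'I_(lvl t i)) x ::
      flatten [seq dfs y | y <- enum 'I_(lvl t i') & par y == x]
  end.

(* All vertices of level < n (the root is excluded), for n > 0. *)
Definition vertices (t : tree n) : seq (vtx t) :=
  flatten [seq dfs x | x <- enum 'I_(lvl t n.-1)].

(* When b is a reordering of the repetition-free sequence a of degree 1 symbols,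
   (-1) ^ inversions a b is the Koszul sign of the reordering: every exchange of
   two symbols contributes -1. *)
Definition inversions (T : eqType) (a b : seq T) : nat :=
  (\sum_(x <- a) \sum_(y <- a)
     ((index x a < index y a) && (index y b < index x b))%N)%N.

Definition vmap t s (u : thom t s) (x : vtx t) : vtx s :=
  Tagged (fun i => 'I_(lvl s i)) (u (tag x) (tagged x)).

(* For u of degree 1 merging x_i and x_j: the sequence x_i, x_j, followed by the
   other vertices in depth-first order. *)
Definition merged_first t s (u : thom t s) : seq (vtx t) :=
  let m (x : vtx t) :=
    has (fun y => (y != x) && (vmap u y == vmap u x)) (vertices t) in
  [seq x <- vertices t | m x] ++ [seq x <- vertices t | ~~ m x].

(* The image under u of [merged_first u] is x_ij, x_ij, r_1, r_2, ...; dropping its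
   head replaces the two symbols x_i, x_j by the single symbol x_ij. Only
   meaningful for u of degree 1. *)
Definition sgn_exp t s (u : thom t s) : nat :=
  (inversions (vertices t) (merged_first u) +
   inversions (behead (map (vmap u) (merged_first u))) (vertices s))%N.

(* A pair of composable morphisms t -> fmid -> s. *)
Record factor (t s : tree n) := Factor {
  fmid : tree n; fouter : thom fmid s; finner : thom t fmid }.
HB.instance Definition _ t s := gen_eqMixin (factor t s).
HB.instance Definition _ t s := gen_choiceMixin (factor t s).

Section Finite.
Context (t s : tree n) (u : thom t s).
Local Open Scope classical_set_scope.

Definition factorization : set (factor t s) := [set f | tcomp (fouter f) (finner f) = u].

Let B := tdeg t.
Let code (f : factor t s) : {ffun 'I_n -> 'I_B.+1} *
    {ffun 'I_n * 'I_B.+1 -> 'I_B.+1} :=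
  ([ffun i : 'I_n => inord (lvl (fmid f) i)],
   [ffun ix : 'I_n * 'I_B.+1 =>
      if (insub (val ix.2) : option 'I_(lvl t ix.1)) is Some x
      then inord (finner f ix.1 x) else ord0]).

(* A factorization t -> r -> s of u is determined by the sizes of the levels of
   r and the values of t -> r, all bounded by [tdeg t]; there are thus finitely
   many, and the sums over factorizations below are genuine finite sums. *)
Fact lvl_le_tdeg (i : 'I_n) : (lvl t i <= B)%N.
Proof. by rewrite /B /tdeg (bigD1 i)//= leq_addr. Qed.

Fact lvl_le (r : tree n) (v : thom t r) i : (lvl r i <= lvl t i)%N.
Proof.
have [g gK] : exists g : 'I_(lvl r i) -> 'I_(lvl t i), cancel g (v i).
  have h y : exists x, v i x = y by exact: tmap_surj.
  by exists (fun y => projT1 (cid (h y))) => y; case: (cid (h y)).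
by have := leq_card g (can_inj gK); rewrite !card_ord.
Qed.

Fact code_inj : {in factorization &, injective code}.
Proof.
move=> [r v w] [r' v' w'] /set_mem /= vw /set_mem /= vw'.
rewrite /code /= => -[/ffunP elvl /ffunP ew].
have el (i : 'I_n) : lvl r i = lvl r' i.
  have := elvl i; rewrite !ffunE => /(congr1 val) /=.
  by rewrite !inordK// ltnS; apply: leq_trans (lvl_le_tdeg i); apply: lvl_le.
have ewx i (x : 'I_(lvl t i)) : (w i x : nat) = w' i x.
  have [ni|ilt] := leqP n i.
    have := ltn_ord (w i x); have := ltn_ord (w' i x).
    have := lvl_root r ni; have := lvl_root r' ni.
    by move: (w i x : nat) (w' i x : nat) => a b -> ->; case: a; case: b.
  have xB : (x < B.+1)%N.
    by apply: (leq_trans (ltn_ord x)); apply: leqW; apply: (lvl_le_tdeg (Ordinal ilt)).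
  have /(congr1 val) := ew (Ordinal ilt, Ordinal xB); rewrite !ffunE /=.
  rewrite valK /=.
  have lB (q : tree n) (z : thom t q) : (z i x < B.+1)%N.
    apply: (leq_trans (ltn_ord (z i x))); apply: leqW.
    by apply: (leq_trans (lvl_le z i)); apply: (lvl_le_tdeg (Ordinal ilt)).
  by rewrite !inordK.
have {}el : lvl r = lvl r'.
  apply: funext => i; have [ni|ilt] := leqP n i; last exact: (el (Ordinal ilt)).
  by rewrite !lvl_root.
case: r r' => [l p pm ps lr] [l' p' pm' ps' lr'] /= in v w v' w' vw vw' el ewx elvl ew *.
case: _ / el p' pm' ps' lr' v' w' vw' ewx elvl ew => p' pm' ps' lr' v' w' vw' ewx _ _.
have {}ewx i x : w i x = w' i x by apply: val_inj; apply: ewx.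
have pp : p = p'.
  apply: functional_extensionality_dep => i; apply: funext => y.
  have [x <-] := tmap_surj w y.
  have e1 : p i (w i x) = w i.+1 (par x) := tmap_par w x.
  have e2 : p' i (w' i x) = w' i.+1 (par x) := tmap_par w' x.
  by rewrite e1 [in LHS]ewx [in RHS]ewx e2.
case: _ / pp pm' ps' v' w' vw' ewx => pm' ps' v' w' vw' ewx.
rewrite (Prop_irrelevance pm' pm) (Prop_irrelevance ps' ps) (Prop_irrelevance lr' lr)
 in v' w' vw' ewx *.
have ww : w = w' by apply: thom_ext.
case: _ / ww vw' ewx => vw' _; congr Factor; apply: thom_ext => i y.
have [x <-] := tmap_surj w y.
have := congr1 (fun h : thom _ _ => h i x) (etrans vw (esym vw')).
by [].
Qed.

Lemma factorization_finite : finite_set factorization.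
Proof.
rewrite -(eq_finite_set (inj_card_eq code_inj)).
exact: finite_finset.
Qed.
End Finite.
End Trees.

Section Diagrams.
Context (k : comPzRingType) (n : nat).

Record diagram := Diagram {
  dob :> tree n -> dmod k;
  dmap : forall t s, thom t s -> dhom (dob t) (dob s);
  dmap_id : forall t, dmap (tid t) = did (dob t);
  dmap_comp : forall t s r (v : thom s r) (u : thom t s),
    dmap (tcomp v u) = dcomp (dmap v) (dmap u) }.
Arguments dmap _ {t s} u.

Record codiagram := Codiagram {
  cob :> tree n -> dmod k;
  cmap : forall t s, thom t s -> dhom (cob s) (cob t);
  cmap_id : forall t, cmap (tid t) = did (cob t);
  cmap_comp : forall t s r (v : thom s r) (u : thom t s),
    cmap (tcomp v u) = dcomp (cmap u) (cmap v) }.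
Arguments cmap _ {t s} u.

Record dgdiagram := DGDiagram {
  dg_diagram :> diagram;
  dg_diagram_sq0 : forall t, is_complex (dg_diagram t) }.

Definition dg_ob (S : dgdiagram) (t : tree n) : dgmod k :=
  DGMod (dg_diagram_sq0 S t).

Record dnat (F G : diagram) := DNat {
  dn :> forall t, dhom (F t) (G t);
  dn_nat : forall t s (u : thom t s),
    dcomp (dn s) (dmap F u) = dcomp (dmap G u) (dn t) }.

Record cnat (F G : codiagram) := CNat {
  cn :> forall t, dhom (F t) (G t);
  cn_nat : forall t s (u : thom t s),
    dcomp (cn t) (cmap F u) = dcomp (cmap G u) (cn s) }.

Section HomDiagrams.
Context (F G : diagram).

Section Degree.
Context (d : int).
Definition nat_fam : lmodType k :=
  pi_mod (fun t : tree n => (hom_gr (F t) (G t) d : lmodType k)).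
(* The end: families f_t in Hom(F t, G t)_d with G(u) f_t = f_s F(u). *)
Definition is_end (f : nat_fam) : Prop := forall t s (u : thom t s) p q,
  lcomp (dmap G u q) (hom_at (f t) p q) = lcomp (hom_at (f s) p q) (dmap F u p).
Fact is_end0 : is_end 0.
Proof. by move=> t s u p q; rewrite [RHS]lcomp0l [LHS]lcomp0r. Qed.
Fact is_endD f g : is_end f -> is_end g -> is_end (f + g).
Proof.
move=> ef eg t s u p q.
by rewrite [LHS]lcompDr [RHS]lcompDl ef eg.
Qed.
Fact is_endZ a f : is_end f -> is_end (a *: f).
Proof.
by move=> ef t s u p q; rewrite [LHS]lcompZr [RHS]lcompZl ef.
Qed.
Definition nat_gr := sub_mod (Submodule is_end0 is_endD is_endZ).
HB.instance Definition _ := GRing.Lmodule.on nat_gr.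
Definition nat_at (f : nat_gr) t : hom_gr (F t) (G t) d := sub_val f t.
Definition nat_mk (f : nat_fam) (ef : is_end f) : nat_gr :=
  @mk_sub _ _ (Submodule is_end0 is_endD is_endZ) f ef.
End Degree.

Definition nat_dif_fam d e (f : nat_gr d) : nat_fam e :=
  fun t => hom_dif (F t) (G t) d e (nat_at f t).
Fact nat_dif_end d e (f : nat_gr d) : is_end (nat_dif_fam e f).
Proof.
move=> t s u p q; rewrite /hom_at /= /hom_dif_fam; case: eqP => _; last first.
  by rewrite lcomp0l lcomp0r.
have ef := sub_valP f : is_end (sub_val f).
rewrite -!scaleNr !lcompDl !lcompDr !lcompZl !lcompZr; congr (_ + _ *: _).
  by rewrite lcompA dh_dif -!lcompA ef.
by rewrite lcompA ef -!lcompA dh_dif.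
Qed.
Fact nat_dif_linear d e : linear (fun f : nat_gr d => nat_mk (@nat_dif_end d e f)).
Proof.
move=> a f g; apply: val_inj; apply: functional_extensionality_dep => t.
exact: (lin_appP (hom_dif (F t) (G t) d e)).
Qed.
Definition nat_dif d e : lin (nat_gr d) (nat_gr e) := mklin (@nat_dif_linear d e).
Fact nat_dif_shape d e : d != e + 1 -> nat_dif d e = 0.
Proof.
move=> de; apply: lin_ext => f; apply: val_inj.
apply: functional_extensionality_dep => t.
by rewrite /= /nat_dif_fam hom_dif_shape.
Qed.
Definition hom_diag : dmod k :=
  DMod (gr := fun d => nat_gr d : lmodType k) nat_dif_shape.
End HomDiagrams.

Section Koszul.
Context (S : codiagram) (T : diagram).

(* S'(s) (x) k{u} (x) T'(t), in degree m, is the sum over p of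
   S'(s)_p (x) T'(t)_(m - deg u - p): the index consists of u : t -> s and p. *)
Record kidx := KIdx {
  ksrc : tree n; ktgt : tree n; kmor : thom ksrc ktgt; kdeg : int }.
HB.instance Definition _ := gen_eqMixin kidx.
HB.instance Definition _ := gen_choiceMixin kidx.

Definition ksummand (m : int) (j : kidx) : lmodType k :=
  tensor (S (ktgt j) (kdeg j)) (T (ksrc j) (m - hdeg (kmor j) - kdeg j)).
Definition kgr (m : int) : lmodType k := dsum (ksummand m).

(* x (x) y |-> x (x) {u} (x) y *)
Definition kin (m : int) (t s : tree n) (u : thom t s) (p : int) :
    lin (tensor (S s p) (T t (m - hdeg u - p))) (kgr m) :=
  dsum_in (ksummand m) (KIdx u p).

Definition sgn (t s : tree n) (u : thom t s) : k := (-1) ^+ sgn_exp u.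

Local Open Scope classical_set_scope.

Definition outer1 (t s : tree n) (u : thom t s) : set (factor t s) :=
  factorization u `&` [set f | hdeg (fouter f) = 1].
Definition inner1 (t s : tree n) (u : thom t s) : set (factor t s) :=
  factorization u `&` [set f | hdeg (finner f) = 1].

Section Dif.
Context (m m' : int) (t s : tree n) (u : thom t s) (p : int).
Let q := m - hdeg u - p.

(* The internal differential, with sign (-1)^(deg x + deg u) on the second
   factor. The casts, here and below, identify equal degrees when m = m' + 1 and
   vanish otherwise. *)
Definition kdif_int : lin (tensor (S s p) (T t q)) (kgr m') :=
  lcomp (kin m' u (p - 1))
    (tens_map (dif (S s) p (p - 1)) (gcast (T t) q _))
  + sg k (p + hdeg u) *:
    lcomp (kin m' u p) (tens_map (lid (S s p)) (dif (T t) q _)).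

(* (-1)^(deg x) times the sum of sgn(v) v^*(x) (x) {w} (x) y over u = v w,
   deg v = 1. *)
Definition kdif_outer : lin (tensor (S s p) (T t q)) (kgr m') :=
  sg k p *: \sum_(f \in outer1 u) sgn (fouter f) *:
    lcomp (kin m' (finner f) p)
      (tens_map (cmap S (fouter f) p) (gcast (T t) q _)).

(* (-1)^(deg x + deg u) times the sum of sgn(w) x (x) {v} (x) w_*(y) over u = v w,
   deg w = 1. *)
Definition kdif_inner : lin (tensor (S s p) (T t q)) (kgr m') :=
  sg k (p + hdeg u) *: \sum_(f \in inner1 u) sgn (finner f) *:
    lcomp (kin m' (fouter f) p)
      (tens_map (lid (S s p))
         (lcomp (gcast (T (fmid f)) q _) (dmap T (finner f) q))).
End Dif.

Definition kdif_at m m' (j : kidx) : lin (ksummand m j) (kgr m') :=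
  kdif_int m m' (kmor j) (kdeg j) + kdif_outer m m' (kmor j) (kdeg j)
  + kdif_inner m m' (kmor j) (kdeg j).

Definition kdif m m' : lin (kgr m) (kgr m') := dsum_lift (kdif_at m m').

Lemma kdif_kin m m' (t s : tree n) (u : thom t s) p :
  lcomp (kdif m m') (kin m u p) = kdif_at m m' (KIdx u p).
Proof. exact: (dsum_lift_in (kdif_at m m') (KIdx u p)). Qed.

Fact kdif_shape m m' : m != m' + 1 -> kdif m m' = 0.
Proof.
move=> mm'; apply: dsum_ext => j x; rewrite dsum_liftE; move: x.
suff -> : kdif_at m m' j = 0 by [].
case: j => t s u p; rewrite /kdif_at /kdif_int /kdif_outer /kdif_inner /=.
rewrite gcast_neq ?tens_map0r ?lcomp0r; last by lia.
rewrite dif_shape ?tens_map0r ?lcomp0r ?scaler0 ?addr0 ?add0r; last by lia.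
rewrite !fsbig1 ?scaler0 ?addr0// => f [] /= fu f1;
  have := hdeg_comp (fouter f) (finner f); rewrite [tcomp _ _]fu f1 => uE;
  by rewrite gcast_neq ?lcomp0l ?tens_map0r ?lcomp0r ?scaler0//; lia.
Qed.

Definition koszul : dmod k := DMod kdif_shape.
End Koszul.

Section KoszulMap.
Context (S S' : codiagram) (T : diagram) (eta : cnat S S').

Definition kmap m : lin (kgr S T m) (kgr S' T m) :=
  dsum_lift (fun j : kidx => lcomp (kin S' T m (kmor j) (kdeg j))
    (tens_map (eta (ktgt j) (kdeg j)) (lid _))).

Lemma kmapE m (t s : tree n) (u : thom t s) p :
  lcomp (kmap m) (kin S T m u p) =
  lcomp (kin S' T m u p) (tens_map (eta s p) (lid _)).
Proof. by apply: lin_ext => x; rewrite lcompE /kmap /kin dsum_liftE. Qed.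

Fact cn_natE (t s : tree n) (u : thom t s) p :
  lcomp (eta t p) (cmap S u p) = lcomp (cmap S' u p) (eta s p).
Proof. exact: (congr1 (fun h : dhom _ _ => dh h p) (cn_nat eta u)). Qed.

Fact kmap_kin m (t s : tree n) (u : thom t s) p (M N : lmodType k)
    (a : lin M (S s p)) (b : lin N (T t (m - hdeg u - p))) :
  lcomp (kmap m) (lcomp (kin S T m u p) (tens_map a b)) =
  lcomp (kin S' T m u p) (tens_map (lcomp (eta s p) a) b).
Proof. by rewrite lcompA kmapE -lcompA tens_map_comp lcomp_idl. Qed.

Fact kin_tens m (t s : tree n) (u : thom t s) p (M M' N : lmodType k)
    (a : lin M (S' s p)) (e : lin M' M) (b : lin N (T t (m - hdeg u - p))) :
  lcomp (lcomp (kin S' T m u p) (tens_map a b)) (tens_map e (lid N)) =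
  lcomp (kin S' T m u p) (tens_map (lcomp a e) b).
Proof. by rewrite -lcompA tens_map_comp lcomp_idr. Qed.

Section AtIndex.
Context (m m' : int) (t s : tree n) (u : thom t s) (p : int).
Local Notation e := (tens_map (eta s p) (lid (T t (m - hdeg u - p)))).

Fact kmap_dif_int :
  lcomp (kmap m') (kdif_int S T m m' u p) = lcomp (kdif_int S' T m m' u p) e.
Proof.
rewrite /kdif_int lcompDr lcompDl lcompZr lcompZl !kmap_kin !kin_tens.
by rewrite dh_dif lcomp_idl lcomp_idr.
Qed.

Fact kmap_dif_outer :
  lcomp (kmap m') (kdif_outer S T m m' u p) = lcomp (kdif_outer S' T m m' u p) e.
Proof.
have finl : finite_set (outer1 u) by apply: finite_setIl; exact: factorization_finite.
rewrite /kdif_outer lcompZr lcompZl !fsbig_finite// lcomp_sumr lcomp_suml.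
by congr (_ *: _); apply: eq_bigr => f _; rewrite lcompZr lcompZl kmap_kin kin_tens cn_natE.
Qed.

Fact kmap_dif_inner :
  lcomp (kmap m') (kdif_inner S T m m' u p) = lcomp (kdif_inner S' T m m' u p) e.
Proof.
have finr : finite_set (inner1 u) by apply: finite_setIl; exact: factorization_finite.
rewrite /kdif_inner lcompZr lcompZl !fsbig_finite// lcomp_sumr lcomp_suml.
congr (_ *: _); apply: eq_bigr => f _; rewrite lcompZr lcompZl kmap_kin kin_tens.
by rewrite lcomp_idl lcomp_idr.
Qed.
End AtIndex.

Fact kmap_dif_at m m' (j : kidx) :
  lcomp (kmap m') (kdif_at S T m m' j) =
  lcomp (kdif_at S' T m m' j) (tens_map (eta (ktgt j) (kdeg j)) (lid _)).
Proof.
rewrite /kdif_at 2!lcompDr 2!lcompDl.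
by rewrite kmap_dif_int kmap_dif_outer kmap_dif_inner.
Qed.

Fact kmap_dif m m' :
  lcomp (kmap m') (kdif S T m m') = lcomp (kdif S' T m m') (kmap m).
Proof.
apply: dsum_lin_ext => -[t s u p]; rewrite -/(kin S T m u p).
by rewrite -2!lcompA kmapE kdif_kin kmap_dif_at lcompA kdif_kin.
Qed.

Definition koszul_map : dhom (koszul S T) (koszul S' T) :=
  @DHom k (koszul S T) (koszul S' T) kmap kmap_dif.
End KoszulMap.

Section Representable.
Context (f : tree n).

(* t |-> the free module on the morphisms t -> f, in degree 0. *)
Definition rep_ob (t : tree n) : dmod k := conc (free_mod k (thom t f)).
Definition rep_map (t s : tree n) (u : thom t s) : dhom (rep_ob s) (rep_ob t) :=
  conc_map (free_map k (fun v : thom s f => tcomp v u)).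
Fact rep_id (t : tree n) : rep_map (tid t) = did (rep_ob t).
Proof.
apply: dhom_ext => -[[|i]|i] //=; apply: free_ext => v.
by rewrite free_mapE tcomp_idr.
Qed.
Fact rep_comp (t s r : tree n) (v : thom s r) (u : thom t s) :
  rep_map (tcomp v u) = dcomp (rep_map u) (rep_map v).
Proof.
apply: dhom_ext => -[[|i]|i] /=; [|exact: lin_ext..].
by apply: free_ext => w; rewrite lcompE !free_mapE tcompA.
Qed.
Definition representable : codiagram := Codiagram rep_id rep_comp.
End Representable.

Section RepresentableMap.
Context (f g : tree n) (w : thom f g).
Definition rep_push_at (t : tree n) : dhom (representable f t) (representable g t) :=
  conc_map (free_map k (fun v : thom t f => tcomp w v)).
Fact rep_push_nat (t s : tree n) (u : thom t s) :
  dcomp (rep_push_at t) (cmap (representable f) u) = dcomp (cmap (representable g) u) (rep_push_at s).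
Proof.
apply: dhom_ext => -[[|i]|i] /=; [|exact: lin_ext..].
by apply: free_ext => v; rewrite !lcompE !free_mapE tcompA.
Qed.
Definition rep_push : cnat (representable f) (representable g) := CNat rep_push_nat.
End RepresentableMap.

Section KoszulDiagram.
Context (S : diagram).

Fact koszul_id (f : tree n) :
  koszul_map S (rep_push (tid f)) = did (koszul (representable f) S).
Proof.
apply: dhom_ext => m; apply: dsum_lin_ext => -[t s u p].
rewrite -/(kin (representable f) S m u p) [LHS]kmapE [RHS]lcomp_idl.
have e : dh (rep_push (tid f) s) p = lid (representable f s p).
  by case: p => [[|i]|i] //=; apply: free_ext => v; rewrite free_mapE tcomp_idl.
by rewrite e tens_map_id lcomp_idr.
Qed.

Fact koszul_comp (f g h : tree n) (w : thom g h) (v : thom f g) :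
  koszul_map S (rep_push (tcomp w v)) =
  dcomp (koszul_map S (rep_push w)) (koszul_map S (rep_push v)).
Proof.
apply: dhom_ext => m; apply: dsum_lin_ext => -[t s u p].
rewrite -/(kin (representable f) S m u p) [LHS]kmapE -[RHS]lcompA kmapE lcompA kmapE.
rewrite -lcompA tens_map_comp.
have e : lcomp (dh (rep_push w s) p) (dh (rep_push v s) p) =
    dh (rep_push (tcomp w v) s) p.
  case: p => [[|i]|i] /=; [|exact: lcomp_idl..].
  by apply: free_ext => z; rewrite lcompE !free_mapE tcompA.
by rewrite e lcomp_idl.
Qed.

(* f |-> K(Omega(-, f), Omega, S), functorial by composition on the left. *)
Definition koszul_diagram : diagram := Diagram koszul_id koszul_comp.
End KoszulDiagram.

Definition dg_cofibrant (S : dgdiagram) : Prop :=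
  forall t, cofibrant (dg_ob S t).

(* Cofibrant objects of the projective model structure, whose weak equivalences
   and fibrations are defined objectwise. *)
Definition diag_cofibrant (Q : dgdiagram) : Prop :=
  forall (X Y : dgdiagram) (p : dnat X Y),
  (forall t, fibration (p t)) -> (forall t, quasi_iso (p t)) ->
  forall g : dnat Q Y, exists h : dnat Q X, forall t, dcomp (p t) (h t) = g t.

Record cofibrant_replacement (S : dgdiagram) := CofibrantReplacement {
  crep :> dgdiagram;
  crep_map : dnat crep S;
  crep_cofibrant : diag_cofibrant crep;
  crep_weq : forall t, quasi_iso (crep_map t) }.

(* Cohomological degree d is homological degree -d. *)
Definition Ext (S : dgdiagram) (Q : cofibrant_replacement S) (T : dgdiagram)
    (d : int) : lmodType k :=
  homology (hom_diag Q T) (- d).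

End Diagrams.

(* Main.v *)
(* Write K = K(Omega, Omega, S). Both the cofibrant replacement Q and K are
   resolutions of S among diagrams F with the following property: every natural
   chain map from F to an objectwise acyclic diagram is naturally contractible. For
   Q, lift against the path object. For K, a natural map is determined by its values
   on the generators 1 (x) {u} (x) y, and a contraction is built by induction on
   deg u, using contractions of maps out of the cofibrant dg-modules S(t). Two such
   resolutions are homotopy equivalent, hence have quasi-isomorphic Hom(-, T).

   The squared differential of K vanishes because a morphism of degree two has
   exactly two factorizations into morphisms of degree one, of opposite signs.

   That the augmentation K -> S is a quasi-isomorphism is shown by algebraic Morse
   theory. For fixed phi and t, the cells of K(phi) are the factorizations
   t -u-> r -v-> phi. Those with composite w are matched by looking at the first
   level, counted from level 0, at which u fails to be the injective map which
   reverses the order on each fiber of (u o par, w), and at the first vertex a of that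
   level witnessing the failure: if a is alone in its u-class, the class is merged with
   the next one, and otherwise a is split off. The only unmatched cell is the pair of
   identities of phi. *)

From HB Require Import structures.
Require Import Defs.
From mathcomp Require Import all_boot all_order all_algebra.
From mathcomp Require Import finmap.
From mathcomp Require Import boolp classical_sets functions cardinality fsbigop.
From mathcomp Require Import zify.
Set Implicit Arguments. Unset Strict Implicit. Unset Printing Implicit Defensive.
Import Order.TTheory GRing.Theory Num.Theory.
Local Open Scope ring_scope.

(** * Trees and factorizations *)

(** A factorization of w is handled through the total preorders that its inner map induces on the
    levels of the source. They determine it, and preorders compatible with parents, with the order
    of siblings and with w come from a factorization. Factorizations are thus built from numerical
    keys and compared through vertex numbers in [nat], which avoids equalities between middle trees.

    Reversal is the useful normal form because morphisms preserve the order of siblings: a level can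
    be reversed only where w separates siblings inside the fibers. A reversed level is moreover
    reconstructed from the level above it, so a merge or split at the first bad level extends to the
    lower levels in one way.

    Morse theory needs the matching to be acyclic, although the sources of the cells over phi have
    unbounded degree. Acyclicity is expressed by a rank in [nat] that also decreases when the source
    shrinks; finite support then gives the inductions a start.

    The same matching, applied to a morphism of degree two, finds its two factorizations, so no case
    analysis on trees is required there. *)

Section InitialSegments.
Local Open Scope nat_scope.

Definition initial (T : Type) (f : T -> nat) :=
  forall x m, m < f x -> exists y, f y = m.

(** The value at x counts the classes of the preorder strictly below x. This identifies a map of
    levels from its preorder alone, even when the targets are levels of different trees. *)
Lemma initial_unique (T : Type) (f g : T -> nat) : initial f -> initial g ->
  (forall x y, (f x <= f y) = (g x <= g y)) -> f =1 g.
Proof.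
move=> fi gi fg.
have fglt x y : (f x < f y) = (g x < g y) by rewrite !ltnNge fg.
move=> x; move: {2}(f x) (erefl (f x)) => m; elim/ltn_ind: m x => m IH x fx.
have [lt|gt|//] := ltngtP (f x) (g x).
  have [y gy] := gi x _ lt.
  have fy : f y < f x by rewrite fglt gy.
  by have := IH (f y); rewrite -fx => /(_ fy y erefl); lia.
have [y fy] := fi x _ gt.
have fyx : f y < f x by rewrite fy.
have := IH (f y); rewrite -fx => /(_ fyx y erefl) e.
by move: fyx; rewrite fglt -e fy ltnn.
Qed.

Lemma surj_initial (T : Type) p (f : T -> 'I_p) :
  (forall y, exists x, f x = y) -> initial (fun x => f x : nat).
Proof.
move=> fs x q qf; have qp : q < p by apply: ltn_trans (ltn_ord (f x)).
by have [y fy] := fs (Ordinal qp); exists y; rewrite fy.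
Qed.

Lemma id_initial m : initial (fun x : 'I_m => x : nat).
Proof. by move=> x q qx; exists (Ordinal (ltn_trans qx (ltn_ord x))). Qed.

Lemma lex_leq B a a' b b' : b < B -> b' < B ->
  (a * B + b <= a' * B + b') = (a < a') || (a == a') && (b <= b').
Proof.
move=> bB b'B; case: (ltngtP a a') => /= [lt|gt|->]; last by rewrite leq_add2l.
  have : a.+1 * B <= a' * B by rewrite leq_mul2r lt orbT.
  by rewrite mulSn; lia.
have : a'.+1 * B <= a * B by rewrite leq_mul2r gt orbT.
by rewrite mulSn; lia.
Qed.

Lemma lex_ltn B a a' b b' : b < B -> b' < B ->
  (a < a') || (a == a') && (b < b') -> a * B + b < a' * B + b'.
Proof.
move=> bB b'B h; rewrite ltnNge lex_leq// negb_or -leqNgt negb_and -ltnNge.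
by case/orP: h => [|/andP[/eqP -> ->]]; [rewrite ltn_neqAle eq_sym => /andP[-> ->]|
  rewrite eqxx leqnn].
Qed.

End InitialSegments.

Section Trees.
Context (n : nat).
Implicit Types t s r : tree n.
Local Open Scope nat_scope.

Lemma par_mono_lt t i (x y : 'I_(lvl t i)) : par x < par y -> x < y.
Proof. by apply: contraTT; rewrite -!leqNgt; exact: par_mono. Qed.

Section Key.
Context (t : tree n) (g : forall {i}, 'I_(lvl t i) -> nat).
Hypothesis g_par : forall i (x y : 'I_(lvl t i)), g x <= g y -> g (par x) <= g (par y).
Hypothesis g_mono : forall i (x y : 'I_(lvl t i)), par x = par y -> x <= y -> g x <= g y.

Let keys i := sort leq (undup [seq g x | x <- enum 'I_(lvl t i)]).
Let klvl i := size (keys i).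

Let key_mem i (x : 'I_(lvl t i)) : g x \in keys i.
Proof. by rewrite mem_sort mem_undup map_f// mem_enum. Qed.
Let rk i (x : 'I_(lvl t i)) : 'I_(klvl i) :=
  Ordinal (etrans (index_mem (g x) (keys i)) (key_mem x)).

Let keys_sorted i : sorted leq (keys i).
Proof. by apply: sort_sorted; exact: leq_total. Qed.
Let keys_uniq i : uniq (keys i).
Proof. by rewrite sort_uniq undup_uniq. Qed.

Let keys_ltn i : sorted ltn (keys i).
Proof. by rewrite ltn_sorted_uniq_leq keys_uniq keys_sorted. Qed.

Let rk_leq i (x y : 'I_(lvl t i)) : (rk x <= rk y) = (g x <= g y).
Proof.
apply/idP/idP => [xy|].
  by apply: (sorted_leq_index leq_trans leqnn (keys_sorted i)) xy.
apply: contraTT; rewrite -!ltnNge => yx.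
exact: (sorted_ltn_index ltn_trans (keys_ltn i)) yx.
Qed.

Let rk_surj i (y : 'I_(klvl i)) : exists x, rk x = y.
Proof.
have : nth 0 (keys i) y \in keys i by rewrite mem_nth.
rewrite mem_sort mem_undup => /mapP[x _ e]; exists x; apply: val_inj => /=.
by rewrite -e index_uniq.
Qed.

Let sec i (y : 'I_(klvl i)) := projT1 (cid (rk_surj y)).
Let secK i : cancel (@sec i) (@rk i).
Proof. by move=> y; rewrite /sec; case: cid. Qed.

Let kpar i (y : 'I_(klvl i)) : 'I_(klvl i.+1) := rk (par (sec y)).
Let kpar_mono i (x y : 'I_(klvl i)) : x <= y -> kpar x <= kpar y.
Proof. by rewrite rk_leq -{1}[x]secK -{1}[y]secK rk_leq => /g_par. Qed.
Let rk_eq i (x y : 'I_(lvl t i)) : g x = g y -> rk x = rk y.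
Proof. by move=> e; apply: val_inj; rewrite /= e. Qed.
Let kpar_rk i (x : 'I_(lvl t i)) : kpar (rk x) = rk (par x).
Proof.
apply: rk_eq; apply/eqP; rewrite eqn_leq.
by rewrite !g_par// -rk_leq secK.
Qed.
Let kpar_surj i (y : 'I_(klvl i.+1)) : exists x, kpar x = y.
Proof.
have [z <-] := rk_surj y; have [x <-] := par_surj z; exists (rk x).
exact: kpar_rk.
Qed.
Let klvl_root i : n <= i -> klvl i = 1.
Proof.
move=> ni; have := lvl_root t ni.
have x0 : 'I_(lvl t i) by rewrite lvl_root//; exact: ord0.
have : 0 < klvl i by exact: leq_ltn_trans (ltn_ord (rk x0)).
have : klvl i <= lvl t i.
  by rewrite /klvl size_sort (leq_trans (size_undup _))// size_map size_enum_ord.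
by lia.
Qed.

(** The vertices of level i are the distinct values of g in increasing order. Parents are computed
    through the section [sec]; its choice is immaterial since, by [g_par], equal keys have equal
    parent keys. *)
Lemma key_quotient : exists r (u : thom t r),
  forall i (x y : 'I_(lvl t i)), (u i x <= u i y) = (g x <= g y).
Proof.
exists (Tree kpar_mono kpar_surj klvl_root).
have um i (x y : 'I_(lvl t i)) : par x = par y -> x <= y -> rk x <= rk y.
  by move=> pxy xy; rewrite rk_leq g_mono.
by exists (@THom n t (Tree kpar_mono kpar_surj klvl_root) rk rk_surj kpar_rk um).
Qed.

End Key.

(** The map is u' after a section of u. Two vertices with one image under u satisfy the hypothesis
    in both directions, so the section does not matter. *)
Lemma descend t r s (u : thom t r) (u' : thom t s) :
  (forall i (x y : 'I_(lvl t i)), u i.+1 (par x) = u i.+1 (par y) ->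
     u i x <= u i y -> u' i x <= u' i y) ->
  exists v : thom r s, tcomp v u = u'.
Proof.
move=> uu'.
have h i (y : 'I_(lvl r i)) : exists x, u i x = y by exact: tmap_surj.
pose sec i y := projT1 (cid (h i y)).
have secK i : cancel (@sec i) (u i) by move=> y; rewrite /sec; case: cid.
have eqv i (x y : 'I_(lvl t i)) : u i x = u i y -> u' i x = u' i y.
  move=> e; have pe : u i.+1 (par x) = u i.+1 (par y) by rewrite -!tmap_par e.
  by apply/eqP; rewrite -val_eqE eqn_leq !uu' ?e.
pose v i (y : 'I_(lvl r i)) := u' i (sec i y).
have vu i x : v i (u i x) = u' i x by apply: eqv; rewrite secK.
have vs i (y : 'I_(lvl s i)) : exists x, v i x = y.
  by have [x <-] := tmap_surj u' y; exists (u i x).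
have vp i (x : 'I_(lvl r i)) : par (v i x) = v i.+1 (par x).
  by rewrite -[x]secK tmap_par !vu tmap_par.
have vm i (x y : 'I_(lvl r i)) : par x = par y -> x <= y -> v i x <= v i y.
  move=> pe xy; rewrite /v; apply: uu'; last by rewrite !secK.
  by rewrite -!tmap_par !secK.
exists (THom vs vp vm).
by apply: thom_ext => i x; exact: vu.
Qed.

Lemma tcomp_epi t r s (u : thom t r) (v v' : thom r s) :
  tcomp v u = tcomp v' u -> v = v'.
Proof.
move=> e; apply: thom_ext => i y; have [x <-] := tmap_surj u y.
exact: (congr1 (fun h : thom _ _ => h i x) e).
Qed.

Lemma tmap_initial t r (u : thom t r) i : initial (fun x => u i x : nat).
Proof. by apply: surj_initial; exact: tmap_surj. Qed.

(** Vertex numbers suffice: they give the sizes of the middle levels, and injectivity of [code] then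
    supplies the equality of the dependent records. *)
Lemma factor_ext t s (u : thom t s) (f f' : factor t s) :
  tcomp (fouter f) (finner f) = u -> tcomp (fouter f') (finner f') = u ->
  (forall i x, finner f i x = finner f' i x :> nat) -> f = f'.
Proof.
have lv (f1 f2 : factor t s) :
    (forall i x, finner f1 i x = finner f2 i x :> nat) ->
    forall i, lvl (fmid f1) i <= lvl (fmid f2) i.
  move=> e i; rewrite leqNgt; apply/negP => lt.
  have [x xE] := tmap_surj (finner f1) (Ordinal lt).
  have := ltn_ord (finner f2 i x); rewrite -e xE /=; lia.
move=> fu f'u e; apply: (@code_inj n t s u); [exact/mem_set|exact/mem_set|].
have el i : lvl (fmid f) i = lvl (fmid f') i.
  by apply/eqP; rewrite eqn_leq !lv.
congr (_, _); apply/ffunP => x; rewrite !ffunE ?el//.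
by case: insub => // y; rewrite e.
Qed.

Lemma key_factor t s (w : thom t s) (g : forall i, 'I_(lvl t i) -> nat) :
  (forall i (x y : 'I_(lvl t i)), g i x <= g i y -> g i.+1 (par x) <= g i.+1 (par y)) ->
  (forall i (x y : 'I_(lvl t i)), par x = par y -> x <= y -> g i x <= g i y) ->
  (forall i (x y : 'I_(lvl t i)), g i.+1 (par x) = g i.+1 (par y) ->
     g i x <= g i y -> w i x <= w i y) ->
  exists f : factor t s, tcomp (fouter f) (finner f) = w /\
    forall i (x y : 'I_(lvl t i)), (finner f i x <= finner f i y) = (g i x <= g i y).
Proof.
move=> gp gm gw; have [r [u uE]] := key_quotient gp gm.
have [|v vu] := @descend _ _ _ u w.
  move=> i x y pxy; rewrite uE; apply: gw; apply/eqP.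
  by rewrite eqn_leq -!uE pxy leqnn.
by exists (Factor v u).
Qed.

Lemma leq_tdeg t s (u : thom t s) : tdeg s <= tdeg t.
Proof. by apply: leq_sum => i _; exact: lvl_le u i. Qed.

Lemma lvl_ge t i : n <= i -> forall x y : 'I_(lvl t i), x = y.
Proof.
move=> ni x y; apply: val_inj => /=.
by have := ltn_ord x; have := ltn_ord y; have := lvl_root t ni; lia.
Qed.

Lemma surj_card_inj (T T' : finType) (f : T -> T') :
  (forall y, exists x, f x = y) -> #|T| <= #|T'| -> injective f.
Proof.
move=> fs le; have : {in T &, injective f}.
  apply/image_injP; rewrite eqn_leq leq_image_card /=.
  apply: (leq_trans le); apply: subset_leq_card; apply/fintype.subsetP => y _.
  by have [x <-] := fs y; exact: codom_f.
by move=> fi x y; apply: fi.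
Qed.

Lemma lvl_eq_inj t r (u : thom t r) i : lvl t i <= lvl r i -> injective (u i).
Proof. by move=> le; apply: surj_card_inj; [exact: tmap_surj|rewrite !card_ord]. Qed.

Lemma inj_lvl_eq t r (u : thom t r) i : injective (u i) -> lvl t i = lvl r i.
Proof.
move=> ui; apply/eqP; rewrite eqn_leq (lvl_le u) andbT.
by have := leq_card (u i) ui; rewrite !card_ord.
Qed.

(** Inside a fiber u is increasing by definition; across fibers the order is decided by the parents,
    which u fixes. *)
Lemma tmap_mono_above t r (u : thom t r) i : (forall x, u i.+1 x = x :> nat) ->
  forall x y : 'I_(lvl t i), x <= y -> u i x <= u i y.
Proof.
move=> ui x y xy; have := par_mono xy; rewrite leq_eqVlt => /orP[/eqP pe|pl].
  by apply: tmap_mono => //; apply: val_inj.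
by apply/ltnW/par_mono_lt; rewrite !tmap_par !ui.
Qed.

(** Descent from the root: once level i + 1 is fixed, level i is monotone, and an injective monotone
    map onto an initial segment is the identity. *)
Lemma tmap_id_above t r (u : thom t r) l : (forall i, l <= i -> injective (u i)) ->
  forall i x, l <= i -> u i x = x :> nat.
Proof.
move=> ui i x li; move: {2}(n - i) (erefl (n - i)) => m.
elim: m i li x => [|m IH] i li x mi.
  have ni : n <= i by lia.
  by have := ltn_ord x; have := ltn_ord (u i x);
    have := lvl_root t ni; have := lvl_root r ni; lia.
have {}IH y : u i.+1 y = y :> nat by apply: IH; lia.
apply: (@initial_unique 'I_(lvl t i) (fun x => u i x : nat) (fun x => x : nat)).
- exact: tmap_initial.
- exact: id_initial.
move=> {}x y; apply/idP/idP; last exact: tmap_mono_above.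
apply: contraTT; rewrite -!ltnNge => yx.
rewrite ltn_neqAle (tmap_mono_above IH (ltnW yx)) andbT.
by apply/eqP => /val_inj /(ui _ li) e; rewrite e ltnn in yx.
Qed.

(** The normal form of a merge of a with its successor. Below level i only injectivity is asked,
    since the children of the two merged vertices may be shuffled. *)
Definition collapse t r (u : thom t r) i (a : 'I_(lvl t i)) :=
  [/\ a.+1 < lvl t i,
      forall x : 'I_(lvl t i), u i x = x - (a < x) :> nat,
      forall l x, i < l -> u l x = x :> nat
    & forall l, l != i -> injective (u l)].

Lemma collapse_fiber t r (u : thom t r) i (a b : 'I_(lvl t i)) :
  collapse u a -> b = a.+1 :> nat -> u i a = u i b /\ par a = par b.
Proof.
case=> _ ua ul _ ba; have e : u i a = u i b by apply: val_inj; rewrite /= !ua ba; lia.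
split=> //; apply: val_inj => /=.
by rewrite -!(ul i.+1)// -!tmap_par e.
Qed.

Lemma collapse_eq t r (u : thom t r) i (a b : 'I_(lvl t i)) :
  collapse u a -> b = a.+1 :> nat -> forall x y : 'I_(lvl t i),
  u i x = u i y -> [\/ x = y, x = a /\ y = b | x = b /\ y = a].
Proof.
case=> _ ua ul _ ba x y /(congr1 val); rewrite /= !ua => e.
have [xy|xy|xy] := ltngtP x y; last by constructor 1; apply: val_inj.
  by constructor 2; split; apply: val_inj; move: e xy; rewrite /= ?ba; lia.
by constructor 3; split; apply: val_inj; move: e xy; rewrite /= ?ba; lia.
Qed.

Lemma tdeg1_level t r (u : thom t r) : tdeg t = (tdeg r).+1 ->
  exists i, [/\ i < n, lvl t i = (lvl r i).+1 & forall l, l != i -> lvl t l = lvl r l].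
Proof.
move=> d1.
have [i li] : exists i : 'I_n, lvl r i < lvl t i.
  apply: contrapT => /forallNP h; suff: tdeg t <= tdeg r by rewrite d1 ltnn.
  by apply: leq_sum => i _; rewrite leqNgt; apply/negP/h.
have rest : \sum_(l < n | l != i) lvl r l <= \sum_(l < n | l != i) lvl t l.
  by apply: leq_sum => l _; exact: lvl_le u l.
have tE (q : tree n) : tdeg q = lvl q i + \sum_(l < n | l != i) lvl q l.
  by rewrite /tdeg (bigD1 i).
move: d1; rewrite !tE => d1.
exists i; split=> //; first by lia.
move=> l li'; have [nl|ln] := leqP n l; first by rewrite !lvl_root.
have := lvl_le u l; rewrite leq_eqVlt => /orP[/eqP ->//|lt].
have li2 : Ordinal ln != i by rewrite -val_eqE.
have : \sum_(l < n | l != i) lvl r l < \sum_(l < n | l != i) lvl t l.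
  rewrite (bigD1 (Ordinal ln))//= [in ltnRHS](bigD1 (Ordinal ln))//=.
  rewrite -addSn leq_add//.
  by apply: leq_sum => m _; exact: lvl_le u m.
by lia.
Qed.

(** Exactly one level loses a vertex. There u is monotone, because it is the identity above, so some
    a is merged with its successor c. Without c an increasing bijection remains, and
    [initial_unique] computes it. *)
Lemma tdeg1_collapse t r (u : thom t r) : tdeg t = (tdeg r).+1 ->
  exists i (a : 'I_(lvl t i)), i < n /\ collapse u a.
Proof.
move=> /(tdeg1_level u) [i [ilt li lo]].
have uinj l : l != i -> injective (u l).
  by move=> nl; apply: lvl_eq_inj; rewrite lo.
have uid l x : i < l -> u l x = x :> nat.
  by move=> il; apply: (@tmap_id_above _ _ u i.+1) => // m im; apply: uinj; lia.
have um : forall x y : 'I_(lvl t i), x <= y -> u i x <= u i y.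
  by apply: tmap_mono_above => x; apply: uid.
have [a [b [ab uab]]] : exists a b : 'I_(lvl t i), a < b /\ u i a = u i b.
  have /injectivePn[a [b nab uab]] : ~~ injectiveb (u i).
    by apply/negP => /injectiveP /inj_lvl_eq; lia.
  by have [lt|gt|/val_inj e] := ltngtP a b;
    [exists a, b|exists b, a|rewrite e eqxx in nab].
have sa : a.+1 < lvl t i by apply: leq_ltn_trans ab (ltn_ord b).
pose c := Ordinal sa.
have uac : u i a = u i c.
  by apply: val_inj; apply/eqP; rewrite /= eqn_leq um ?leqnSn//= uab um.
pose sc (x : 'I_(lvl t i)) (xc : x != c) : {x | x != c} := exist _ x xc.
have fs (y : 'I_(lvl r i)) : exists x : {x | x != c}, u i (val x) = y.
  have [x xy] := tmap_surj u y; have [xc|xc] := eqVneq x c.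
    have ac : a != c by rewrite -val_eqE /=; lia.
    by exists (sc a ac); rewrite /= uac -xc.
  by exists (sc x xc).
have fi : injective (fun x : {x | x != c} => u i (val x)).
  apply: surj_card_inj => //; rewrite card_sig cardC1 !card_ord li; lia.
have key : (fun x : {x | x != c} => u i (val x) : nat) =1
           (fun x : {x | x != c} => val x - (a < val x)).
  apply: initial_unique.
  - exact: (@surj_initial _ _ (fun x : {x | x != c} => u i (val x))).
  - move=> [x xc] m /=; rewrite -val_eqE /= in xc; move=> mx.
    have [ma|am] := leqP m a.
      have ml : m < lvl t i by lia.
      have mc : Ordinal ml != c by rewrite -val_eqE /=; lia.
      by exists (sc _ mc) => /=; lia.
    have ml : m.+1 < lvl t i by have := ltn_ord x; lia.
    have mc : Ordinal ml != c by rewrite -val_eqE /=; lia.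
    by exists (sc _ mc) => /=; lia.
  move=> [x xc] [y yc] /=; move: (xc) (yc); rewrite -!val_eqE /= => xc' yc'.
  apply/idP/idP => [|xy]; last by apply: um; lia.
  apply: contraTT; rewrite -!ltnNge => yx.
  rewrite ltn_neqAle um ?andbT; last by lia.
  apply/eqP => /val_inj e; have /(congr1 val) /= e' := fi (sc _ yc) (sc _ xc) e.
  by move: yx; rewrite e' ltnn.
exists i, a; split=> //; split=> // x.
have [xc|xc] := eqVneq x c; last by have := key (sc x xc).
have ac : a != c by rewrite -val_eqE /=; lia.
by have := key (sc a ac); rewrite xc -uac /= => ->; lia.
Qed.

Lemma tdeg0_id t r (u : thom t r) : tdeg t = tdeg r -> forall i x, u i x = x :> nat.
Proof.
move=> d0; have ui i : injective (u i).
  apply: lvl_eq_inj; have [ni|ilt] := leqP n i; first by rewrite !lvl_root.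
  rewrite leqNgt; apply/negP => lt; move: d0.
  have tE (q : tree n) : tdeg q = lvl q i + \sum_(l < n | l != Ordinal ilt) lvl q l.
    by rewrite /tdeg (bigD1 (Ordinal ilt)).
  rewrite !tE.
  have : \sum_(l < n | l != Ordinal ilt) lvl r l <= \sum_(l < n | l != Ordinal ilt) lvl t l.
    by apply: leq_sum => l _; exact: lvl_le u l.
  by lia.
by move=> i x; apply: (@tmap_id_above _ _ u 0).
Qed.

End Trees.

(** * The matching on the factorizations of a morphism *)

Section Matching.
Context (n : nat).
Local Open Scope nat_scope.

Lemma fiber_mono (t r s : tree n) (u : thom t r) (v : thom r s) (w : thom t s) i
    (x y : 'I_(lvl t i)) : tcomp v u = w -> u i.+1 (par x) = u i.+1 (par y) ->
  u i x <= u i y -> w i x <= w i y.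
Proof. by move=> <- pe xy; apply: (tmap_mono v); rewrite ?tmap_par ?pe. Qed.

Lemma lvl_bound (t : tree n) i : lvl t i <= (tdeg t).+1.
Proof.
have [ni|ilt] := leqP n i; first by rewrite lvl_root.
by apply/leqW/(lvl_le_tdeg t (Ordinal ilt)).
Qed.

Lemma lvl_values (t r r' : tree n) (u : thom t r) (u' : thom t r') i :
  (forall x, u i x = u' i x :> nat) -> lvl r i = lvl r' i.
Proof.
have le (q q' : tree n) (v : thom t q) (v' : thom t q') :
    (forall x, v i x = v' i x :> nat) -> lvl q i <= lvl q' i.
  move=> e; rewrite leqNgt; apply/negP => lt; have [x xE] := tmap_surj v (Ordinal lt).
  by have := ltn_ord (v' i x); rewrite -e xE /=; lia.
by move=> e; apply/eqP; rewrite eqn_leq (le _ _ u u')// (le _ _ u' u).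
Qed.

Context (t s : tree n) (w : thom t s).

(* For a factorization w = v u, the vertices x and x' lie in one fiber of
   (u o par, w). All fibers at a level are good when u strictly reverses the
   order on each of them: this is the chosen vertex of the permutohedron of
   orderings of the fiber. *)
Definition good r (u : thom t r) i (x : 'I_(lvl t i)) : bool :=
  [forall x' : 'I_(lvl t i), [&& x < x', u i.+1 (par x) == u i.+1 (par x')
     & w i x == w i x'] ==> (u i x' < u i x)].

Lemma goodP r (u : thom t r) i (x : 'I_(lvl t i)) :
  reflect (forall x' : 'I_(lvl t i), x < x' -> u i.+1 (par x) = u i.+1 (par x') ->
     w i x = w i x' -> u i x' < u i x) (good u x).
Proof.
apply: (iffP forallP) => [h x' xx' pe we|h x'].
  by have := h x'; rewrite xx' pe we !eqxx.
by apply/implyP => /and3P[xx' /eqP pe /eqP we]; apply: h.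
Qed.

Lemma badP r (u : thom t r) i (x : 'I_(lvl t i)) :
  reflect (exists x' : 'I_(lvl t i), [/\ x < x', u i.+1 (par x) = u i.+1 (par x'),
     w i x = w i x' & u i x <= u i x']) (~~ good u x).
Proof.
rewrite negb_forall; apply: (iffP existsP) => [[x' h]|[x' [xx' pe we le]]]; exists x'.
  by move: h; rewrite negb_imply -leqNgt => /andP[/and3P[-> /eqP -> /eqP ->] ->].
by rewrite xx' pe we !eqxx -leqNgt le.
Qed.

Definition canonical r (u : thom t r) i := forall x : 'I_(lvl t i), good u x.

Definition first_bad r (u : thom t r) j (a : 'I_(lvl t j)) :=
  [/\ ~~ good u a, forall i, i < j -> canonical u i
    & forall x : 'I_(lvl t j), x < a -> good u x].

Lemma first_bad_unique r (u : thom t r) j (a : 'I_(lvl t j)) j' (a' : 'I_(lvl t j')) :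
  first_bad u a -> first_bad u a' -> existT _ j a = existT (fun j => 'I_(lvl t j)) j' a'.
Proof.
move=> [ba cj ga] [ba' cj' ga']; have e : j = j'.
  have [lt|lt|//] := ltngtP j j'; first by rewrite cj' in ba.
  by rewrite cj in ba'.
case: _ / e a' ba' cj' ga' => a' ba' _ ga'; congr existT; apply: val_inj.
have [lt|lt|//] := ltngtP a a'; first by rewrite ga' in ba.
by rewrite ga in ba'.
Qed.

(** Transport between two names of the first bad vertex: their levels are only propositionally
    equal, so uniqueness is used as an equality of dependent pairs. *)
Lemma first_bad_ind r (u : thom t r) (P : forall j, 'I_(lvl t j) -> Prop)
    j (a : 'I_(lvl t j)) j' (a' : 'I_(lvl t j')) :
  first_bad u a -> first_bad u a' -> P j' a' -> P j a.
Proof.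
move=> fb fb' p.
exact: (@eq_ind_r _ (existT (fun j => 'I_(lvl t j)) j' a')
  (fun z => P (projT1 z) (projT2 z)) p _ (first_bad_unique fb fb')).
Qed.

Lemma first_bad_lt r (u : thom t r) j (a : 'I_(lvl t j)) : first_bad u a -> j < n.
Proof.
case=> /badP[x' [ax' _ _ _]] _ _; rewrite ltnNge; apply/negP => nj.
by rewrite (lvl_ge nj a x') ltnn in ax'.
Qed.

Section Factored.
Context (r : tree n) (u : thom t r) (v : thom r s).
Hypothesis vu : tcomp v u = w.

Lemma factor_w i (x y : 'I_(lvl t i)) : u i x = u i y -> w i x = w i y.
Proof. by rewrite -vu /= => ->. Qed.
Lemma factor_par (q : tree n) (z : thom t q) i (x y : 'I_(lvl t i)) :
  z i x = z i y -> z i.+1 (par x) = z i.+1 (par y).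
Proof. by rewrite -!tmap_par => ->. Qed.

Lemma canonical_inj i : canonical u i -> injective (u i).
Proof.
move=> cu x y e; have pe := factor_par e; have we := factor_w e.
have [lt|lt|/val_inj//] := ltngtP x y.
  by have /goodP/(_ _ lt pe we) := cu x; rewrite e ltnn.
by have /goodP/(_ _ lt (esym pe) (esym we)) := cu y; rewrite e ltnn.
Qed.

(** On two such siblings u would both preserve and strictly reverse the order. *)
Lemma canonical_sibling i (x y : 'I_(lvl t i)) :
  canonical u i -> par x = par y -> w i x = w i y -> x = y.
Proof.
move=> cu pe we; have [lt|lt|/val_inj//] := ltngtP x y.
  have /goodP/(_ _ lt) := cu x; rewrite pe => /(_ erefl we).
  by rewrite ltnNge tmap_mono// ltnW.
have /goodP/(_ _ lt) := cu y; rewrite pe => /(_ erefl (esym we)).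
by rewrite ltnNge tmap_mono// ltnW.
Qed.

(** A lexicographic order: parent under u, then w, then reversed position. Only level i + 1 of u
    occurs on the right, so canonical levels are determined by the levels above. *)
Lemma canonical_leq i (x y : 'I_(lvl t i)) : canonical u i ->
  (u i x <= u i y) = (u i.+1 (par x) < u i.+1 (par y)) ||
     (u i.+1 (par x) == u i.+1 (par y) :> nat) &&
       ((w i x < w i y) || (w i x == w i y :> nat) && (y <= x)).
Proof.
move=> cu; have [lt|lt|/val_inj e] := ltngtP (u i.+1 (par x)) (u i.+1 (par y)) => /=.
- by apply/ltnW/par_mono_lt; rewrite !tmap_par.
- by apply/negbTE; rewrite -ltnNge; apply/par_mono_lt; rewrite !tmap_par.
have [lt|lt|/val_inj we] := ltngtP (w i x) (w i y) => /=.
- have [//|yx] := leqP (u i x) (u i y).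
  by have := fiber_mono vu (esym e) (ltnW yx); rewrite leqNgt lt.
- apply/negbTE/negP => xy.
  by have := fiber_mono vu e xy; rewrite leqNgt lt.
have [lt|lt|/val_inj ->] := ltngtP x y; last by rewrite leqnn.
  have /goodP/(_ _ lt e we) := cu x => yx.
  by apply/negbTE; rewrite -ltnNge.
by have /goodP/(_ _ lt (esym e) (esym we)) := cu y; move/ltnW ->.
Qed.

(** If all levels were canonical, w would be injective by descent from the root: two vertices with
    one image under w have equal parents, and a canonical level contains no two such siblings. *)
Lemma first_bad_exists : tdeg t <> tdeg s -> exists j (a : 'I_(lvl t j)), first_bad u a.
Proof.
move=> dts.
have [j [a ba]] : exists j (a : 'I_(lvl t j)), ~~ good u a.
  apply: contrapT => h; have cu i : canonical u i.
    by move=> x; apply/negPn/negP => bx; apply: h; exists i, x.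
  have uid i x : u i x = x :> nat.
    by apply: (@tmap_id_above n t r u 0) => // l _; apply: canonical_inj.
  have winj i : injective (w i).
    move: {2}(n - i) (erefl (n - i)) => m; elim: m i => [|m IH] i mi x y we.
      by apply: lvl_ge; lia.
    by apply: canonical_sibling => //; apply: (IH i.+1); [lia|apply: factor_par].
  apply: dts; apply: eq_bigr => i _; exact: inj_lvl_eq (winj i).
pose P j := [exists a : 'I_(lvl t j), ~~ good u a].
have exP : exists j, P j by exists j; apply/existsP; exists a.
case: (ex_minnP exP) => {ba}{}j /existsP[{}a ba] jmin.
case: (@arg_minnP _ a (fun x => ~~ good u x) (fun x : 'I_(lvl t j) => x : nat) ba).
move=> {ba}{}a ba amin.
exists j, a; split=> // [i ij x|x xa]; apply/negPn/negP => bx.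
  have : j <= i by apply: jmin; apply/existsP; exists x.
  by rewrite leqNgt ij.
by have := amin x bx; rewrite leqNgt xa.
Qed.
End Factored.

Lemma canonical_ext r r' (u : thom t r) (v : thom r s) (u' : thom t r') (v' : thom r' s) j :
  tcomp v u = w -> tcomp v' u' = w ->
  (forall i, i < j -> canonical u i) -> (forall i, i < j -> canonical u' i) ->
  (forall i x, j <= i -> u i x = u' i x :> nat) -> forall i x, u i x = u' i x :> nat.
Proof.
move=> vu vu' cu cu' e i; move: {2}(j - i) (erefl (j - i)) => m.
elim: m i => [|m IH] i mi x; first by apply: e; lia.
apply: (initial_unique (@tmap_initial n t r u i) (@tmap_initial n t r' u' i)).
have ij : i < j by lia.
move=> {}x y; rewrite (canonical_leq vu _ _ (cu i ij)) (canonical_leq vu' _ _ (cu' i ij)).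
by rewrite !IH//; lia.
Qed.

Section CanonicalKey.
Context (j : nat) (g : forall i, 'I_(lvl t i) -> nat).
Hypothesis g_par : forall i (x y : 'I_(lvl t i)), j <= i -> g x <= g y -> g (par x) <= g (par y).
Hypothesis g_mono : forall i (x y : 'I_(lvl t i)), j <= i -> par x = par y -> x <= y -> g x <= g y.
Hypothesis g_fiber : forall i (x y : 'I_(lvl t i)), j <= i -> g (par x) = g (par y) ->
  g x <= g y -> w i x <= w i y.
Hypothesis w_sibling : forall i (x y : 'I_(lvl t i)), i < j -> par x = par y ->
  w i x = w i y -> x = y.

Let B := (tdeg t + tdeg s).+2.
(** The order of [canonical_leq] as a number in base [B], where d counts the levels left before
    level j. The digit [lvl t i - x] reverses positions. [B] exceeds both digits by [lvl_bound]. *)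
Fixpoint ckey (d : nat) (i : nat) (x : 'I_(lvl t i)) : nat :=
  if d is d'.+1 then (ckey d' (par x) * B + w i x) * B + (lvl t i - x) else g x.
Let K i (x : 'I_(lvl t i)) := ckey (j - i) x.

Let K_ge i (x : 'I_(lvl t i)) : j <= i -> K x = g x.
Proof. by move=> ji; rewrite /K; have -> : j - i = 0 by lia. Qed.
Let K_lt i (x : 'I_(lvl t i)) : i < j -> K x = (K (par x) * B + w i x) * B + (lvl t i - x).
Proof. by move=> ij; rewrite /K; have -> : j - i = (j - i.+1).+1 by lia. Qed.

Let K_leq i (x y : 'I_(lvl t i)) : i < j -> (K x <= K y) = (K (par x) < K (par y)) ||
  (K (par x) == K (par y)) && ((w i x < w i y) || (w i x == w i y :> nat) && (y <= x)).
Proof.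
move=> ij; rewrite (K_lt x ij) (K_lt y ij).
have xB := lvl_bound t i; have yB := lvl_bound s i.
have h (z : 'I_(lvl t i)) : lvl t i - z < B by rewrite /B; lia.
have h' (z : 'I_(lvl t i)) : w i z < B by rewrite /B; have := ltn_ord (w i z); lia.
rewrite lex_leq// ltnNge eqn_leq !lex_leq//.
have -> : (lvl t i - x <= lvl t i - y) = (y <= x).
  by have := ltn_ord x; have := ltn_ord y; lia.
by case: (ltngtP (K (par x)) (K (par y))); case: (ltngtP (w i x) (w i y)).
Qed.

(** A preorder prescribed from level j upwards is completed canonically below. Hypothesis
    [w_sibling] is what makes the completed key weakly increasing on siblings. *)
Lemma canonical_key : exists f : factor t s, [/\ tcomp (fouter f) (finner f) = w,
  forall i, i < j -> canonical (finner f) i &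
  forall i (x y : 'I_(lvl t i)), j <= i -> (finner f i x <= finner f i y) = (g x <= g y)].
Proof.
have [|||f [fw fK]] := @key_factor n t s w (fun i x => K x).
- move=> i x y; have [ji|ij] := leqP j i.
    by rewrite !K_ge ?(leqW ji)//; exact: g_par.
  by rewrite K_leq// => /orP[/ltnW//|/andP[/eqP -> _]].
- move=> i x y pe xy; have [ji|ij] := leqP j i; first by rewrite !K_ge// g_mono.
  rewrite K_leq// pe eqxx ltnn /=.
  have := tmap_mono w pe xy; rewrite leq_eqVlt => /orP[/eqP/val_inj we|-> //].
  by rewrite (w_sibling ij pe we) leqnn eqxx orbT.
- move=> i x y; have [ji|ij] := leqP j i.
    by rewrite !K_ge ?(leqW ji)//; exact: g_fiber.
  by move=> pe; rewrite K_leq// pe eqxx ltnn /= => /orP[/ltnW//|/andP[/eqP -> _]].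
exists f; split=> // [i ij x|i x y ji]; last by rewrite fK !K_ge.
apply/goodP => x' xx' pe we; rewrite ltnNge fK K_leq//.
have -> : K (par x) = K (par x').
  by apply/eqP; rewrite eqn_leq -!fK pe leqnn.
by rewrite we !eqxx !ltnn /= -ltnNge.
Qed.
End CanonicalKey.

(* u' is obtained from u by merging the class of a, reduced to a, with the next
   one. *)
Definition paired r r' (u : thom t r) (u' : thom t r') j (a : 'I_(lvl t j)) :=
  [/\ first_bad u a /\ first_bad u' a, forall x, u j x = u j a -> x = a,
      exists2 b, b <> a & u' j b = u' j a,
      forall i x, j < i -> u i x = u' i x :> nat
    & forall x : 'I_(lvl t j), u' j x = u j x - (u j a < u j x) :> nat].

(** Lowering by one all keys above that of a merges its class with the next. The point is that a
    stays the first bad vertex. *)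
Lemma pair_up r (u : thom t r) (v : thom r s) j (a : 'I_(lvl t j)) :
  tcomp v u = w -> first_bad u a -> (forall x, u j x = u j a -> x = a) ->
  exists f' : factor t s, tcomp (fouter f') (finner f') = w /\ paired u (finner f') a.
Proof.
move=> vu fb sa; have [ba cu ga] := fb.
have /badP[x1 [ax1 pe1 we1 le1]] := ba.
have lt1 : u j a < u j x1.
  rewrite ltn_neqAle le1 andbT; apply/eqP => /val_inj/esym/sa e.
  by rewrite e ltnn in ax1.
have sa' y : u j y = u j a :> nat -> y = a by move=> /val_inj/sa.
(* The next class lies in the fiber of a, being squeezed between a and the witness [x1]. Its members
   come after a: an earlier one would be good, so [u j x1] would be at most [u j a]. *)
have next y : u j y = (u j a).+1 :> nat -> [/\ u j.+1 (par y) = u j.+1 (par a),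
    w j y = w j a & a < y].
  move=> ya; have pya : u j.+1 (par y) = u j.+1 (par a).
    apply: val_inj; apply/eqP; rewrite /= eqn_leq.
    have -> : u j.+1 (par a) <= u j.+1 (par y).
      by rewrite -!tmap_par; apply: par_mono; rewrite ya.
    rewrite andbT pe1 -!tmap_par; apply: par_mono.
    by rewrite ya.
  have wya : w j y = w j a.
    apply: val_inj; apply/eqP; rewrite /= eqn_leq.
    rewrite (fiber_mono vu (esym pya)) ?ya// andbT we1.
    by apply: (fiber_mono vu); rewrite ?pya// ya.
  split=> //; rewrite ltnNge; apply/negP; rewrite leq_eqVlt => /orP[/eqP/val_inj e|lt].
    by move: ya; rewrite e; lia.
  have /goodP/(_ x1) := ga _ lt; rewrite pya wya => /(_ (ltn_trans lt ax1) pe1 we1).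
  by rewrite ya; lia.
pose g i (x : 'I_(lvl t i)) : nat := u i x - ((i == j) && (u j a < u i x)).
have g_gt i x : j < i -> g i x = u i x by move=> ji; rewrite /g gtn_eqF//= subn0.
have g_j x : g j x = u j x - (u j a < u j x) by rewrite /g eqxx.
(* The merge adds no comparisons except from the next class to a. *)
have g_leq x y : g j x <= g j y -> u j x <= u j y \/ u j x = (u j a).+1 :> nat /\ y = a.
  rewrite !g_j => le; have [?|lt] := leqP (u j x) (u j y); first by left.
  by right; split; [|apply: sa']; lia.
have [||||f' [fw fc fg]] := @canonical_key j g.
- move=> i x y; rewrite leq_eqVlt => /orP[/eqP e|ji].
    case: _ / e x y => x y /g_leq; rewrite !g_gt// => -[le|[/next [-> _ _] -> //]].
    by rewrite -!tmap_par; exact: par_mono.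
  by rewrite !g_gt ?(leqW ji)// => le; rewrite -!tmap_par; exact: par_mono.
- move=> i x y _ pe xy; have := tmap_mono u pe xy.
  by rewrite /g; move: (u i x : nat) (u i y : nat) => c d; case: (i == j) => /=; lia.
- move=> i x y; rewrite leq_eqVlt => /orP[/eqP e|ji].
    case: _ / e x y => x y; rewrite (g_gt _ (par x) (ltnSn j)) (g_gt _ (par y) (ltnSn j)) => /val_inj pe /g_leq [le|[/next [_ -> _] -> //]].
    exact: fiber_mono vu pe le.
  by rewrite !g_gt ?(leqW ji)// => /val_inj pe le; exact: fiber_mono vu pe le.
- by move=> i x y ij; apply: canonical_sibling; exact: cu.
have val_gt i x : j < i -> u i x = finner f' i x :> nat.
  move=> ji; apply: (initial_unique (@tmap_initial n t r u i) (@tmap_initial n t _ (finner f') i)).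
  by move=> {}x y; rewrite fg ?(ltnW ji)// !g_gt.
have val_j x : finner f' j x = u j x - (u j a < u j x) :> nat.
  rewrite -g_j; apply: (initial_unique (@tmap_initial n t _ (finner f') j)).
    move=> {}x m; rewrite g_j => mx.
    have [mp|pm] := leqP m (u j a).
      have [y ym] : exists y, u j y = m :> nat.
        by apply: (@tmap_initial n t r u j x); lia.
      by exists y; rewrite g_j ym; lia.
    have [y ym] : exists y, u j y = m.+1 :> nat.
      by apply: (@tmap_initial n t r u j x); lia.
    by exists y; rewrite g_j ym; lia.
  by move=> {}x y; rewrite fg.
have par_eq (x y : 'I_(lvl t j)) : finner f' j.+1 (par x) = finner f' j.+1 (par y) <->
    u j.+1 (par x) = u j.+1 (par y).
  by split=> /(congr1 val) /= e; apply: val_inj; rewrite /= ?val_gt// -?val_gt.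
exists f'; split=> //; split=> //; first split=> //; first split=> //.
- apply/badP; exists x1; split=> //; first exact/par_eq.
  by rewrite !val_j; lia.
- move=> x xa; apply/goodP => x' xx' /par_eq pe we.
  have /goodP/(_ x' xx' pe we) lt := ga x xa.
  (* A strict inequality is lost only between the two merged classes, and the upper one contains no
     vertex before a. *)
  have ne : ~ (u j x' = u j a :> nat /\ u j x = (u j a).+1 :> nat).
    by move=> [/sa' e /next[_ _]]; rewrite ltnNge (ltnW xa).
  by rewrite !val_j; lia.
have [b bE] : exists b, u j b = (u j a).+1 :> nat.
  have [e|lt] := eqVneq (u j x1 : nat) (u j a).+1; first by exists x1.
  by apply: (@tmap_initial n t r u j x1); lia.
exists b; first by move=> e; move: bE; rewrite e; lia.
by apply: val_inj; rewrite /= !val_j bE; lia.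
Qed.

(** The inverse move: a becomes a class of its own, just below the rest of its old class. *)
Lemma pair_down r' (u' : thom t r') (v' : thom r' s) j (a b : 'I_(lvl t j)) :
  tcomp v' u' = w -> first_bad u' a -> b <> a -> u' j b = u' j a ->
  exists f : factor t s, tcomp (fouter f) (finner f) = w /\ paired (finner f) u' a.
Proof.
move=> vu fb nba uba; have [ba cu ga] := fb.
(* a is the first vertex of its class, since an earlier member would be good and hence separated
   from a. Placing a below the others therefore respects the order of siblings. *)
have after y : u' j y = u' j a -> y <> a -> a < y.
  move=> e ya; have [lt|//|/val_inj//] := ltngtP y a.
  have /goodP/(_ a lt (factor_par e) (factor_w vu e)) := ga y lt.
  by rewrite e ltnn.
pose g i (x : 'I_(lvl t i)) : nat := u' i x +
  ((i == j) && ((u' j a < u' i x) || (u' i x == u' j a :> nat) && (x != a :> nat))).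
have g_gt i x : j < i -> g i x = u' i x by move=> ji; rewrite /g gtn_eqF//= addn0.
have g_j x : g j x = u' j x + ((u' j a < u' j x) || (u' j x == u' j a :> nat) && (x != a)).
  by rewrite /g eqxx.
have g_leq i x y : g i x <= g i y -> u' i x <= u' i y.
  rewrite /g; case: (i == j) => /=; rewrite ?addn0//.
  by case: (x != a :> nat); case: (y != a :> nat) => /=; lia.
have [||||f [fw fc fg]] := @canonical_key j g.
- move=> i x y ji /g_leq le; rewrite !g_gt//.
  by rewrite -!tmap_par; exact: par_mono.
- move=> i x y; rewrite leq_eqVlt => /orP[/eqP e|ji] pe xy; last first.
    by rewrite !g_gt// tmap_mono.
  case: _ / e x y pe xy => x y pe xy; rewrite !g_j; have := tmap_mono u' pe xy.
  have [yE|ya] := eqVneq y a; have [xE|xa] := eqVneq x a; rewrite ?yE ?xE /=; try lia.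
  move=> le; have [e|ne] := eqVneq (u' j x : nat) (u' j a); last by lia.
  by have := after x (val_inj e) (elimN eqP xa); move: xy; rewrite yE; lia.
- move=> i x y ji; rewrite (g_gt _ (par x)) ?(g_gt _ (par y))// => /val_inj pe /g_leq le.
  exact: fiber_mono vu pe le.
- by move=> i x y ij; apply: canonical_sibling; exact: cu.
have val_gt i x : j < i -> finner f i x = u' i x :> nat.
  move=> ji; apply: (initial_unique (@tmap_initial n t _ (finner f) i) (@tmap_initial n t _ u' i)).
  by move=> {}x y; rewrite fg ?(ltnW ji)// !g_gt.
have val_j x : finner f j x =
    u' j x + ((u' j a < u' j x) || (u' j x == u' j a :> nat) && (x != a)) :> nat.
  rewrite -g_j; apply: (initial_unique (@tmap_initial n t _ (finner f) j)); last first.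
    by move=> {}x y; rewrite fg.
  move=> {}x m mx; have [mp|pm|mp] := ltngtP m (u' j a); last first.
  - by exists a; rewrite g_j !eqxx; lia.
  - have [me|mne] := eqVneq m (u' j a).+1.
      by exists b; rewrite g_j uba eqxx (introN eqP nba) me; lia.
    have [y ym] : exists y, u' j y = m.-1 :> nat.
      by apply: (@tmap_initial n t _ u' j x); move: mx; rewrite g_j; lia.
    by exists y; rewrite g_j ym; lia.
  have [y ym] : exists y, u' j y = m :> nat by exact: (@tmap_initial n t _ u' j a).
  by exists y; rewrite g_j ym; lia.
have par_eq (x y : 'I_(lvl t j)) : finner f j.+1 (par x) = finner f j.+1 (par y) <->
    u' j.+1 (par x) = u' j.+1 (par y).
  by split=> /(congr1 val) /= e; apply: val_inj; rewrite /= ?val_gt// -?val_gt.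
have val_a : finner f j a = u' j a :> nat by rewrite val_j !eqxx; lia.
exists f; split=> //; split=> //; first split=> //; first split=> //.
- apply/badP; exists b; split.
  + exact: after.
  + by apply/par_eq; apply/esym/factor_par.
  + by apply/esym/(factor_w vu).
  by rewrite val_a val_j uba; lia.
- move=> x xa; apply/goodP => x' xx' /par_eq pe we.
  have /goodP/(_ x' xx' pe we) lt := ga x xa.
  by rewrite !val_j; lia.
- move=> x /(congr1 val) /=; rewrite val_a val_j.
  by have [->//|xa] := eqVneq x a; lia.
- by exists b.
- by move=> x; rewrite val_a val_j; case: (x != a); lia.
Qed.

Lemma paired_canonical r r' (u : thom t r) (u' : thom t r') j (a : 'I_(lvl t j)) :
  paired u u' a -> forall i, i < j -> canonical u i /\ canonical u' i.
Proof. by case=> [[[_ cu _] [_ cu' _]] _ _ _ _] i ij; split; [exact: cu|exact: cu']. Qed.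

(** The map u prescribes a, the levels above j, and level j by the explicit formula; canonicity
    determines the levels below. *)
Lemma paired_fun r (u : thom t r) (f f' : factor t s)
    j (a : 'I_(lvl t j)) j' (a' : 'I_(lvl t j')) :
  tcomp (fouter f) (finner f) = w -> tcomp (fouter f') (finner f') = w ->
  paired u (finner f) a -> paired u (finner f') a' -> f = f'.
Proof.
move=> fw fw' p p'; have [[fb _] _ _ _ _] := p; have [[fb' _] _ _ _ _] := p'.
have {}p' := first_bad_ind (P := fun j a => paired u (finner f') a) fb fb' p'.
apply: (factor_ext fw fw'); apply: (canonical_ext (j := j) fw fw').
- by move=> i /(paired_canonical p) [].
- by move=> i /(paired_canonical p') [].
move=> i x; rewrite leq_eqVlt => /orP[/eqP e|ji].
  case: _ / e x => x; have [_ _ _ _ ->] := p; have [_ _ _ _ ->] := p'; by [].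
by have [_ _ _ <- //] := p; have [_ _ _ <- //] := p'.
Qed.

Lemma paired_inj r' (u' : thom t r') (f f' : factor t s)
    j (a : 'I_(lvl t j)) j' (a' : 'I_(lvl t j')) :
  tcomp (fouter f) (finner f) = w -> tcomp (fouter f') (finner f') = w ->
  paired (finner f) u' a -> paired (finner f') u' a' -> f = f'.
Proof.
move=> fw fw' p p'; have [[_ fb] _ _ _ _] := p; have [[_ fb'] _ _ _ _] := p'.
have {}p' := first_bad_ind (P := fun j a => paired (finner f') u' a) fb fb' p'.
apply: (factor_ext fw fw'); apply: (canonical_ext (j := j) fw fw').
- by move=> i /(paired_canonical p) [].
- by move=> i /(paired_canonical p') [].
(* The formula of [paired] solved for the finer map: only the class of a was split, with a at the
   bottom. *)
have vE (g : factor t s) (x : 'I_(lvl t j)) : paired (finner g) u' a ->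
    finner g j x = u' j x + ((u' j a < u' j x) || (u' j x == u' j a :> nat) && (x != a)) :> nat.
  move=> [_ ga _ _ ge]; have := ge x; have := ge a; have [->|xa] := eqVneq x a.
    by rewrite ?eqxx; lia.
  have ne : finner g j x != finner g j a :> nat.
    by apply/eqP => /val_inj/ga; apply/eqP.
  by lia.
move=> i x; rewrite leq_eqVlt => /orP[/eqP e|ji].
  by case: _ / e x => x; rewrite !vE.
by case: p p' => [_ _ _ e _] [_ _ _ e' _]; rewrite e ?e'.
Qed.

(** Below level j both maps are canonical, hence injective, so both middle trees have as many
    vertices there as t. The degree changes at level j only. *)
Lemma paired_lvl r r' (u : thom t r) (v : thom r s) (u' : thom t r') (v' : thom r' s)
    j (a : 'I_(lvl t j)) :
  tcomp v u = w -> tcomp v' u' = w -> paired u u' a ->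
  lvl r j = (lvl r' j).+1 /\ forall i, i != j -> lvl r i = lvl r' i.
Proof.
move=> vu vu' p; have [_ ua [b ba ub] ui uj] := p; split; last first.
  move=> i; rewrite neq_ltn => /orP[ij|ji]; last first.
    by apply: (@lvl_values t r r' u u') => x; exact: ui.
  have [cu cu'] := paired_canonical p ij.
  by rewrite -(inj_lvl_eq (canonical_inj vu cu)) -(inj_lvl_eq (canonical_inj vu' cu')).
have bE : u j b = (u j a).+1 :> nat.
  have ne : u j b != u j a :> nat by apply/eqP => /val_inj/ua.
  by have := congr1 val ub; rewrite /= !uj; lia.
have r0 : 0 < lvl r j by apply: leq_ltn_trans (ltn_ord (u j a)).
have r0' : 0 < lvl r' j by apply: leq_ltn_trans (ltn_ord (u' j a)).
have [x xE] : exists x, u j x = (lvl r j).-1 :> nat.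
  have lt : (lvl r j).-1 < lvl r j by lia.
  by have [x xE] := tmap_surj u (Ordinal lt); exists x; rewrite xE.
have [y yE] : exists x, u' j x = (lvl r' j).-1 :> nat.
  have lt : (lvl r' j).-1 < lvl r' j by lia.
  by have [z zE] := tmap_surj u' (Ordinal lt); exists z; rewrite zE.
have := ltn_ord (u' j x); have := ltn_ord (u j y); have := ltn_ord (u j b).
by move: yE; rewrite !uj xE bE; lia.
Qed.

Lemma tdegE (q : tree n) j : j < n ->
  tdeg q = lvl q j + \sum_(l < n | l != j :> nat) lvl q l.
Proof. by move=> jn; rewrite /tdeg (bigD1 (Ordinal jn)). Qed.

Lemma paired_tdeg r r' (u : thom t r) (v : thom r s) (u' : thom t r') (v' : thom r' s)
    j (a : 'I_(lvl t j)) :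
  tcomp v u = w -> tcomp v' u' = w -> paired u u' a -> tdeg r = (tdeg r').+1.
Proof.
move=> vu vu' p; have [e o] := paired_lvl vu vu' p.
have [[/first_bad_lt jn _] _ _ _ _] := p.
by rewrite !(@tdegE _ j)// e addSn; congr (_ + _).+1; apply: eq_bigr => i; apply: o.
Qed.

(** Below level j both orders are lexicographic and differ only through the parents, and parents
    identified by u are identified by [u']. *)
Lemma paired_descend r r' (u : thom t r) (v : thom r s) (u' : thom t r') (v' : thom r' s)
    j (a : 'I_(lvl t j)) :
  tcomp v u = w -> tcomp v' u' = w -> paired u u' a ->
  exists v1 : thom r r', tcomp v1 u = u'.
Proof.
move=> vu vu' p; have [_ ua [b ba ub] ui uj] := p.
have level_j m (x y : 'I_(lvl t m)) : m = j -> u m x = u m y -> u' m x = u' m y.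
  move=> mj; case: _ / (esym mj) x y => x y e.
  by apply: val_inj; rewrite /= !uj e.
apply: descend => i x y pe; have [ij|ji|ij] := ltngtP i j; last first.
- by case: _ / (esym ij) x y pe => x y _; rewrite !uj; lia.
- by rewrite !ui.
have [cu cu'] := paired_canonical p ij.
rewrite (canonical_leq vu)// (canonical_leq vu')// pe ltnn eqxx /=.
suff -> : u' i.+1 (par x) = u' i.+1 (par y) by rewrite ltnn eqxx.
move: ij; rewrite leq_eqVlt => /orP[/eqP e|ij].
  by apply: level_j => //; exact: e.
have [cu1 cu1'] := paired_canonical p ij.
by rewrite (canonical_inj vu cu1 pe).
Qed.

Definition upper_deg (r : tree n) j := \sum_(i < n | j < i) (lvl t i - lvl r i).

(* Lexicographic order packed into one number. The summand X * X makes the first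
   component n - j + X * X grow with tdeg t: this is what [rank_tdeg] needs to
   compare cells of different sources. *)
Definition rho r (u : thom t r) j (a : 'I_(lvl t j)) : nat :=
  let X := (tdeg t + n).+2 in
  (((X * X + (n - j)) * X + upper_deg r j) * X + (lvl t j - a)) * X
    + #|[set x | u j a < u j x]|.

Lemma upper_deg_bound r j : upper_deg r j <= tdeg t.
Proof.
rewrite /upper_deg /tdeg big_mkcond /=; apply: leq_sum => i _.
by case: ifP => // _; exact: leq_subr.
Qed.

Lemma card_bound j (A : {set 'I_(lvl t j)}) : #|A| <= (tdeg t).+1.
Proof.
by apply: leq_trans (lvl_bound t j); rewrite -[leqRHS]card_ord max_card.
Qed.

Lemma rho_lt r r' (u : thom t r) j (a : 'I_(lvl t j)) (u' : thom t r') j' (a' : 'I_(lvl t j')) :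
  (n - j < n - j') || (n - j == n - j') &&
    ((upper_deg r j < upper_deg r' j') || (upper_deg r j == upper_deg r' j') &&
      ((lvl t j - a < lvl t j' - a') || (lvl t j - a == lvl t j' - a') &&
        (#|[set x | u j a < u j x]| < #|[set x | u' j' a' < u' j' x]|))) ->
  rho u a < rho u' a'.
Proof.
move=> h; rewrite /rho; set X := (tdeg t + n).+2.
have := card_bound [set x | u j a < u j x]; have := card_bound [set x | u' j' a' < u' j' x].
have := upper_deg_bound r j; have := upper_deg_bound r' j'.
have := lvl_bound t j; have := lvl_bound t j'.
move=> b1 b2 b3 b4 b5 b6.
have X1 : forall m, m <= (tdeg t).+1 -> m < X by rewrite /X; lia.
have X2 : forall m, m <= n -> m < X by rewrite /X; lia.
have x1 : n - j < X by apply: X2; lia.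
have x2 : n - j' < X by apply: X2; lia.
have x3 : upper_deg r j < X by apply: X1; lia.
have x4 : upper_deg r' j' < X by apply: X1; lia.
have x5 : lvl t j - a < X by apply: X1; lia.
have x6 : lvl t j' - a' < X by apply: X1; lia.
have x7 := X1 _ b5; have x8 := X1 _ b6.
move: h; case/orP => [lt|/andP[/eqP -> h]].
  by do 3 (apply: lex_ltn => //; apply/orP; left); rewrite ltn_add2l.
apply: lex_ltn => //; case/orP: h => [lt|/andP[/eqP -> h]].
  by apply/orP; left; apply: lex_ltn => //; apply/orP; left; rewrite ltn_add2l.
case/orP: h => [lt|/andP[/eqP -> ->]]; last by rewrite eqxx orbT.
by apply/orP; left; rewrite ltn_add2l.
Qed.

(** Acyclicity of the matching: y is a cell matched upwards like u, and it also yields [u'] after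
    one merge [v1]. The cases follow the components of [rho]: the first bad level, the degree lost
    above it, the position of the bad vertex, and the number of vertices that y places above it. *)
Lemma facet_rho r r' q (u : thom t r) (v : thom r s) (u' : thom t r') (v' : thom r' s)
    (y : thom t q) (z : thom q s) (v1 : thom q r')
    j (a : 'I_(lvl t j)) j' (a' : 'I_(lvl t j')) :
  tcomp v u = w -> tcomp v' u' = w -> tcomp z y = w -> paired u u' a ->
  tcomp v1 y = u' -> tdeg q = (tdeg r').+1 ->
  first_bad y a' -> (forall x, y j' x = y j' a' -> x = a') ->
  rho y a' < rho u a \/ Factor v u = Factor z y.
Proof.
move=> vu vu' zy p vy dq fby ya.
have [[fb fb'] ua [b ba ub] ui uj] := p.
have [l [c [ln cl]]] := tdeg1_collapse v1 dq.
have u'E i x : u' i x = v1 i (y i x) by rewrite -vy.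
have [cn vc vup vinj] := cl.
(* Below level j the map [u'] is canonical, hence injective, so [v1] cannot merge there. *)
have jl : j <= l.
  rewrite leqNgt; apply/negP => lj; have [_ cu'] := paired_canonical p lj.
  have [x xc] := tmap_surj y c; have [x' xc'] := tmap_surj y (Ordinal cn).
  have := @canonical_inj _ u' v' vu' _ cu' x x'.
  have [e _] := collapse_fiber (b := Ordinal cn) cl erefl.
  rewrite !u'E xc xc' e => /(_ erefl) exx.
  by move: xc'; rewrite -exx xc => /(congr1 val) /=; lia.
have cy i : i < j -> canonical y i.
  move=> ij x; apply/goodP => x' xx' pe we; have [_ /(_ x)/goodP cu'] := paired_canonical p ij.
  have := cu' x' xx'; rewrite !u'E pe => /(_ erefl we); apply: contraTT; rewrite -!leqNgt.
  by rewrite -!u'E; apply: (fiber_mono vy).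
have jj' : j <= j'.
  by rewrite leqNgt; apply/negP => /cy/(_ a'); have [/negP] := fby.
move: jj'; rewrite leq_eqVlt => /orP[/eqP jj'|jj']; last first.
  by left; apply: rho_lt; have := first_bad_lt fby; lia.
case: _ / jj' a' fby ya => a' fby ya.
have [lr lro] := paired_lvl vu vu' p.
(* If the merge takes place above level j, then q has one more vertex there than r, which lowers
   [upper_deg]. *)
move: jl; rewrite leq_eqVlt => /orP[/eqP jl|jl]; last first.
  left; apply: rho_lt; rewrite eqxx ltnn /=; apply/orP; left.
  have lq : lvl q l = (lvl r' l).+1.
    have [l' [_ e o]] := tdeg1_level v1 dq.
    have [el|nl] := eqVneq l l'; first by rewrite el.
    have le : lvl q l <= lvl r' l by rewrite o.
    have inj := lvl_eq_inj (u := v1) le.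
    have [e' _] := collapse_fiber (b := Ordinal cn) cl erefl.
    by have /(congr1 val) /= := inj _ _ e'; lia.
  have uE (r0 : tree n) : upper_deg r0 j =
      lvl t l - lvl r0 l + \sum_(i < n | (j < i) && (i != Ordinal ln)) (lvl t i - lvl r0 i).
    by rewrite /upper_deg (bigD1 (Ordinal ln)).
  rewrite !uE -addSn leq_add//.
    by have := lvl_le y l; rewrite lro ?gtn_eqF// lq; lia.
  apply: leq_sum => i /andP[ji _]; rewrite lro ?gtn_eqF// leq_sub2l//.
  exact: lvl_le v1 i.
case: _ / jl c ln cl cn vc vup vinj => c ln cl cn vc vup vinj.
have yup i x : j < i -> y i x = u' i x :> nat by move=> ji; rewrite u'E vup.
have yj x : u' j x = y j x - (c < y j x) :> nat by rewrite u'E vc.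
have aa' : a <= a'.
  rewrite leqNgt; apply/negP => lt; have [_ _ /(_ _ lt)/goodP g'] := fb'.
  have [/negP + _ _] := fby; apply; apply/goodP => x' xx' pe we.
  have pe' : u' j.+1 (par a') = u' j.+1 (par x').
    by apply: val_inj; rewrite /= -!yup// pe.
  by have := g' x' xx' pe' we; rewrite !yj; lia.
have ue : upper_deg q j = upper_deg r j.
  apply: eq_bigr => i ji; rewrite lro ?gtn_eqF//.
  by rewrite (@lvl_values t q r' y u')// => x; apply: yup.
move: aa'; rewrite leq_eqVlt => /orP[/eqP/val_inj aa'|aa']; last first.
  left; apply: rho_lt; rewrite ue !eqxx !ltnn /=; apply/orP; left.
  by have := ltn_ord a'; lia.
case: _ / aa' fby ya => fby ya.
(* a is alone for y but not for [u'], so [v1] rejoins a with the rest of its class and a is the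
   lower or the upper part. The lower part is the partner of [u'], that is, u. In the upper part b
   falls below a, which lowers the last component. *)
have yac : y j a = c :> nat \/ y j a = c.+1 :> nat.
  have ne : y j b != y j a :> nat by apply/eqP => /val_inj/ya.
  by have := congr1 val ub; rewrite /= !yj; lia.
case: yac => yac.
  right; apply: (@paired_inj _ u' (Factor v u) (Factor z y) j a j a) => //.
  split=> //; first by exists b.
  by move=> x; rewrite /= yj yac.
left; apply: rho_lt; rewrite ue !eqxx !ltnn /=.
have u'ac : u' j a = c :> nat by rewrite yj yac; lia.
have uac : u j a = c :> nat by have := uj a; lia.
have ubc : u j b = c.+1 :> nat.
  have ne : u j b != u j a :> nat by apply/eqP => /val_inj/ua.
  by have := congr1 val ub; rewrite /= !uj; lia.
apply: proper_card; apply/properP; split.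
  by apply/fintype.subsetP => x; rewrite !inE => yx; have := uj x; rewrite yj; lia.
exists b; rewrite inE; first by lia.
have ne : y j b != y j a :> nat by apply/eqP => /val_inj/ya.
by have := congr1 val ub; rewrite /= !yj; lia.
Qed.
End Matching.

(** * The matching as a relation between cells, and the rank *)

Section Cells.
Context (n : nat).
Local Open Scope nat_scope.

Definition matched (t s : tree n) (f f' : factor t s) :=
  exists j (a : 'I_(lvl t j)),
    paired (tcomp (fouter f) (finner f)) (finner f) (finner f') a.

(** Depends on a first bad vertex, hence the choice; [first_bad_unique] makes it well defined, and 0
    is the value in the absence of such a vertex. *)
Definition rank (t s : tree n) (f : factor t s) : nat :=
  xget 0 [set N | exists j (a : 'I_(lvl t j)),
    first_bad (tcomp (fouter f) (finner f)) (finner f) a /\ N = rho (finner f) a]%classic.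

Lemma rankE (t s : tree n) (f : factor t s) j (a : 'I_(lvl t j)) :
  first_bad (tcomp (fouter f) (finner f)) (finner f) a -> rank f = rho (finner f) a.
Proof.
move=> fb; rewrite /rank; case: xgetP => [N _ [j' [a' [fb' ->]]]|/(_ (rho (finner f) a))].
  exact: (first_bad_ind (P := fun j a => rho (finner f) a' = rho (finner f) a) fb fb').
by case; exists j, a.
Qed.

Context (t s : tree n).
Implicit Types f g : factor t s.
Local Notation comp f := (tcomp (fouter f) (finner f)).

Lemma matched_total f : tdeg t <> tdeg s -> exists f', comp f' = comp f /\
  (matched f f' \/ matched f' f).
Proof.
move=> d; have [j [a fb]] := first_bad_exists (erefl (comp f)) d.
have [sa|/existsNP[b /not_implyP[ba nba]]] := pselect (forall x, finner f j x = finner f j a -> x = a).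
  have [f' [fw p]] := pair_up erefl fb sa.
  by exists f'; split=> //; left; exists j, a.
have [f' [fw p]] := pair_down erefl fb nba ba.
by exists f'; split=> //; right; exists j, a; rewrite fw.
Qed.

Lemma matched_fun f g g' : comp g = comp f -> comp g' = comp f ->
  matched f g -> matched f g' -> g = g'.
Proof.
by move=> e e' [j [a p]] [j' [a' p']]; exact: (paired_fun e e' p p').
Qed.

Lemma matched_inj f f' g : comp f = comp g -> comp f' = comp g ->
  matched f g -> matched f' g -> f = f'.
Proof.
move=> e e' [j [a p]] [j' [a' p']]; rewrite e in p; rewrite e' in p'.
exact: (paired_inj e e' p p').
Qed.

(** The class of the first bad vertex would be a singleton and not a singleton. *)
Lemma matched_excl f g g' : comp g = comp f -> comp g' = comp f ->
  matched f g -> matched g' f -> False.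
Proof.
move=> e e' [j [a p]] [j' [a' p']]; rewrite e' in p'.
have [[fb _] ua _ _ _] := p; have [[_ fb'] _ [b ba ub] _ _] := p'.
have {}p' := first_bad_ind (P := fun j a => paired (comp f) (finner g') (finner f) a) fb fb' p'.
by have [_ _ [c ca /ua]] := p'.
Qed.

Lemma matched_facet f g : comp g = comp f -> matched f g ->
  exists v : thom (fmid f) (fmid g),
    [/\ tcomp v (finner f) = finner g, tcomp (fouter g) v = fouter f
      & tdeg (fmid f) = (tdeg (fmid g)).+1].
Proof.
move=> e [j [a p]]; have [v vu] := paired_descend erefl e p.
exists v; split=> //; last exact: (paired_tdeg erefl e p).
by apply: (@tcomp_epi n t _ _ (finner f)); rewrite -tcompA vu e.
Qed.

Lemma matched_rank f g h h' (v : thom (fmid h) (fmid g)) :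
  comp g = comp f -> comp h = comp f -> comp h' = comp f ->
  matched f g -> matched h h' -> tcomp v (finner h) = finner g ->
  tdeg (fmid h) = (tdeg (fmid g)).+1 -> rank h < rank f \/ f = h.
Proof.
move=> eg eh eh' [j [a p]] [j' [a' p']] vh dh.
have [[fb _] _ _ _ _] := p; have [[fb' _] ua' _ _ _] := p'.
rewrite (rankE fb) (rankE fb').
have := facet_rho erefl eg eh p vh dh; rewrite -eh => /(_ _ _ fb' ua').
by case: f {p fb eg eh eh'} => ? ? ?; case: h {fb' dh vh p' ua'} v => ? ? ? v.
Qed.

(** Serves the inner part of the differential, which passes to a smaller source. The base and the
    leading summand [X * X] grow with [tdeg], and this outweighs all other digits. *)
Lemma rank_tdeg (t' : tree n) f (f' : factor t' s) :
  tdeg t <> tdeg s -> tdeg t' < tdeg t -> tdeg t' <> tdeg s -> rank f' < rank f.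
Proof.
move=> d lt d'.
have [j [a fb]] := first_bad_exists (erefl (comp f)) d.
have [j' [a' fb']] := first_bad_exists (erefl (tcomp (fouter f') (finner f'))) d'.
rewrite (rankE fb) (rankE fb') /rho.
set X := (tdeg t + n).+2; set X' := (tdeg t' + n).+2.
have XX : X' < X by rewrite /X /X'; lia.
have b1 := card_bound [set x | finner f' j' a' < finner f' j' x].
have b2 := upper_deg_bound t' (fmid f') j'.
have b3 := lvl_bound t' j'.
have up m e N : m < N -> e < X' -> m * X' + e < N * X.
  move=> mN eX; apply: (@leq_trans (m.+1 * X')); first by rewrite mulSn; lia.
  by apply: leq_mul => //; exact: ltnW.
apply: ltn_addr; apply: (up); last by apply: (leq_ltn_trans b1); rewrite /X'; lia.
apply: ltn_addr; apply: (up); last by rewrite /X'; lia.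
apply: ltn_addr; apply: (up); last by rewrite /X'; lia.
apply: ltn_addr; apply: (up) => //.
by rewrite /X'; lia.
Qed.

End Cells.

(** * Signs of morphisms *)

Section Inversions.
Local Open Scope nat_scope.
Context (T : eqType).
Implicit Types a b c : seq T.

Lemma odd_sum_sym a (h : T -> T -> nat) :
  (forall x, ~~ odd (h x x)) -> (forall x y, odd (h x y) = odd (h y x)) ->
  ~~ odd (\sum_(x <- a) \sum_(y <- a) h x y).
Proof.
move=> hd hs; elim: a => [|z a IH]; first by rewrite big_nil.
rewrite big_cons big_cons.
under [X in _ + X]eq_bigr => x _ do rewrite big_cons.
rewrite big_split /= !oddD (negbTE IH) (negbTE (hd z)) /= addbF.
suff -> : odd (\sum_(y <- a) h z y) = odd (\sum_(y <- a) h y z) by rewrite addbb.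
elim: a {IH} => [|y a IH]; first by rewrite !big_nil.
by rewrite !big_cons !oddD IH hs.
Qed.

Let L a x y := index x a < index y a.

Let L_sym a x y : x \in a -> x != y -> L a y x = ~~ L a x y.
Proof.
move=> xa xy; rewrite /L -leqNgt [RHS]leq_eqVlt; case: eqP => //= e.
have ya : y \in a by rewrite -index_mem e index_mem.
by case/eqP: xy; rewrite -(nth_index x xa) -e nth_index.
Qed.

(** Multiplicativity of the sign of permutations. On an unordered pair of symbols, three orders
    disagree in zero or two of their three comparisons; the symmetry of [h] modulo 2 expresses
    this. *)
Lemma odd_inversions_trans a b c : perm_eq a b -> perm_eq b c ->
  odd (inversions a c) = odd (inversions a b) (+) odd (inversions b c).
Proof.
move=> ab bc.
pose h x y : nat := if (x \in a) && (y \in a) then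
   (L a x y && L c y x) + (L a x y && L b y x) + (L b x y && L c y x) else 0.
have : ~~ odd (\sum_(x <- a) \sum_(y <- a) h x y).
  apply: odd_sum_sym => [x|x y].
    by rewrite /h /L !ltnn; case: ifP.
  rewrite /h [in RHS]andbC; case: ifP => // /andP[xa ya].
  have [->//|xy] := eqVneq x y.
  have xb : x \in b by rewrite -(perm_mem ab).
  have xc : x \in c by rewrite -(perm_mem bc).
  rewrite (L_sym xa xy) (L_sym xb xy) (L_sym xc xy).
  by case: (L a x y); case: (L b x y); case: (L c x y).
have -> : \sum_(x <- a) \sum_(y <- a) h x y =
    inversions a c + inversions a b + inversions b c.
  rewrite /inversions -(perm_big _ ab) /=.
  under [X in _ = _ + X]eq_bigr => x _ do rewrite -(perm_big _ ab) /=.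
  rewrite -!big_split /=; apply: eq_big_seq => x xa.
  rewrite -!big_split /=; apply: eq_big_seq => y ya.
  by rewrite /h xa ya.
by rewrite !oddD; do 3 case: odd.
Qed.

Lemma inversions_refl a : inversions a a = 0.
Proof.
rewrite /inversions big1// => x _; rewrite big1// => y _.
by case: ltngtP.
Qed.

Lemma odd_inversions_sym a b : perm_eq a b -> odd (inversions a b) = odd (inversions b a).
Proof.
move=> ab; have := @odd_inversions_trans a b a ab; rewrite perm_sym ab => /(_ erefl).
by rewrite inversions_refl; case: (odd (inversions a b)); case: (odd (inversions b a)).
Qed.

Lemma inversions_cons x a b : x \notin a -> x \notin b ->
  inversions (x :: a) (x :: b) = inversions a b.
Proof.
move=> xa xb; rewrite /inversions big_cons big1 ?add0n; last first.
  by move=> y _ /=; rewrite eqxx ltn0 andbF.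
apply: eq_big_seq => y ya.
have xy : x == y = false by apply: contraNF xa => /eqP ->.
rewrite big_cons /= eqxx xy ltn0 /= add0n; apply: eq_big_seq => z za.
have xz : x == z = false by apply: contraNF xa => /eqP ->.
by rewrite xz !ltnS.
Qed.

Lemma inversions_swap x y a : uniq [:: x, y & a] ->
  inversions [:: x, y & a] [:: y, x & a] = 1.
Proof.
rewrite /= inE negb_or => /andP[/andP[xy xa] /andP[ya ua]].
have nx z : z \in a -> (x == z = false) * (y == z = false).
  by move=> za; split; [apply: contraNF xa => /eqP ->|apply: contraNF ya => /eqP ->].
rewrite /inversions !big_cons /= !eqxx.
rewrite !(eq_sym y x) !(negbTE xy) /=.
rewrite big1_seq ?addn0; last first.
  by move=> z /andP[_ za]; rewrite !(nx _ za).
rewrite big1_seq ?addn0; last first.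
  by move=> z /andP[_ za]; rewrite !(nx _ za) ltn0 andbF.
rewrite big1_seq ?addn0//.
move=> z /andP[_ za]; rewrite !big_cons /= !(nx _ za) !eqxx (eq_sym y x) (negbTE xy) /=.
rewrite big1_seq// => z' /andP[_ za']; rewrite !(nx _ za') !ltnS.
by case: ltngtP.
Qed.

Lemma odd_inversions_swap c x y a : uniq c -> perm_eq c [:: x, y & a] ->
  odd (inversions c [:: x, y & a]) = ~~ odd (inversions c [:: y, x & a]).
Proof.
move=> uc p; have u : uniq [:: x, y & a] by rewrite -(perm_uniq p).
have p2 : perm_eq [:: x, y & a] [:: y, x & a].
  by rewrite -[[:: x, y & a]]/([:: x] ++ [:: y] ++ a) perm_catCA.
by rewrite (odd_inversions_trans p p2) inversions_swap//=; case: odd.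
Qed.

Lemma odd_inversions_swap1 c z x y a : uniq c -> perm_eq c [:: z, x, y & a] ->
  odd (inversions c [:: z, x, y & a]) = ~~ odd (inversions c [:: z, y, x & a]).
Proof.
move=> uc p; have u : uniq [:: z, x, y & a] by rewrite -(perm_uniq p).
have p2 : perm_eq [:: z, x, y & a] [:: z, y, x & a].
  by rewrite perm_cons -[[:: x, y & a]]/([:: x] ++ [:: y] ++ a) perm_catCA.
rewrite (odd_inversions_trans p p2) inversions_cons.
- by case/andP: u => _ u; rewrite inversions_swap//=; case: odd.
- by case/andP: u.
by case/andP: u; rewrite !inE !negb_or => /and3P[-> ->].
Qed.
End Inversions.

Lemma inversions_map (T T' : eqType) (f : T -> T') (a b : seq T) :
  {in a &, injective f} -> {subset b <= a} ->
  inversions (map f a) (map f b) = inversions a b.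
Proof.
move=> fi ba; have idx s x : {subset s <= a} -> x \in a -> index (f x) (map f s) = index x s.
  elim: s => //= y s IH sa xa; rewrite (inj_in_eq fi (sa y (mem_head y s)) xa).
  by case: eqP => // _; rewrite IH// => z zs; apply: sa; rewrite inE zs orbT.
rewrite /inversions big_map; apply: eq_big_seq => x xa.
rewrite big_map; apply: eq_big_seq => y ya.
by rewrite !idx.
Qed.

(** * Depth-first order and the sign of a merge *)

Section Vertices.
Context (n : nat).
Local Open Scope nat_scope.
Implicit Types t r : tree n.

Definition vx t i (x : 'I_(lvl t i)) : vtx t := Tagged (fun i => 'I_(lvl t i)) x.

Lemma vx_inj t i : injective (@vx t i).
Proof. by move=> x y /eqP; rewrite eq_Tagged /= => /eqP. Qed.

Lemma sorted_ord_eq m (a b : seq 'I_m) :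
  sorted ltn (map val a) -> sorted ltn (map val b) -> a =i b -> a = b.
Proof.
move=> sa sb ab; apply: (inj_map val_inj).
apply: (irr_sorted_eq ltn_trans ltnn sa sb) => x.
by apply/mapP/mapP => -[y yab ->]; exists y; rewrite // ?ab// -ab.
Qed.

Lemma enum_sorted m (P : pred 'I_m) : sorted ltn [seq val x | x <- enum 'I_m & P x].
Proof.
have : sorted ltn (map val (enum 'I_m)) by rewrite val_enum_ord iota_ltn_sorted.
by apply: (subseq_sorted ltn_trans); apply/map_subseq/filter_subseq.
Qed.

(** This is [vertices t] for [l = n.-1]; the level is left free for induction. *)
Definition dfs_from t l : seq (vtx t) := flatten [seq Defs.dfs x | x <- enum 'I_(lvl t l)].

(** As [par] is weakly increasing, its fibers are consecutive intervals of the level. *)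
Lemma enum_children t l :
  flatten [seq [seq y <- enum 'I_(lvl t l) | par y == x] | x <- enum 'I_(lvl t l.+1)] =
  enum 'I_(lvl t l).
Proof.
apply: sorted_ord_eq.
- suff h (s : seq 'I_(lvl t l.+1)) : sorted ltn (map val s) ->
    sorted ltn [seq val i | i <- flatten [seq [seq y <- enum 'I_(lvl t l) | par y == x] | x <- s]].
    by apply: h; rewrite val_enum_ord iota_ltn_sorted.
  elim: s => //= x s IH xs; rewrite map_cat.
  have ss : sorted ltn (map val s) by exact: path_sorted xs.
  rewrite -[sorted _ _]/(sorted _ _) sorted_pairwise; last exact: ltn_trans.
  rewrite pairwise_cat -!sorted_pairwise; try exact: ltn_trans.
  rewrite IH// enum_sorted !andbT; apply/allrelP => _ _ /mapP[y + ->] /mapP[z + ->].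
  rewrite mem_filter => /andP[/eqP yx _] /flatten_mapP[x' x's]; rewrite mem_filter => /andP[/eqP zx' _].
  apply: par_mono_lt; rewrite yx zx'.
  have := order_path_min ltn_trans xs => /allP; apply.
  exact: map_f.
- by have := enum_sorted (fun _ : 'I_(lvl t l) => true); rewrite filter_predT.
move=> y; rewrite mem_enum; apply/flatten_mapP; exists (par y); rewrite ?mem_enum//.
by rewrite mem_filter eqxx mem_enum.
Qed.

Lemma dfs_tag t l (x : 'I_(lvl t l)) : all (fun z => tag z <= l) (Defs.dfs x).
Proof.
elim: l x => [|l IH] x //=; rewrite leqnn /=.
apply/allP => z /flatten_mapP[y _ zy].
by have /allP/(_ z zy) := IH y; lia.
Qed.

Lemma dfs_from_tag t l : all (fun z => tag z <= l) (dfs_from t l).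
Proof. by apply/allP => z /flatten_mapP[x _]; move: z; apply/allP; exact: dfs_tag. Qed.

Lemma dfs_from_S t l : [seq z <- dfs_from t l.+1 | tag z <= l] = dfs_from t l.
Proof.
have dE : dfs_from t l.+1 = flatten [seq vx x :: flatten [seq Defs.dfs y | y <- enum 'I_(lvl t l) & par y == x]
   | x <- enum 'I_(lvl t l.+1)] by [].
have ff (T T' : Type) (f : T -> seq T') (ss : seq (seq T)) :
    flatten (map f (flatten ss)) = flatten [seq flatten (map f q) | q <- ss].
  by elim: ss => //= a ss IHs; rewrite map_cat flatten_cat IHs.
rewrite dE filter_flatten -map_comp /dfs_from -[in RHS](enum_children t l) ff -map_comp.
congr flatten; apply: eq_map => x /=.
rewrite ltnn; apply/all_filterP/allP => z /flatten_mapP[y _ zy].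
by have /allP/(_ z zy) := dfs_tag y.
Qed.

Lemma dfs_from_filter t l i : i <= l ->
  [seq z <- dfs_from t l | tag z == i] = map (@vx t i) (enum 'I_(lvl t i)).
Proof.
elim: l i => [|l IH] i; rewrite ?leqn0 => il.
  have d0 : dfs_from t 0 = map (@vx t 0) (enum 'I_(lvl t 0)).
    by rewrite /dfs_from /=; elim: (enum _) => //= x s' ->.
  rewrite (eqP il) d0.
  by apply/all_filterP/allP => z /mapP[x _ ->].
move: il; rewrite leq_eqVlt => /orP[/eqP ->|il].
  rewrite /dfs_from; elim: (enum _) => //= x s' IHs; rewrite eqxx filter_cat IHs.
  rewrite (_ : filter _ _ = [::])//; apply/eqP; rewrite -(negbK (_ == _)) -has_filter.
  apply/negP => /hasP[z /flatten_mapP[y _ zy] /eqP].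
  by have /allP/(_ z zy) := dfs_tag y; lia.
rewrite -(IH i)// -(dfs_from_S t l) -filter_predI; apply: eq_filter => z /=.
by case: eqP => // ->; rewrite -ltnS il.
Qed.

Lemma vertices_filter t i : i < n ->
  [seq z <- vertices t | tag z == i] = map (@vx t i) (enum 'I_(lvl t i)).
Proof. by move=> ilt; apply: dfs_from_filter; lia. Qed.

Lemma mem_vertices t i (x : 'I_(lvl t i)) : i < n -> vx x \in vertices t.
Proof.
move=> ilt; suff : vx x \in [seq z <- vertices t | tag z == i] by rewrite mem_filter => /andP[].
by rewrite vertices_filter// map_f// mem_enum.
Qed.

Lemma vertices_tag t (z : vtx t) : 0 < n -> z \in vertices t -> tag z < n.
Proof. by move=> n0 zv; have /allP/(_ z zv) := dfs_from_tag t n.-1; lia. Qed.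

Lemma vertices_uniq t : 0 < n -> uniq (vertices t).
Proof.
move=> n0; apply: count_mem_uniq => z.
have [zv|zv] := boolP (z \in vertices t); last by apply/count_memPn.
have zn := vertices_tag n0 zv.
have -> : count_mem z (vertices t) = count_mem z [seq y <- vertices t | tag y == tag z].
  by rewrite count_filter; apply: eq_count => y /=; case: eqP => //= ->; rewrite eqxx.
rewrite vertices_filter// count_uniq_mem ?(map_inj_uniq (@vx_inj t _)) ?enum_uniq//.
by case: z zv zn => i x /= _ _; rewrite map_f// mem_enum.
Qed.

Section Sign.
Context (t r : tree n) (w : thom t r) (i : nat) (a b : 'I_(lvl t i)).
Hypothesis wa : collapse w a.
Hypothesis ba : b = a.+1 :> nat.
Hypothesis ilt : i < n.

Lemma vmap_collapse (x y : vtx t) : vmap w x = vmap w y ->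
  [\/ x = y, x = vx a /\ y = vx b | x = vx b /\ y = vx a].
Proof.
case: x y => l x [l' y] e; have ll : l = l' by exact: (congr1 tag e).
case: _ / ll y e => y /eqP; rewrite eq_Tagged /= => /eqP e.
have [li|li] := eqVneq l i; last first.
  by constructor 1; have [_ _ _ /(_ l li)/(_ _ _ e) ->] := wa.
case: _ / (esym li) x y e => x y e.
have [->|[-> ->]|[-> ->]] := collapse_eq wa ba e; [by constructor 1|by constructor 2|by constructor 3].
Qed.

Lemma vmap_ab : vmap w (vx a) = vmap w (vx b).
Proof. by have [e _] := collapse_fiber wa ba; rewrite /vmap /= e. Qed.

Lemma ab_neq : vx b != vx a.
Proof. by apply/eqP => /vx_inj e; move: ba; rewrite e; lia. Qed.

Lemma merged_first_collapse : merged_first w =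
  [:: vx a, vx b & [seq x <- vertices t | (x != vx a) && (x != vx b)]].
Proof.
pose m x := has (fun y => (y != x) && (vmap w y == vmap w x)) (vertices t).
have mE x : m x = (x == vx a) || (x == vx b).
  apply/hasP/orP => [[y _ /andP[yx /eqP/vmap_collapse]]|].
    by case=> [e|[_ ->]|[_ ->]]; [rewrite e eqxx in yx|right|left].
  case=> /eqP ->; [exists (vx b)|exists (vx a)]; rewrite ?mem_vertices//.
    by rewrite ab_neq vmap_ab eqxx.
  by rewrite eq_sym ab_neq vmap_ab eqxx.
have -> : merged_first w = [seq x <- vertices t | m x] ++ [seq x <- vertices t | ~~ m x] by [].
rewrite -[[:: _, _ & _]]/([:: vx a; vx b] ++ _); congr (_ ++ _); last first.
  by apply: eq_filter => x; rewrite mE negb_or.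
transitivity [seq x <- [seq z <- vertices t | tag z == i] | m x].
  rewrite -filter_predI; apply: eq_filter => x /=; rewrite mE.
  by case: eqP => [->|_] /=; [rewrite eqxx|case: eqP => // ->; rewrite eqxx].
rewrite vertices_filter// filter_map; rewrite -[RHS]/(map (@vx t i) [:: a; b]).
congr map; apply: sorted_ord_eq; first exact: enum_sorted.
  by rewrite /= andbT ba.
move=> x; rewrite mem_filter mem_enum andbT /= mE !inE.
by rewrite !(inj_eq (@vx_inj t i)).
Qed.

Lemma vmap_perm (B : seq (vtx t)) : perm_eq (vertices t) (vx a :: B) ->
  {in B &, injective (vmap w)} /\ perm_eq (map (vmap w) B) (vertices r).
Proof.
move=> p; have n0 : 0 < n by lia.
have uB : uniq (vx a :: B) by rewrite -(perm_uniq p) vertices_uniq.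
have /andP[aB uB'] := uB.
have inj : {in B &, injective (vmap w)}.
  move=> x y xB yB /vmap_collapse[//|[xa _]|[_ ya]]; first by rewrite -xa xB in aB.
  by rewrite -ya yB in aB.
have bB : vx b \in B.
  have : vx b \in vx a :: B by rewrite -(perm_mem p) mem_vertices.
  by rewrite inE (negbTE ab_neq).
split=> //; apply: uniq_perm; rewrite ?vertices_uniq ?map_inj_in_uniq//.
move=> [l y]; apply/mapP/idP => [[x xB ->]|yv].
  have xv : x \in vertices t by rewrite (perm_mem p) inE xB orbT.
  by apply: mem_vertices; exact: vertices_tag xv.
have ln := vertices_tag n0 yv; have [x xy] := tmap_surj w y.
rewrite -[existT _ l y]/(vx y); have -> : vx y = vmap w (vx x) by rewrite /vmap /= xy.
have : vx x \in vx a :: B by rewrite -(perm_mem p) mem_vertices.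
by rewrite inE => /orP[/eqP ->|xB]; [exists (vx b); rewrite ?vmap_ab|exists (vx x)].
Qed.

(** The remaining vertices may be listed in any order: a reordering of B enters both factors of the
    sign, and w carries it injectively to the image. The vertex b stands for the merged symbol. *)
Lemma odd_sgn_exp (B : seq (vtx t)) : perm_eq (vertices t) (vx a :: B) ->
  odd (sgn_exp w) = odd (inversions (vertices t) (vx a :: B)) (+)
                    odd (inversions (map (vmap w) B) (vertices r)).
Proof.
move=> p; have n0 : 0 < n by lia.
pose B0 := vx b :: [seq x <- vertices t | (x != vx a) && (x != vx b)].
have mf : merged_first w = vx a :: B0 by exact: merged_first_collapse.
have p0 : perm_eq (vertices t) (vx a :: B0).
  by rewrite -mf /merged_first perm_sym; apply/permEl/perm_filterC.
have pB : perm_eq B0 B by rewrite -(perm_cons (vx a)) -(permPl p0).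
have [inj pB0] := vmap_perm p0; have [_ pBr] := vmap_perm p.
rewrite /sgn_exp mf /= oddD.
have [aB0 aB] : vx a \notin B0 /\ vx a \notin B.
  by split; [have := perm_uniq p0|have := perm_uniq p]; rewrite vertices_uniq// => /esym/andP[].
rewrite (odd_inversions_trans p0 (_ : perm_eq _ (vx a :: B0)))//.
rewrite inversions_refl addbF.
rewrite (odd_inversions_trans p0 (_ : perm_eq _ (vx a :: B))) ?perm_cons//.
rewrite inversions_cons//.
rewrite (@odd_inversions_trans _ (map (vmap w) B0) (map (vmap w) B)) ?perm_map//.
rewrite inversions_map//; last by move=> x; rewrite (perm_mem pB).
by rewrite addbA.
Qed.

End Sign.

Section DegreeTwo.
Context (t s : tree n) (e : thom t s).

(* The sign of a chain of two merges, read off the removed vertices a and z. *)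
Lemma odd_sgn_chain (f : factor t s) i (a : 'I_(lvl t i)) j (c : 'I_(lvl (fmid f) j))
    (z : vtx t) (B : seq (vtx t)) :
  tcomp (fouter f) (finner f) = e -> i < n -> j < n ->
  collapse (finner f) a -> collapse (fouter f) c -> vmap (finner f) z = vx c ->
  perm_eq (vertices t) [:: vx a, z & B] ->
  odd (sgn_exp (fouter f)) (+) odd (sgn_exp (finner f)) =
  odd (inversions (vertices t) [:: vx a, z & B]) (+)
  odd (inversions (map (vmap e) B) (vertices s)).
Proof.
move=> fe ilt jlt wa vc zc p; have [a1 _ _ _] := wa; have [c1 _ _ _] := vc.
rewrite (odd_sgn_exp wa (b := Ordinal a1) erefl ilt p).
have [_ pw] := vmap_perm wa (b := Ordinal a1) erefl ilt p.
have p' : perm_eq (vertices (fmid f)) (vx c :: map (vmap (finner f)) B).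
  by rewrite perm_sym -zc.
rewrite (odd_sgn_exp vc (b := Ordinal c1) erefl jlt p') -map_comp.
have -> : map (vmap (fouter f) \o vmap (finner f)) B = map (vmap e) B.
  by apply: eq_map => -[l x]; rewrite -fe.
(* The depth-first order of the middle tree enters both signs and cancels. *)
rewrite /= zc (odd_inversions_sym p') !addbA [LHS]addbC !addbA.
by rewrite addbC !addbA; case: odd; case: odd; case: odd.
Qed.

Lemma collapse_inj t1 s1 (u : thom t1 s1) i (a : 'I_(lvl t1 i)) l (x y : 'I_(lvl t1 l)) :
  collapse u a -> u l x = u l y -> x < y -> vx x = vx a /\ l = i.
Proof.
move=> ua uxy xy; have [a1 _ _ inj] := ua.
have [li|li] := eqVneq l i; last by rewrite (inj l li _ _ uxy) ltnn in xy.
case: _ / (esym li) x y uxy xy => x y uxy xy.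
have [xE|[-> _] //|[xE yE]] := collapse_eq ua (b := Ordinal a1) erefl uxy.
  by rewrite xE ltnn in xy.
by move: xy; rewrite xE yE /=; lia.
Qed.

Context (f f' : factor t s).
Hypotheses (fe : tcomp (fouter f) (finner f) = e) (fe' : tcomp (fouter f') (finner f') = e).

(** The inner map separates x and y but e does not, so the outer merge identifies them, and the
    smaller image is the vertex c. *)
Lemma chain_second (g : factor t s) i (a : 'I_(lvl t i)) j (c : 'I_(lvl (fmid g) j))
    l (x y : 'I_(lvl t l)) : tcomp (fouter g) (finner g) = e ->
  collapse (finner g) a -> collapse (fouter g) c ->
  finner g l x < finner g l y -> e l x = e l y -> vmap (finner g) (vx x) = vx c.
Proof.
move=> ge wa vc xy exy; rewrite -ge in exy.
by have [e' _] := collapse_inj vc exy xy; exact: e'.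
Qed.

Lemma chain_first (g : factor t s) i (a : 'I_(lvl t i)) j (c : 'I_(lvl (fmid g) j))
    i' (a' b' : 'I_(lvl t i')) : tcomp (fouter g) (finner g) = e ->
  collapse (finner g) a -> collapse (fouter g) c -> b' = a'.+1 :> nat ->
  par a' = par b' -> e i' a' = e i' b' -> vx a' <> vx a ->
  vmap (finner g) (vx a') = vx c.
Proof.
move=> ge wa vc ba pab eab nea; apply: (chain_second (y := b') ge wa vc) => //.
have := tmap_mono (finner g) pab; rewrite ba => /(_ (leqnSn _)).
rewrite leq_eqVlt => /orP[/eqP/val_inj wab|//].
have lt : a' < b' by rewrite ba.
by have [] := collapse_inj wa wab lt.
Qed.

(** By [odd_sgn_chain] only the arrangement of the removed vertices matters. If the first removed
    vertices differ, both chains remove the same two vertices in opposite orders. If they agree, the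
    inner maps differ by a shuffle at another level, and two shuffled vertices take the role of
    second removed vertex. *)
Lemma odd_sgn_two : f <> f' -> tdeg t = (tdeg (fmid f)).+1 -> tdeg t = (tdeg (fmid f')).+1 ->
  tdeg (fmid f) = (tdeg s).+1 ->
  odd (sgn_exp (fouter f)) (+) odd (sgn_exp (finner f)) =
  ~~ (odd (sgn_exp (fouter f')) (+) odd (sgn_exp (finner f'))).
Proof.
move=> ff' d d' ds; have ds' : tdeg (fmid f') = (tdeg s).+1 by lia.
have [i [a [ilt wa]]] := tdeg1_collapse (finner f) d.
have [i' [a' [ilt' wa']]] := tdeg1_collapse (finner f') d'.
have [j [c [jlt vc]]] := tdeg1_collapse (fouter f) ds.
have [j' [c' [jlt' vc']]] := tdeg1_collapse (fouter f') ds'.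
have [a1 wav wup winj] := wa; have [a1' wav' wup' winj'] := wa'.
have n0 : 0 < n by lia.
have [eaa|eaa] := pselect (vx a = vx a'); last first.
  have [wab pab] := collapse_fiber wa (b := Ordinal a1) erefl.
  have [wab' pab'] := collapse_fiber wa' (b := Ordinal a1') erefl.
  have z : vmap (finner f) (vx a') = vx c.
    apply: (chain_first fe wa vc (b' := Ordinal a1')) => //; last exact/nesym.
    by rewrite -fe' /= wab'.
  have z' : vmap (finner f') (vx a) = vx c'.
    apply: (chain_first fe' wa' vc' (b' := Ordinal a1)) => //.
    by rewrite -fe /= wab.
  have [B p] : exists B, perm_eq (vertices t) [:: vx a, vx a' & B].
    have pa := perm_to_rem (mem_vertices a ilt).
    have : vx a' \in rem (vx a) (vertices t).
      by rewrite (mem_rem_uniq _ (vertices_uniq _ n0)) inE mem_vertices// andbT; apply/eqP/nesym.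
    move/perm_to_rem => pa'; eexists; apply: (perm_trans pa).
    by rewrite perm_cons; exact: pa'.
  rewrite (odd_sgn_chain fe ilt jlt wa vc z p).
  have p' : perm_eq (vertices t) [:: vx a', vx a & B].
    by apply: (perm_trans p); rewrite -[[:: vx a, _ & _]]/([:: vx a] ++ [:: vx a'] ++ B) perm_catCA.
  rewrite (odd_sgn_chain fe' ilt' jlt' wa' vc' z' p').
  by rewrite (odd_inversions_swap (vertices_uniq t n0) p) ?addNb.
have ii : i' = i by exact: esym (congr1 tag eaa).
case: _ / (esym ii) a' ilt' wa' a1' wav' winj' wup' eaa => a' ilt' wa' a1' wav' winj' wup' /vx_inj aa.
case: _ / aa wa' a1' wav' => wa' a1' wav'.
(* The topmost level at which the inner maps differ: agreement above it puts the oppositely ordered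
   pair x, y found below into one fiber. *)
have [l [ln lne lup]] : exists l, [/\ l < n,
    exists x, finner f l x <> finner f' l x :> nat
    & forall m x, l < m -> finner f m x = finner f' m x :> nat].
  pose P l := [exists x, finner f l x != finner f' l x :> nat].
  have exP : exists l, P l.
    apply: contrapT => h; apply: ff'; apply: (factor_ext fe fe') => l x.
    by apply/eqP/negPn/negP => ne; apply: h; exists l; apply/existsP; exists x.
  have ubP l : P l -> l <= n.
    move=> /existsP[x /eqP ne]; rewrite leqNgt; apply/negP => nl; apply: ne.
    have := ltn_ord (finner f l x); have := ltn_ord (finner f' l x).
    by have := lvl_root (fmid f) (ltnW nl); have := lvl_root (fmid f') (ltnW nl); lia.
  case: (ex_maxnP exP ubP) => l /existsP[x /eqP ne] lmax; exists l; split.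
  - rewrite ltnNge; apply/negP => nl; apply: ne.
    have := ltn_ord (finner f l x); have := ltn_ord (finner f' l x).
    by have := lvl_root (fmid f) nl; have := lvl_root (fmid f') nl; lia.
  - by exists x.
  move=> m y lm; apply/eqP/negPn/negP => ney.
  have : m <= l by apply: lmax; apply/existsP; exists y.
  by rewrite leqNgt lm.
have li : l != i.
  apply/eqP => li; case: lne => x; apply.
  by case: _ / (esym li) x => x; rewrite wav wav'.
have [x [y [xy yx]]] : exists x y, finner f l x < finner f l y /\ finner f' l y < finner f' l x.
  apply: contrapT => h; case: lne => x; apply.
  apply: (initial_unique (@tmap_initial n _ _ (finner f) l) (@tmap_initial n _ _ (finner f') l)).
  move=> {}x y; have [->|nxy] := eqVneq x y; first by rewrite !leqnn.
  have ne (g : factor t s) : injective (finner g l) -> finner g l x != finner g l y :> nat.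
    by move=> inj; apply: contra nxy => /eqP/val_inj/inj ->.
  have nw := ne f (winj l li); have nw' := ne f' (winj' l li).
  apply/idP/idP => le; rewrite leqNgt; apply/negP => lt; apply: h.
    by exists x, y; split=> //; rewrite ltn_neqAle nw le.
  by exists y, x; split=> //; rewrite ltn_neqAle nw' le.
have pxy : finner f l.+1 (par x) = finner f l.+1 (par y).
  apply: val_inj; apply/eqP; rewrite /= eqn_leq.
  apply/andP; split; first by rewrite -!tmap_par par_mono// ltnW.
  by rewrite !lup// -!tmap_par par_mono// ltnW.
have pxy' : finner f' l.+1 (par y) = finner f' l.+1 (par x).
  by apply: val_inj; rewrite /= -!lup// pxy.
have exy : e l x = e l y.
  apply: val_inj; apply/eqP; rewrite /= eqn_leq (fiber_mono fe pxy (ltnW xy)).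
  by rewrite (fiber_mono fe' pxy' (ltnW yx)).
have zx := chain_second fe wa vc xy exy.
have zy := chain_second fe' wa' vc' yx (esym exy).
(* f removes x second and [f'] removes y. Since e identifies x and y, the remaining lists have the
   same image, and only the exchange of x and y contributes a sign. *)
have [B p] : exists B, perm_eq (vertices t) [:: vx a, vx x, vx y & B].
  have lneq (q : 'I_(lvl t l)) : vx q != vx a.
    by apply: contra li => /eqP/(congr1 tag) /= ->.
  have pa := perm_to_rem (mem_vertices a ilt).
  have ua : uniq (rem (vx a) (vertices t)) by rewrite rem_uniq// vertices_uniq.
  have : vx x \in rem (vx a) (vertices t).
    by rewrite (mem_rem_uniq _ (vertices_uniq _ n0)) inE lneq mem_vertices.
  move/perm_to_rem => px.
  have : vx y \in rem (vx x) (rem (vx a) (vertices t)).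
    rewrite mem_rem_uniq// inE (mem_rem_uniq _ (vertices_uniq _ n0)) inE lneq mem_vertices//.
    by rewrite !andbT; apply/eqP => /vx_inj e2; rewrite e2 ltnn in xy.
  move/perm_to_rem => py; eexists; apply: (perm_trans pa); rewrite perm_cons.
  by apply: (perm_trans px); rewrite perm_cons; exact: py.
have p' : perm_eq (vertices t) [:: vx a, vx y, vx x & B].
  apply: (perm_trans p); rewrite perm_cons.
  by rewrite -[[:: vx x, _ & _]]/([:: vx x] ++ [:: vx y] ++ B) perm_catCA.
rewrite (odd_sgn_chain fe ilt jlt wa vc zx p) (odd_sgn_chain fe' ilt jlt' wa' vc' zy p').
rewrite (odd_inversions_swap1 (vertices_uniq t n0) p).
have -> : map (vmap e) (vx x :: B) = map (vmap e) (vx y :: B).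
  by rewrite /= /vmap /= exy.
by rewrite addNb.
Qed.

End DegreeTwo.
End Vertices.

(** * Factorizations of degree two *)

Section TwoFactors.
Context (n : nat) (t s : tree n) (e : thom t s).
Local Open Scope nat_scope.
Local Notation comp f := (tcomp (fouter f) (finner f)).

Lemma factor_deg0 (f : factor t s) : comp f = e -> tdeg (fmid f) = tdeg t ->
  f = Factor e (tid t).
Proof.
move=> fe d; apply: (factor_ext fe); first exact: tcomp_idr.
by move=> i x; apply: tdeg0_id.
Qed.

Lemma factor_outer0 (f : factor t s) : comp f = e -> tdeg (fmid f) = tdeg s ->
  f = Factor (tid s) e.
Proof.
move=> fe d; apply: (factor_ext fe); first exact: tcomp_idl.
by move=> i x /=; rewrite -[in RHS]fe /= (tdeg0_id (fouter f) d).
Qed.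

(** Read off from the matching. The cells with an identity as inner or as outer part each have a
    partner in the middle degree, and a middle cell can only be matched with one of those two. *)
Lemma two_factors : tdeg t = (tdeg s).+2 ->
  exists g1 g2 : factor t s, [/\ comp g1 = e /\ tdeg (fmid g1) = (tdeg s).+1,
    comp g2 = e /\ tdeg (fmid g2) = (tdeg s).+1, g1 <> g2
    & forall g, comp g = e -> tdeg (fmid g) = (tdeg s).+1 -> g = g1 \/ g = g2].
Proof.
move=> d2; have ds : tdeg t <> tdeg s by lia.
have le (f : factor t s) := leq_tdeg (finner f).
have ge (f : factor t s) := leq_tdeg (fouter f).
have md (f g : factor t s) : comp g = comp f -> matched f g ->
    tdeg (fmid f) = (tdeg (fmid g)).+1.
  by move=> e1 /(matched_facet e1) [v [_ _]].
pose fid := Factor e (tid t); pose ftop := Factor (tid s) e.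
have cid' : comp fid = e by rewrite /= tcomp_idr.
have ctop : comp ftop = e by rewrite /= tcomp_idl.
have [g1 [c1 m1]] := matched_total fid ds; rewrite cid' in c1.
have {}m1 : matched fid g1.
  case: m1 => // m1; have := md g1 fid; rewrite cid' c1 => /(_ erefl m1) /=.
  by have := le g1; lia.
have [g2 [c2 m2]] := matched_total ftop ds; rewrite ctop in c2.
have {}m2 : matched g2 ftop.
  case: m2 => // m2; have := md ftop g2; rewrite ctop c2 => /(_ erefl m2) /=.
  by have := ge g2; lia.
have d1 := md _ _ (etrans c1 (esym cid')) m1.
have d2' := md _ _ (etrans ctop (esym c2)) m2.
exists g1, g2; split=> //; first by split=> //; move: d1 => /=; lia.
  move=> g12; rewrite -g12 in m2.
  by apply: (matched_excl _ _ m2 m1); rewrite ?ctop ?cid' c1.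
move=> g cg dg; have [g' [cg' [mg|mg]]] := matched_total g ds; rewrite cg in cg'.
  right; have d3 := md _ _ (etrans cg' (esym cg)) mg.
  have g't : g' = ftop by apply: factor_outer0 => //; lia.
  by rewrite g't in mg; apply: (matched_inj _ _ mg m2); rewrite ctop.
left; have d3 := md _ _ (etrans cg (esym cg')) mg.
have g'i : g' = fid by apply: factor_deg0 => //; lia.
by rewrite g'i in mg; apply: (matched_fun _ _ mg m1); rewrite cid'.
Qed.

End TwoFactors.

Section Sums.
Context (k : comPzRingType) (n : nat).

Lemma hdegE (t s : tree n) (u : thom t s) : exists d : nat, hdeg u = d /\ tdeg t = (tdeg s + d)%N.
Proof.
exists (tdeg t - tdeg s)%N; have := leq_tdeg u; rewrite /hdeg; split; lia.
Qed.

Definition outs (t s : tree n) (u : thom t s) : seq (factor t s) := fset_set (outer1 u).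
Definition ins (t s : tree n) (u : thom t s) : seq (factor t s) := fset_set (inner1 u).

Lemma outsP (t s : tree n) (u : thom t s) f :
  reflect (tcomp (fouter f) (finner f) = u /\ hdeg (fouter f) = 1) (f \in outs u).
Proof.
rewrite /outs in_fset_set; last by apply: finite_setIl; exact: factorization_finite.
by apply: (iffP idP) => [/set_mem|/mem_set].
Qed.
Lemma insP (t s : tree n) (u : thom t s) f :
  reflect (tcomp (fouter f) (finner f) = u /\ hdeg (finner f) = 1) (f \in ins u).
Proof.
rewrite /ins in_fset_set; last by apply: finite_setIl; exact: factorization_finite.
by apply: (iffP idP) => [/set_mem|/mem_set].
Qed.
Lemma outs_uniq (t s : tree n) (u : thom t s) : uniq (outs u).
Proof. exact: fset_uniq. Qed.
Lemma ins_uniq (t s : tree n) (u : thom t s) : uniq (ins u).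
Proof. exact: fset_uniq. Qed.

Lemma sgn_sum0 (t s : tree n) (e : thom t s) : hdeg e = 2 ->
  \sum_(f <- outs e) sgn k (fouter f) * sgn k (finner f) = 0.
Proof.
move=> d2; have [d [dE dt]] := hdegE e.
have d2' : tdeg t = (tdeg s).+2 by lia.
have [g1 [g2 [[c1 d1] [c2 d2''] g12 all12]]] := two_factors e d2'.
have p : perm_eq (outs e) [:: g1; g2].
  apply: uniq_perm; rewrite ?outs_uniq//=.
    by rewrite inE andbT; apply/eqP.
  move=> g; rewrite !inE; apply/outsP/orP => [[cg dg]|].
    by have [||->|->] := all12 g; rewrite ?eqxx//; [move: dg; rewrite /hdeg; lia|left|right].
  by case=> /eqP ->; split=> //; rewrite /hdeg; lia.
rewrite (perm_big _ p) /= !big_cons big_nil addr0 /sgn -!exprD.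
have so m : (-1) ^+ m = (-1) ^+ odd m :> k by rewrite signr_odd.
rewrite so [X in _ + X]so.
rewrite (oddD (sgn_exp (fouter g1))) (oddD (sgn_exp (fouter g2))) (odd_sgn_two c1 c2 g12); try lia.
by case: (_ (+) _) => /=; rewrite ?expr0 ?expr1 ?addNr ?subrr.
Qed.

End Sums.

(** * Generators of the Koszul complex *)

Section Casts.
Context (k : comPzRingType).

Lemma gcast_comp (C : int -> lmodType k) i j l x : i = j \/ j = l ->
  gcast C j l (gcast C i j x) = gcast C i l x.
Proof. by case=> e; subst; rewrite gcast_id. Qed.

Lemma gcastK (C : int -> lmodType k) i j x : i = j -> gcast C j i (gcast C i j x) = x.
Proof. by move=> e; subst; rewrite !gcast_id. Qed.

Lemma dif_gcast (C : dmod k) i j l m x : i = j -> l = m ->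
  dif C j m (gcast C i j x) = gcast C l m (dif C i l x).
Proof. by move=> e e'; subst; rewrite !gcast_id. Qed.

Lemma dhom_gcast (C D : dmod k) (f : dhom C D) i j x :
  f j (gcast C i j x) = gcast D i j (f i x).
Proof.
have [e|ij] := eqVneq i j; first by subst; rewrite !gcast_id.
by rewrite !gcast_neq// lin_app0.
Qed.

Lemma lin_sumE (U V : lmodType k) (I : Type) (r : seq I) (F : I -> lin U V) x :
  lin_fun (\sum_(i <- r) F i) x = \sum_(i <- r) F i x.
Proof. by elim/big_ind2: _ => [|a b c d <- <-|//]; rewrite ?lin0E ?linDE. Qed.

Lemma lin_app_sum (U V : lmodType k) (I : Type) (r : seq I) (P : pred I) (F : I -> U) (f : lin U V) :
  f (\sum_(i <- r | P i) F i) = \sum_(i <- r | P i) f (F i).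
Proof. exact: linear_sum. Qed.

Lemma sgS (i : int) : sg k (i + 1) = - sg k i.
Proof.
rewrite /sg -signr_odd -[in RHS]signr_odd -signrN; congr (_ ^+ _).
by have -> : odd (absz (i + 1)) = ~~ odd (absz i) by lia.
Qed.
Lemma sgB (i : int) : sg k (i - 1) = - sg k i.
Proof. by rewrite -[in RHS](subrK 1 i) sgS opprK. Qed.
Lemma sg_sq (i : int) : sg k i * sg k i = 1.
Proof. by rewrite /sg -exprD -signr_odd addnn odd_double. Qed.
Lemma sg0 : sg k 0 = 1.
Proof. by []. Qed.

End Casts.

Section Tens.
Context (k : comPzRingType) (M N : lmodType k).
Fact tens_right_linear (x : M) : linear (fun y : N => tens x y).
Proof. by move=> a y y'; exact: tensPr. Qed.
Definition tens_right x : lin N (tensor M N) := mklin (tens_right_linear x).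
Fact tens_left_linear (y : N) : linear (fun x : M => tens x y).
Proof. by move=> a x x'; exact: tensPl. Qed.
Definition tens_left y : lin M (tensor M N) := mklin (tens_left_linear y).
End Tens.

Section Generators.
Context (k : comPzRingType) (n : nat) (S : diagram k n) (phi : tree n).
Local Notation R := (representable k phi).
Local Notation K := (koszul R S).

(* v (x) {u} (x) y for a cell f = (v, u), placed in degree m; zero unless
   q = m - deg u. *)
Definition gen m t (f : factor t phi) q : lin (S t q) (K m) :=
  lcomp (kin R S m (finner f) (Posz 0))
    (lcomp (tens_right _ (free_gen k (fouter f) : R (fmid f) (Posz 0)))
           (gcast (S t) q (m - hdeg (finner f) - Posz 0))).

Lemma rep_thin (r : tree n) (p : int) (x : R r p) : p != 0 -> x = 0.
Proof. by case: p x => [[|p]|p] x //= _; exact: thinmx0. Qed.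

Section Lift.
Context (m : int) (U : lmodType k).
Context (h : forall t (f : factor t phi) q, lin (S t q) U).

Let hb (t r : tree n) (u : thom t r) q : lin (free_mod k (thom r phi)) (lin (S t q) U) :=
  free_lift (fun v => h (Factor v u) q).

Fact lift_bl (t r : tree n) (u : thom t r) q a x x' y :
  lin_fun (hb u q (a *: x + x')) y = a *: lin_fun (hb u q x) y + lin_fun (hb u q x') y.
Proof. by rewrite lin_appP. Qed.
Fact lift_br (t r : tree n) (u : thom t r) q a x y y' :
  lin_fun (hb u q x) (a *: y + y') = a *: lin_fun (hb u q x) y + lin_fun (hb u q x) y'.
Proof. by rewrite lin_appP. Qed.

(** Zero may be taken outside p = 0, where the representable factor vanishes. *)
Definition lift_at (j : kidx n) : lin (ksummand R S m j) U :=
  match kdeg j as p return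
    lin (tensor (R (ktgt j) p) (S (ksrc j) (m - hdeg (kmor j) - p))) U with
  | Posz 0 => tens_lift (@lift_bl _ _ (kmor j) (m - hdeg (kmor j) - 0))
                        (@lift_br _ _ (kmor j) (m - hdeg (kmor j) - 0))
  | _ => 0
  end.

Definition klift : lin (K m) U := dsum_lift lift_at.

Lemma kliftE t (f : factor t phi) q y : q = m - hdeg (finner f) ->
  klift (gen m f q y) = h f q y.
Proof.
move=> qE; rewrite /klift /gen /kin !lcompE dsum_liftE.
rewrite [LHS]tens_liftE /hb free_liftE; case: f qE => r v u /= qE.
have e : q = m - hdeg u - 0 by rewrite subr0.
by rewrite -[Posz 0]/(0 : int); case: _ / e; rewrite gcast_id.
Qed.
End Lift.

Lemma gen_ext m (U : lmodType k) (f g : lin (K m) U) :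
  (forall t (c : factor t phi) q y, q = m - hdeg (finner c) ->
     f (gen m c q y) = g (gen m c q y)) -> f = g.
Proof.
move=> fg; apply: dsum_lin_ext => -[t r u p]; rewrite -/(kin R S m u p).
apply: tens_ext => x y.
have [p0|p0] := eqVneq p 0; last first.
  rewrite (rep_thin x p0); have -> : tens (0 : R r p) y = 0.
    exact: (lin_app0 (tens_left _ y)).
  by rewrite !lin_app0.
move: x y; rewrite p0 => x y.
pose F (h : lin (K m) U) := lcomp h (lcomp (kin R S m u 0) (tens_left (R r 0) y)).
suff e : F f = F g by exact: (congr1 (fun h : lin _ _ => h x) e).
apply: free_ext => v.
have := fg t (Factor v u) (m - hdeg u - 0) y (subr0 _).
by rewrite /gen !lcompE gcast_id.
Qed.

Definition cell : choiceType := {t : tree n & factor t phi}%type.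

Section Coordinates.
Context (m : int).
Definition coord_mod (c : cell) : lmodType k := S (tag c) (m - hdeg (finner (tagged c))).
Definition mkcell t (f : factor t phi) : cell := Tagged (fun t => factor t phi) f.

(** Identifies K(phi) with the direct sum of the modules of S over all cells, so that the
    coefficient of an element at a cell makes sense. *)
Definition coords : lin (K m) (dsum coord_mod) := klift m (fun t f q =>
  lcomp (dsum_in coord_mod (mkcell f)) (gcast (S t) q (m - hdeg (finner f)))).
Definition gcoord t (f : factor t phi) (z : K m) : S t (m - hdeg (finner f)) :=
  sub_val (coords z) (mkcell f).

Lemma coordP t (f : factor t phi) : linear (gcoord f).
Proof. by move=> a x y; rewrite /gcoord linearP. Qed.
Definition lcoord t (f : factor t phi) : lin (K m) (S t (m - hdeg (finner f))) :=
  mklin (coordP f).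

Lemma coord_gen t (f : factor t phi) q y : q = m - hdeg (finner f) ->
  gcoord f (gen m f q y) = gcast (S t) q (m - hdeg (finner f)) y.
Proof.
move=> qE; rewrite /gcoord /coords kliftE// lcompE.
exact: (@dsum_at_eq _ _ coord_mod (mkcell f)).
Qed.

Lemma gen_neq t (f : factor t phi) q : q <> m - hdeg (finner f) -> gen m f q = 0.
Proof.
by move=> /eqP qE; rewrite /gen gcast_neq ?lcomp0r ?lcomp0r// subr0.
Qed.

Lemma coord_gen_neq t (f : factor t phi) t' (f' : factor t' phi) q y :
  mkcell f <> mkcell f' -> gcoord f' (gen m f q y) = 0.
Proof.
move=> ff'; have [qE|qE] := pselect (q = m - hdeg (finner f)); last first.
  by rewrite gen_neq// lin0E [LHS](lin_app0 (lcoord f')).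
by rewrite /gcoord /coords kliftE// lcompE [LHS]dsum_at_neq.
Qed.

Lemma coord_sum (z : K m) : exists A : {fset cell},
  (forall t (f : factor t phi), mkcell f \notin A -> gcoord f z = 0) /\
  z = \sum_(c <- A) gen m (tagged c) (m - hdeg (finner (tagged c))) (gcoord (tagged c) z).
Proof.
have [A Az] := dsum_fset (coords z).
exists A; split; first by move=> t f /Az.
pose psi : lin (dsum coord_mod) (K m) :=
  dsum_lift (fun c : cell => gen m (tagged c) (m - hdeg (finner (tagged c)))).
have psiK : psi (coords z) = z.
  rewrite -lcompE; have -> : lcomp psi coords = lid _; last by [].
  apply: gen_ext => t f q y qE; rewrite lcompE /coords kliftE// lcompE.
  by rewrite [LHS](dsum_liftE _ (i := mkcell f)); subst q; rewrite gcast_id.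
transitivity (psi (\sum_(c <- A) dsum_in coord_mod c (sub_val (coords z) c))).
  by rewrite -(dsum_sum Az) psiK.
rewrite linear_sum; apply: eq_bigr => -[t f] _.
exact: (dsum_liftE _ (i := mkcell f)).
Qed.
End Coordinates.

(** The left factor v has degree 0, so the only signs left besides [sgn] are those of deg u. *)
Lemma dif_gen m m' t r (v : thom r phi) (u : thom t r) q y : m = m' + 1 -> q = m - hdeg u ->
  dif K m m' (gen m (Factor v u) q y) =
  sg k (hdeg u) *: gen m' (Factor v u) (q - 1) (dif (S t) q (q - 1) y)
  + \sum_(g <- outs u) sgn k (fouter g) *:
      gen m' (Factor (tcomp v (fouter g)) (finner g)) q y
  + sg k (hdeg u) *: \sum_(g <- ins u) sgn k (finner g) *:
      gen m' (Factor v (fouter g)) q (dmap S (finner g) q y).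
Proof.
move=> mE qE.
set q0 := m - hdeg u - 0; have q0E : q = q0 by rewrite /q0 subr0.
pose y0 := gcast (S t) q q0 y.
have gE m1 t1 r1 (v1 : thom r1 phi) (u1 : thom t1 r1) q1 y1 :
    gen m1 (Factor v1 u1) q1 y1 = kin R S m1 u1 0
      (tens (free_gen k v1 : R r1 0) (gcast (S t1) q1 (m1 - hdeg u1 - 0) y1)) by [].
pose X : tensor (R r 0) (S t q0) := tens (free_gen k v : R r 0) y0.
have e1 : kdif_int R S m m' u 0 X =
    sg k (hdeg u) *: gen m' (Factor v u) (q - 1) (dif (S t) q (q - 1) y).
  rewrite /kdif_int linDE tens_map0l lcomp0r lin0E add0r linZE add0r; congr (_ *: _).
  rewrite lcompE tens_mapE gE; congr (kin _ _ _ _ _ (tens _ _)).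
  by rewrite /y0 (dif_gcast (l := q - 1)) //; lia.
have fin_o : finite_set (outer1 u) by apply: finite_setIl; exact: factorization_finite.
have fin_i : finite_set (inner1 u) by apply: finite_setIl; exact: factorization_finite.
have e2 : kdif_outer R S m m' u 0 X = \sum_(g <- outs u) sgn k (fouter g) *:
      gen m' (Factor (tcomp v (fouter g)) (finner g)) q y.
  rewrite /kdif_outer linZE scale1r (fsbig_finite _ _ fin_o) lin_sumE.
  apply: eq_bigr => g _; rewrite linZE; congr (_ *: _).
  rewrite lcompE tens_mapE gE; congr (kin _ _ _ _ _ (tens _ _)).
    exact: free_mapE.
  by rewrite /y0 gcast_comp//; left.
have e3 : kdif_inner R S m m' u 0 X = sg k (hdeg u) *: \sum_(g <- ins u) sgn k (finner g) *:
      gen m' (Factor v (fouter g)) q (dmap S (finner g) q y).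
  rewrite /kdif_inner linZE add0r (fsbig_finite _ _ fin_i) lin_sumE; congr (_ *: _).
  apply: eq_bigr => g _; rewrite linZE; congr (_ *: _).
  rewrite lcompE tens_mapE gE; congr (kin _ _ _ _ _ (tens _ _)).
  by rewrite lcompE /y0 dhom_gcast gcast_comp//; left.
transitivity (kdif_at R S m m' (KIdx u 0) X).
  exact: (congr1 (fun h : lin _ _ => h X) (kdif_kin R S m m' u 0)).
transitivity (kdif_int R S m m' u 0 X + kdif_outer R S m m' u 0 X + kdif_inner R S m m' u 0 X).
  by [].
by rewrite e1 e2 e3.
Qed.
End Generators.

Section GeneratorsMap.
Context (k : comPzRingType) (n : nat) (S : diagram k n).
Local Notation K := (koszul_diagram S).
Local Notation gen := (gen S).

Lemma gen_degree phi m t r (v : thom r phi) (u : thom t r) q :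
  q != m - hdeg u -> gen m (Factor v u) q = 0.
Proof. by move=> /eqP qE; exact: gen_neq. Qed.

Lemma dmap_gen (phi psi : tree n) (w : thom phi psi) m t r (v : thom r phi) (u : thom t r) q y :
  dmap K w m (gen m (Factor v u) q y) = gen m (Factor (tcomp w v) u) q y.
Proof.
set X := tens (free_gen k v : representable k phi r 0) (gcast (S t) q (m - hdeg u - 0) y).
transitivity (lcomp (kin (representable k psi) S m u 0)
    (tens_map (rep_push k w r 0) (lid _)) X).
  exact: (congr1 (fun h : lin _ _ => h X) (kmapE S (rep_push k w) m u 0)).
rewrite lcompE tens_mapE; congr (kin _ _ _ _ _ (tens _ _)).
exact: free_mapE.
Qed.

End GeneratorsMap.

Opaque gen.

(** * The Koszul differential *)

Section Triples.
Context (n : nat) (t s : tree n).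

(** A common index for refinements of the inner and of the outer part of a factorization. The flat
    chains replace nested dependent pairs, which are awkward to compare. *)
Record triple := Triple { tmid1 : tree n; tmid2 : tree n;
  touter : thom tmid2 s; tmiddle : thom tmid1 tmid2; tinner : thom t tmid1 }.
HB.instance Definition _ := gen_eqMixin triple.
HB.instance Definition _ := gen_choiceMixin triple.

Definition refine_inner (g : factor t s) (h : factor t (fmid g)) : triple :=
  Triple (fouter g) (fouter h) (finner h).
Definition refine_outer (g : factor t s) (h : factor (fmid g) s) : triple :=
  Triple (fouter h) (finner h) (finner g).

Definition merge_outer (x : triple) : factor t s := Factor (tcomp (touter x) (tmiddle x)) (tinner x).
Definition merge_inner (x : triple) : factor t s := Factor (touter x) (tcomp (tmiddle x) (tinner x)).

Definition split_inner (x : triple) : {g : factor t s & factor t (fmid g)} :=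
  Tagged (fun g => factor t (fmid g)) (Factor (tmiddle x) (tinner x) : factor t (fmid (merge_inner x))).
Definition split_outer (x : triple) : {g : factor t s & factor (fmid g) s} :=
  Tagged (fun g => factor (fmid g) s) (Factor (touter x) (tmiddle x) : factor (fmid (merge_outer x)) s).

Lemma refine_innerK (g : factor t s) (h : factor t (fmid g)) :
  tcomp (fouter h) (finner h) = finner g ->
  split_inner (refine_inner h) = Tagged (fun g => factor t (fmid g)) h.
Proof. by case: g h => r a b [r' c d] /= e; case: _ / e. Qed.

Lemma refine_outerK (g : factor t s) (h : factor (fmid g) s) :
  tcomp (fouter h) (finner h) = fouter g ->
  split_outer (refine_outer h) = Tagged (fun g => factor (fmid g) s) h.
Proof. by case: g h => r a b [r' c d] /= e; case: _ / e. Qed.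

Lemma refine_inner_uniq (A : seq (factor t s)) (B : forall g : factor t s, seq (factor t (fmid g))) :
  uniq A -> (forall g, uniq (B g)) ->
  (forall g h, h \in B g -> tcomp (fouter h) (finner h) = finner g) ->
  uniq [seq refine_inner h | g <- A, h <- B g].
Proof.
move=> uA uB hB; apply: allpairs_uniq_dep => //.
move=> _ _ /allpairsPdep[g [h [_ hg ->]]] /allpairsPdep[g' [h' [_ hg' ->]]] /= e.
by rewrite -(refine_innerK (hB _ _ hg)) -(refine_innerK (hB _ _ hg')) e.
Qed.

Lemma refine_outer_uniq (A : seq (factor t s)) (B : forall g : factor t s, seq (factor (fmid g) s)) :
  uniq A -> (forall g, uniq (B g)) ->
  (forall g h, h \in B g -> tcomp (fouter h) (finner h) = fouter g) ->
  uniq [seq refine_outer h | g <- A, h <- B g].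
Proof.
move=> uA uB hB; apply: allpairs_uniq_dep => //.
move=> _ _ /allpairsPdep[g [h [_ hg ->]]] /allpairsPdep[g' [h' [_ hg' ->]]] /= e.
by rewrite -(refine_outerK (hB _ _ hg)) -(refine_outerK (hB _ _ hg')) e.
Qed.

Context (u : thom t s).

Definition facs : seq (factor t s) := fset_set (factorization u).
Lemma facsP f : reflect (tcomp (fouter f) (finner f) = u) (f \in facs).
Proof.
rewrite /facs in_fset_set; last exact: factorization_finite.
by apply: (iffP idP) => [/set_mem|/mem_set].
Qed.

Context (V : zmodType) (F : triple -> V).

(** The two merges performed last are grouped into one morphism of degree two, to which [sgn_sum0]
    applies. *)
Lemma sum_outs_outs :
  \sum_(g <- outs u) \sum_(h <- outs (finner g)) F (refine_inner h) =
  \sum_(g <- facs | hdeg (fouter g) == 2) \sum_(h <- outs (fouter g)) F (refine_outer h).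
Proof.
rewrite -[RHS]big_filter.
transitivity (\sum_(x <- [seq refine_inner h | g <- outs u, h <- outs (finner g)]) F x).
  by rewrite big_allpairs_dep.
transitivity (\sum_(x <- [seq refine_outer h | g <- [seq g <- facs | hdeg (fouter g) == 2], h <- outs (fouter g)]) F x); last first.
  by rewrite big_allpairs_dep.
apply/perm_big/uniq_perm.
- by apply: refine_inner_uniq => [|g|g h /outsP[]]; rewrite ?outs_uniq.
- by apply: refine_outer_uniq => [|g|g h /outsP[]]; rewrite ?outs_uniq ?filter_uniq ?fset_uniq.
move=> x; apply/allpairsPdep/allpairsPdep.
  case=> [g [h [/outsP[gu dg] /outsP[hg dh] ->]]].
  exists (merge_outer (refine_inner h)), (Factor (fouter g) (fouter h)); split=> //.
    rewrite mem_filter; apply/andP; split.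
      by rewrite hdeg_comp dg dh.
    by apply/facsP; rewrite /= -tcompA hg gu.
  by apply/outsP.
case=> [g [h []]]; rewrite mem_filter => /andP[/eqP dg /facsP gu] /outsP[hg dh] ->.
exists (merge_inner (refine_outer h)), (Factor (finner h) (finner g)); split=> //.
  by apply/outsP; rewrite /= tcompA hg.
apply/outsP; split=> //=; have := hdeg_comp (fouter h) (finner h); rewrite hg dg dh; lia.
Qed.

Lemma sum_ins_ins :
  \sum_(g <- ins u) \sum_(h <- ins (fouter g)) F (refine_outer h) =
  \sum_(g <- facs | hdeg (finner g) == 2) \sum_(h <- outs (finner g)) F (refine_inner h).
Proof.
rewrite -[RHS]big_filter.
transitivity (\sum_(x <- [seq refine_outer h | g <- ins u, h <- ins (fouter g)]) F x).
  by rewrite big_allpairs_dep.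
transitivity (\sum_(x <- [seq refine_inner h | g <- [seq g <- facs | hdeg (finner g) == 2], h <- outs (finner g)]) F x); last first.
  by rewrite big_allpairs_dep.
apply/perm_big/uniq_perm.
- by apply: refine_outer_uniq => [|g|g h /insP[]]; rewrite ?ins_uniq.
- by apply: refine_inner_uniq => [|g|g h /outsP[]]; rewrite ?outs_uniq ?filter_uniq ?fset_uniq.
move=> x; apply/allpairsPdep/allpairsPdep.
  case=> [g [h [/insP[gu dg] /insP[hg dh] ->]]].
  exists (merge_inner (refine_outer h)), (Factor (finner h) (finner g)); split=> //.
    rewrite mem_filter; apply/andP; split.
      by rewrite hdeg_comp dg dh.
    by apply/facsP; rewrite /= tcompA hg gu.
  by apply/outsP.
case=> [g [h []]]; rewrite mem_filter => /andP[/eqP dg /facsP gu] /outsP[hg dh] ->.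
exists (merge_outer (refine_inner h)), (Factor (fouter g) (fouter h)); split=> //.
  apply/insP; rewrite /= -tcompA hg; split=> //.
  by have := hdeg_comp (fouter h) (finner h); rewrite hg dg dh; lia.
by apply/insP.
Qed.

Lemma sum_outs_ins :
  \sum_(g <- outs u) \sum_(h <- ins (finner g)) F (refine_inner h) =
  \sum_(g <- ins u) \sum_(h <- outs (fouter g)) F (refine_outer h).
Proof.
transitivity (\sum_(x <- [seq refine_inner h | g <- outs u, h <- ins (finner g)]) F x).
  by rewrite big_allpairs_dep.
transitivity (\sum_(x <- [seq refine_outer h | g <- ins u, h <- outs (fouter g)]) F x); last first.
  by rewrite big_allpairs_dep.
apply/perm_big/uniq_perm.
- by apply: refine_inner_uniq => [|g|g h /insP[]]; rewrite ?ins_uniq ?outs_uniq.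
- by apply: refine_outer_uniq => [|g|g h /outsP[]]; rewrite ?ins_uniq ?outs_uniq.
move=> x; apply/allpairsPdep/allpairsPdep.
  case=> [g [h [/outsP[gu dg] /insP[hg dh] ->]]].
  exists (merge_outer (refine_inner h)), (Factor (fouter g) (fouter h)); split=> //.
    by apply/insP; rewrite /= -tcompA hg.
  by apply/outsP.
case=> [g [h [/insP[gu dg] /outsP[hg dh] ->]]].
exists (merge_inner (refine_outer h)), (Factor (finner h) (finner g)); split=> //.
  by apply/outsP; rewrite /= tcompA hg.
by apply/insP.
Qed.

End Triples.

Section Square.
Context (k : comPzRingType) (n : nat) (S : dgdiagram k n) (phi : tree n).
Local Notation K := (koszul (representable k phi) S).

Lemma outs_hdeg (t s : tree n) (u : thom t s) g : g \in outs u ->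
  hdeg (fouter g) = 1 /\ hdeg (finner g) = hdeg u - 1.
Proof.
move=> /outsP[gu dg]; have := hdeg_comp (fouter g) (finner g); rewrite gu dg => ->.
by split=> //; rewrite addrC addKr.
Qed.
Lemma ins_hdeg (t s : tree n) (u : thom t s) g : g \in ins u ->
  hdeg (finner g) = 1 /\ hdeg (fouter g) = hdeg u - 1.
Proof.
move=> /insP[gu dg]; have := hdeg_comp (fouter g) (finner g); rewrite gu dg => ->.
by split=> //; rewrite addrK.
Qed.

Lemma sum_split3 (V : lmodType k) (I : Type) (r : seq I) (a : I -> k) (c : k) (A B C : I -> V) :
  \sum_(i <- r) a i *: (- (c *: A i) + B i - c *: C i) =
  - (c *: \sum_(i <- r) a i *: A i) + \sum_(i <- r) a i *: B i - c *: \sum_(i <- r) a i *: C i.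
Proof.
rewrite !scaler_sumr -!sumrN -!big_split /=; apply: eq_bigr => i _.
by rewrite !scalerDr !scalerN !scalerA ![c * _]mulrC.
Qed.

Lemma koszul_complex : is_complex K.
Proof.
move=> i j l.
have [ij|ij] := eqVneq i (j + 1); last by rewrite [dif K i j]dif_shape ?lcomp0r.
have [jl|jl] := eqVneq j (l + 1); last by rewrite [dif K j l]dif_shape ?lcomp0l.
apply: gen_ext => t [s v u] q y qE; rewrite lin0E lcompE (dif_gen _ _ ij qE); set c := sg k (hdeg u).
(* Products of two parts of the differential: O outer, I inner, D internal. [OO] and [II] vanish by
   [sgn_sum0]. [OI] and [IO] are one sum over chains and meet opposite signs, as do the two
   occurrences of [OD] and of [ID]. *)
pose OD := \sum_(g <- outs u) sgn k (fouter g) *: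
  gen S l (Factor (tcomp v (fouter g)) (finner g)) (q - 1) (dif (S t) q (q - 1) y).
pose ID := \sum_(g <- ins u) sgn k (finner g) *:
  gen S l (Factor v (fouter g)) (q - 1) (dmap S (finner g) (q - 1) (dif (S t) q (q - 1) y)).
pose OO := \sum_(g <- outs u) sgn k (fouter g) *: \sum_(h <- outs (finner g)) sgn k (fouter h) *:
  gen S l (Factor (tcomp (tcomp v (fouter g)) (fouter h)) (finner h)) q y.
pose OI := \sum_(g <- outs u) sgn k (fouter g) *: \sum_(h <- ins (finner g)) sgn k (finner h) *:
  gen S l (Factor (tcomp v (fouter g)) (fouter h)) q (dmap S (finner h) q y).
pose IO := \sum_(g <- ins u) sgn k (finner g) *: \sum_(h <- outs (fouter g)) sgn k (fouter h) *:
  gen S l (Factor (tcomp v (fouter h)) (finner h)) q (dmap S (finner g) q y).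
pose II := \sum_(g <- ins u) sgn k (finner g) *: \sum_(h <- ins (fouter g)) sgn k (finner h) *:
  gen S l (Factor v (fouter h)) q (dmap S (finner h) q (dmap S (finner g) q y)).
have e1 : dif K j l (gen S j (Factor v u) (q - 1) (dif (S t) q (q - 1) y)) = OD + c *: ID.
  rewrite (dif_gen _ _ jl); last by rewrite qE ij /=; lia.
  have dd : dif (S t) (q - 1) (q - 1 - 1) (dif (S t) q (q - 1) y) = 0.
    exact: (congr1 (fun h : lin _ _ => h y) (dg_diagram_sq0 S t q (q - 1) (q - 1 - 1))).
  by rewrite dd lin_app0 scaler0 add0r.
have e2 : dif K j l (\sum_(g <- outs u) sgn k (fouter g) *:
      gen S j (Factor (tcomp v (fouter g)) (finner g)) q y) = - (c *: OD) + OO - c *: OI.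
  rewrite lin_app_sum -sum_split3; apply: eq_big_seq => g /outs_hdeg [_ dg].
  rewrite lin_appZ (dif_gen _ _ jl); last by rewrite dg qE ij /=; lia.
  by rewrite dg sgB -/c !scaleNr.
have e3 : dif K j l (\sum_(g <- ins u) sgn k (finner g) *:
      gen S j (Factor v (fouter g)) q (dmap S (finner g) q y)) = - (c *: ID) + IO - c *: II.
  rewrite lin_app_sum -sum_split3; apply: eq_big_seq => g /ins_hdeg [_ dg].
  rewrite lin_appZ (dif_gen _ _ jl); last by rewrite dg qE ij /=; lia.
  have dd : dif (S (fmid g)) q (q - 1) (dmap S (finner g) q y) =
      dmap S (finner g) (q - 1) (dif (S t) q (q - 1) y).
    exact: (congr1 (fun h : lin _ _ => h y) (esym (dh_dif (dmap S (finner g)) q (q - 1)))).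
  by rewrite dg sgB -/c !scaleNr dd.
have oo0 : OO = 0.
  pose F (x : triple t s) := (sgn k (touter x) * sgn k (tmiddle x)) *:
    gen S l (Factor (tcomp v (tcomp (touter x) (tmiddle x))) (tinner x)) q y.
  transitivity (\sum_(g <- outs u) \sum_(h <- outs (finner g)) F (refine_inner h)).
    apply: eq_bigr => g _; rewrite scaler_sumr; apply: eq_bigr => h _.
    by rewrite scalerA /F /= -tcompA.
  rewrite sum_outs_outs big1// => g /eqP dg.
  transitivity (\sum_(h <- outs (fouter g)) (sgn k (fouter h) * sgn k (finner h)) *:
      gen S l (Factor (tcomp v (fouter g)) (finner g)) q y).
    by apply: eq_big_seq => h /outsP[<- _].
  by rewrite -scaler_suml sgn_sum0// scale0r.
have ii0 : II = 0.
  pose F (x : triple t s) := (sgn k (tmiddle x) * sgn k (tinner x)) *: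
    gen S l (Factor v (touter x)) q (dmap S (tcomp (tmiddle x) (tinner x)) q y).
  transitivity (\sum_(g <- ins u) \sum_(h <- ins (fouter g)) F (refine_outer h)).
    apply: eq_bigr => g _; rewrite scaler_sumr; apply: eq_bigr => h _.
    by rewrite scalerA /F /= mulrC dmap_comp.
  rewrite sum_ins_ins big1// => g /eqP dg.
  transitivity (\sum_(h <- outs (finner g)) (sgn k (fouter h) * sgn k (finner h)) *:
      gen S l (Factor v (fouter g)) q (dmap S (finner g) q y)).
    by apply: eq_big_seq => h /outsP[<- _].
  by rewrite -scaler_suml sgn_sum0// scale0r.
have oi : OI = IO.
  pose F (x : triple t s) := (sgn k (touter x) * sgn k (tinner x)) *:
    gen S l (Factor (tcomp v (touter x)) (tmiddle x)) q (dmap S (tinner x) q y).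
  transitivity (\sum_(g <- outs u) \sum_(h <- ins (finner g)) F (refine_inner h)).
    apply: eq_bigr => g _; rewrite scaler_sumr; apply: eq_bigr => h _.
    by rewrite scalerA.
  rewrite sum_outs_ins; apply: eq_bigr => g _; rewrite scaler_sumr; apply: eq_bigr => h _.
  by rewrite scalerA /F /= mulrC.
rewrite 2!lin_appD lin_appZ lin_appZ e1 e2 e3 oo0 ii0 oi.
rewrite scaler0 subr0 addr0 !scalerDr !scalerN !scalerA sg_sq !scale1r.
by rewrite (addrACA (c *: OD)) subrr add0r addrACA subrr addNr addr0.
Qed.
End Square.

(** * Cofibrant diagrams and contractions *)

Section Quasi.
Context (k : comPzRingType).
Implicit Types C D X Y Z : dmod k.

Lemma bijective_of (A B : Type) (f : A -> B) :
  injective f -> (forall y, exists x, f x = y) -> bijective f.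
Proof.
move=> fi fs; pose g y := projT1 (cid (fs y)).
have gK : cancel g f by move=> y; rewrite /g; case: cid.
by exists g => // x; apply: fi; rewrite gK.
Qed.

Definition is_cycle C i (x : C i) := dif C i (i - 1) x = 0.
Definition boundary C i (x : C i) := exists y, x = dif C (i + 1) i y.

Lemma cycleP C i (x : C i) : is_cycle x -> cycles C i x.
Proof.
move=> cx j; have [e|ne] := eqVneq j (i - 1); first by subst j.
by rewrite dif_shape ?lin0E//; lia.
Qed.

Definition acyclic C := forall i (x : C i), is_cycle x -> boundary x.

Lemma homology_surj C i (z : homology C i) :
  exists (x : C i) (cx : is_cycle x), z = quot_pi (boundaries C i) (mk_sub (cycleP cx)).
Proof.
have cx : is_cycle (sub_val (repr z)) by apply: (sub_valP (repr z)).
exists (sub_val (repr z)), cx; rewrite -[LHS]reprK.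
by congr (\pi_(quot_mod (boundaries C i))%qT _); apply: val_inj.
Qed.

Lemma homology_eq C i (x y : C i) (cx : cycles C i x) (cy : cycles C i y) :
  quot_pi (boundaries C i) (mk_sub cx) = quot_pi (boundaries C i) (mk_sub cy) <->
  boundary (x - y).
Proof. by split=> [/quot_eqP|b]; [|apply/quot_eqP]. Qed.

Lemma homology_mapE C D (f : dhom C D) i x (cx : cycles C i x) (cfx : cycles D i (f i x)) :
  homology_map f i (quot_pi (boundaries C i) (mk_sub cx)) =
  quot_pi (boundaries D i) (mk_sub cfx).
Proof.
rewrite /homology_map quot_liftE lcompE; congr (quot_pi _ _); exact: val_inj.
Qed.

Lemma dhomE C D (f : dhom C D) i j x : f j (dif C i j x) = dif D i j (f i x).
Proof. exact: (congr1 (fun h : lin _ _ => h x) (dh_dif f i j)). Qed.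

Lemma dhom_cycle C D (f : dhom C D) i x : cycles C i x -> cycles D i (f i x).
Proof. by move=> cx j; rewrite -dhomE cx lin_app0. Qed.

Lemma quasi_isoP C D (f : dhom C D) : quasi_iso f <->
  (forall i (x : C i), is_cycle x -> boundary (f i x) -> boundary x) /\
  (forall i (y : D i), is_cycle y -> exists x, is_cycle x /\ boundary (y - f i x)).
Proof.
split=> [qf|[fi fs] i].
  split=> i x cx.
    move=> [y fxy]; have [g gK _] := qf i.
    have c0 : cycles C i 0 by exact: cycles0.
    have := can_inj gK; move/(_ (quot_pi _ (mk_sub (cycleP cx))) (quot_pi _ (mk_sub c0))).
    rewrite !homology_mapE; [exact: dhom_cycle (cycleP cx)|exact: dhom_cycle c0|].
    move=> cf0 cfx /(_ _)/homology_eq; rewrite subr0; apply.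
    by apply/homology_eq; rewrite lin_app0 subr0; exists y.
  have [g _ gK] := qf i.
  have [x' [cx' xE]] := homology_surj (g (quot_pi _ (mk_sub (cycleP cx)))).
  exists x'; split=> //; have := gK (quot_pi _ (mk_sub (cycleP cx))).
  rewrite xE homology_mapE; first exact: dhom_cycle (cycleP cx').
  by move=> cf /esym/homology_eq.
apply: bijective_of => [z z'|z].
  have [x [cx ->]] := homology_surj z; have [x' [cx' ->]] := homology_surj z'.
  rewrite !homology_mapE; [exact: dhom_cycle (cycleP cx)|exact: dhom_cycle (cycleP cx')|].
  move=> c1 c2 /homology_eq; rewrite -linearB => /fi b.
  by apply/homology_eq/b; rewrite /is_cycle linearB /= cx cx' subr0.
have [y [cy ->]] := homology_surj z; have [x [cx b]] := fs i y cy.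
exists (quot_pi _ (mk_sub (cycleP cx))).
rewrite homology_mapE; first exact: dhom_cycle (cycleP cx).
by move=> c; apply/esym/homology_eq.
Qed.
End Quasi.

Section Constructions.
Context (k : comPzRingType).
Implicit Types C D X Y Z : dmod k.

Lemma pair_eq (A B : Type) (z z' : A * B) : z.1 = z'.1 -> z.2 = z'.2 -> z = z'.
Proof. by case: z z' => a b [c d] /= -> ->. Qed.

Lemma lin_app_sub (U V : lmodType k) (f : lin U V) x y : f (x - y) = f x - f y.
Proof. exact: linearB. Qed.

Lemma dif_dif C : is_complex C -> forall i j l x, dif C j l (dif C i j x) = 0.
Proof. by move=> cC i j l x; rewrite -lcompE cC. Qed.

Section Shift.
Context (e : int) (s : k) (Z : dmod k).
Fact shift_shape i j : i != j + 1 -> s *: dif Z (i + e) (j + e) = 0.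
Proof. by move=> ij; rewrite dif_shape ?scaler0//; lia. Qed.
(** The factor s, in practice a sign, turns maps of degree e that commute with the differentials up
    to s into chain maps. *)
Definition shift : dmod k :=
  @DMod k (fun i => Z (i + e)) (fun i j => s *: dif Z (i + e) (j + e)) shift_shape.

Lemma shift_complex : is_complex Z -> is_complex shift.
Proof.
by move=> cZ i j l /=; rewrite lcompZl lcompZr cZ !scaler0.
Qed.

Lemma shift_difE i j x : dif shift i j x = s *: dif Z (i + e) (j + e) x.
Proof. by []. Qed.

Lemma shift_acyclic : s * s = 1 -> acyclic Z -> acyclic shift.
Proof.
move=> ss aZ i x; rewrite /is_cycle /boundary shift_difE => cx.
have cx' : dif Z (i + e) (i - 1 + e) x = 0.
  by rewrite -[LHS]scale1r -ss -scalerA cx scaler0.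
have [|y yE] := aZ (i + e) x.
  rewrite /is_cycle; have -> : i + e - 1 = i - 1 + e by lia.
  exact: cx'.
have ee : i + e + 1 = i + 1 + e by lia.
exists (s *: gcast Z (i + e + 1) (i + 1 + e) y).
by rewrite shift_difE lin_appZ scalerA ss scale1r (dif_gcast (l := i + e)) ?gcast_id.
Qed.
End Shift.

Section ShiftMap.
Context (e : int) (s : k) (Z Z' : dmod k) (f : dhom Z Z').
Fact shift_map_dif i j : lcomp (f (j + e)) (dif (shift e s Z) i j) =
  lcomp (dif (shift e s Z') i j) (f (i + e)).
Proof. by rewrite /= lcompZr lcompZl dh_dif. Qed.
Definition shift_map : dhom (shift e s Z) (shift e s Z') :=
  @DHom k (shift e s Z) (shift e s Z') (fun i => f (i + e)) shift_map_dif.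
End ShiftMap.

Section Cone.
Context (X Y : dmod k) (q : dhom X Y).
Definition cone_gr (m : int) : lmodType k := prod (Y (m + 1)) (X m).
Definition cone_dif_fun m m' (z : cone_gr m) : cone_gr m' :=
  (gcast Y m (m' + 1) (q m z.2) - dif Y (m + 1) (m' + 1) z.1, dif X m m' z.2).
Fact cone_dif_linear m m' : linear (@cone_dif_fun m m').
Proof.
move=> a [y x] [y' x']; rewrite /cone_dif_fun /= !lin_appP.
by apply: pair_eq => //=; rewrite scalerBr opprD addrACA.
Qed.
Definition cone_dif m m' : lin (cone_gr m) (cone_gr m') := mklin (@cone_dif_linear m m').
Fact cone_shape m m' : m != m' + 1 -> cone_dif m m' = 0.
Proof.
move=> mm; apply: lin_ext => -[y x]; rewrite linE /cone_dif_fun /=.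
rewrite gcast_neq// !dif_shape//; last by lia.
by rewrite !lin0E subr0.
Qed.
(* The cone of q, shifted so that x sits in its own degree. *)
Definition cone : dmod k := DMod cone_shape.

Lemma cone_difE m m' (z : cone m) : dif cone m m' z =
  (gcast Y m (m' + 1) (q m z.2) - dif Y (m + 1) (m' + 1) z.1, dif X m m' z.2).
Proof. by []. Qed.

Lemma cone_dif1 m m' (z : cone m) : (dif cone m m' z).1 =
  gcast Y m (m' + 1) (q m z.2) - dif Y (m + 1) (m' + 1) z.1.
Proof. by []. Qed.

Lemma cone_complex : is_complex X -> is_complex Y -> is_complex cone.
Proof.
move=> cX cY i j l; apply: lin_ext => -[y x]; rewrite lcompE !cone_difE lin0E /=.
rewrite (dif_dif cX) linearB /= (dif_dif cY) subr0.
congr pair.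
have [ij|ij] := eqVneq i (j + 1); last first.
  by rewrite [gcast Y i _]gcast_neq// [dif X i j]dif_shape// !lin0E !lin_app0 subr0.
have [jl|jl] := eqVneq j (l + 1); last first.
  rewrite [gcast Y j _]gcast_neq// [dif Y (j + 1) (l + 1)]dif_shape ?lin0E ?subr0//; lia.
subst i j; rewrite !gcast_id /= dhomE.
by rewrite subrr.
Qed.

Fact cone_proj_linear m : linear (fun z : cone m => z.2).
Proof. by []. Qed.
Definition cone_proj_at m : lin (cone m) (X m) := mklin (@cone_proj_linear m).
Fact cone_proj_dif i j : lcomp (cone_proj_at j) (dif cone i j) = lcomp (dif X i j) (cone_proj_at i).
Proof. exact: lin_ext. Qed.
Definition cone_proj : dhom cone X := DHom cone_proj_dif.

Lemma cone_proj_fibration : fibration cone_proj.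
Proof. by move=> i x; exists (0, x). Qed.

(** Injectivity of q on homology makes x a boundary; surjectivity then corrects the remaining cycle
    in Y. *)
Lemma cone_acyclic : is_complex X -> is_complex Y -> quasi_iso q -> acyclic cone.
Proof.
move=> cX cY /quasi_isoP[qi qs] i [y x]; rewrite /is_cycle cone_difE => -[/=].
have -> : i - 1 + 1 = i by rewrite subrK.
rewrite gcast_id => /eqP; rewrite subr_eq0 => /eqP qx cx.
have [x' xE] : boundary x by apply: qi => //; exists y.
have cy : is_cycle (q (i + 1) x' - y).
  rewrite /is_cycle addrK linearB /= -dhomE.
  by rewrite -xE -[q i x]/(lid _ (q i x)) qx subrr.
have [x2 [cx2 [y2 y2E]]] := qs _ _ cy.
exists (y2, x' - x2); rewrite cone_difE /= gcast_id; congr pair.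
  by rewrite -[lid _ _]/(q (i + 1) (x' - x2)) -y2E lin_app_sub [X in _ - X]addrAC opprB [RHS]addrC subrK.
by rewrite linearB /= -xE (cycleP cx2) subr0.
Qed.
End Cone.

Lemma id_quasi_iso C : quasi_iso (did C).
Proof.
apply/quasi_isoP; split=> [//|i y cy]; exists y; split=> //.
by exists 0; rewrite lin_app0 /= subrr.
Qed.

Lemma acyclic_quasi_iso C D (f : dhom C D) : acyclic C -> acyclic D -> quasi_iso f.
Proof.
move=> aC aD; apply/quasi_isoP; split=> [i x cx _|i y cy]; first exact: aC.
by exists 0; split; [rewrite /is_cycle lin_app0|rewrite lin_app0 subr0; exact: aD].
Qed.

Section ConeMap.
Context (X Y X' Y' : dmod k) (q : dhom X Y) (q' : dhom X' Y') (f : dhom X X') (g : dhom Y Y').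
Hypothesis qfg : dcomp q' f = dcomp g q.
Definition cone_map_fun m (z : cone q m) : cone q' m := (g (m + 1) z.1, f m z.2).
Fact cone_map_linear m : linear (@cone_map_fun m).
Proof. by move=> a [y x] [y' x']; rewrite /cone_map_fun /= !lin_appP. Qed.
Definition cone_map_at m : lin (cone q m) (cone q' m) := mklin (@cone_map_linear m).
Fact cone_map_dif i j : lcomp (cone_map_at j) (dif (cone q) i j) =
  lcomp (dif (cone q') i j) (cone_map_at i).
Proof.
apply: lin_ext => -[y x]; rewrite !lcompE [cone_map_at j _]linE [cone_map_at i _]linE.
rewrite !cone_difE /cone_map_fun /=; congr pair; last exact: dhomE.
rewrite linearB /= dhom_gcast dhomE; congr (gcast _ _ _ _ - _).
exact: (congr1 (fun h : dhom _ _ => h i x) (esym qfg)).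
Qed.
Definition cone_map : dhom (cone q) (cone q') := DHom cone_map_dif.
End ConeMap.

Lemma gcast_shift (C : int -> lmodType k) e i j (x : C (i + e)) :
  gcast (fun m => C (m + e)) i j x = gcast C (i + e) (j + e) x.
Proof.
have [ij|ij] := eqVneq i j; first by subst j; rewrite !gcast_id.
by rewrite !gcast_neq//; lia.
Qed.

(* A lift of g to the path object cone (id Z[e]) is a contraction of g. *)
Lemma path_homotopy C Z e s (h : dhom C (cone (did (shift e s Z)))) p q x : q = p + e ->
  gcast Z (p + e) q (h p x).2 =
  s *: dif Z (q + 1) q (gcast Z (p + 1 + e) (q + 1) (h p x).1)
  + gcast Z (p - 1 + 1 + e) q (h (p - 1) (dif C p (p - 1) x)).1.
Proof.
move=> qE; subst q; rewrite dhomE cone_dif1 gcast_shift lin_app_sub gcast_comp; last first.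
  by right; lia.
rewrite gcast_id shift_difE lin_appZ.
have -> : dif Z (p + e + 1) (p + e) (gcast Z (p + 1 + e) (p + e + 1) (h p x).1) =
    gcast Z (p - 1 + 1 + e) (p + e) (dif Z (p + 1 + e) (p - 1 + 1 + e) (h p x).1).
  by apply: dif_gcast; lia.
by rewrite [RHS]addrC subrK.
Qed.
End Constructions.

Section Projective.
Context (k : comPzRingType).

(** The path object of an acyclic complex is acyclic, so its projection is an acyclic fibration and
    f lifts to it. *)
Lemma cofibrant_contraction (C : dgmod k) (cofC : cofibrant C) (Z : dmod k)
    (cZ : is_complex Z) (aZ : acyclic Z) (e : int) (s : k) (ss : s * s = 1)
    (f : forall p q, lin (C p) (Z q)) :
  (forall p q p' q' x, q = p + e -> q' = p' + e ->
     f p' q' (dif C p p' x) = s *: dif Z q q' (f p q x)) ->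
  exists h : forall p q, lin (C p) (Z q), forall p q x, q = p + e ->
    f p q x = s *: dif Z (q + 1) q (h p (q + 1) x) + h (p - 1) q (dif C p (p - 1) x).
Proof.
move=> fd; pose Y := shift e s Z.
have cY : is_complex Y by exact: shift_complex.
have aY : acyclic Y by exact: shift_acyclic.
have gd i j : lcomp (f j (j + e)) (dif C i j) = lcomp (dif Y i j) (f i (i + e)).
  by apply: lin_ext => x; rewrite !lcompE (fd i (i + e)).
pose g : dhom C Y := @DHom k C Y (fun p => f p (p + e)) gd.
have cP : is_complex (cone (did Y)) by exact: cone_complex.
have aP : acyclic (cone (did Y)) by apply: cone_acyclic => //; exact: id_quasi_iso.
have [h hE] := cofC (DGMod cP) (DGMod cY) (cone_proj (did Y)) (@cone_proj_fibration _ _ _ _)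
  (acyclic_quasi_iso _ aP aY) g.
have fst_lin p : linear (fun x : C p => (h p x).1).
  by move=> a x y; rewrite lin_appP.
exists (fun p q => lcomp (gcast Z (p + 1 + e) q) (mklin (fst_lin p))) => p q x qE.
rewrite !lcompE !linE -path_homotopy//.
have -> : (h p x).2 = f p (p + e) x.
  exact: (congr1 (fun h : dhom _ _ => h p x) hE).
by subst q; rewrite gcast_id.
Qed.

Context (n : nat).

Definition natural (F G : diagram k n) (f : forall t p q, lin (F t p) (G t q)) :=
  forall t s (u : thom t s) p q x, dmap G u q (f t p q x) = f s p q (dmap F u p x).

(* Hom(F, Z) is acyclic for acyclic Z, the maps of degree e being twisted by a
   sign s. *)
Definition hom_projective (F : diagram k n) := forall (Z : dgdiagram k n),
  (forall t, acyclic (Z t)) -> forall (e : int) (s : k), s * s = 1 ->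
  forall f : forall t p q, lin (F t p) (Z t q), natural f ->
  (forall t p q p' q' x, q = p + e -> q' = p' + e ->
     f t p' q' (dif (F t) p p' x) = s *: dif (Z t) q q' (f t p q x)) ->
  exists h : forall t p q, lin (F t p) (Z t q), natural h /\
   forall t p q p' q' x, q = p + e -> p' = p - 1 -> q' = q + 1 ->
    f t p q x = s *: dif (Z t) q' q (h t p q' x) + h t p' q (dif (F t) p p' x).

Section DiagramConstructions.
Section ShiftDiagram.
Context (e : int) (s : k) (Z : dgdiagram k n).
Definition shift_diag : diagram k n.
Proof.
refine (@Diagram k n (fun t => shift e s (Z t)) (fun t r u => shift_map e s (dmap Z u)) _ _).
- by move=> t; apply: dhom_ext => i /=; rewrite dmap_id.
- by move=> t r q v u; apply: dhom_ext => i /=; rewrite dmap_comp.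
Defined.
Definition shift_dg : dgdiagram k n :=
  @DGDiagram k n shift_diag (fun t => shift_complex e s (dg_diagram_sq0 Z t)).
End ShiftDiagram.

Section ConeDiagram.
Context (X Y : dgdiagram k n) (q : dnat X Y).
Definition cone_diag : diagram k n.
Proof.
refine (@Diagram k n (fun t => cone (q t)) (fun t r u => cone_map (dn_nat q u)) _ _).
- move=> t; apply: dhom_ext => i; apply: lin_ext => -[y x].
  by rewrite [LHS]linE /cone_map_fun !dmap_id.
- move=> t r s v u; apply: dhom_ext => i; apply: lin_ext => -[y x].
  by rewrite [LHS]linE /cone_map_fun !dmap_comp.
Defined.
Definition cone_dg : dgdiagram k n :=
  @DGDiagram k n cone_diag
    (fun t => @cone_complex _ _ _ (q t) (dg_diagram_sq0 X t) (dg_diagram_sq0 Y t)).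
Fact cone_dg_proj_nat t s (u : thom t s) :
  dcomp (cone_proj (q s)) (dmap cone_dg u) = dcomp (dmap X u) (cone_proj (q t)).
Proof. by apply: dhom_ext => i; apply: lin_ext => -[y x]. Qed.
Definition cone_dg_proj : dnat cone_dg X := DNat cone_dg_proj_nat.
End ConeDiagram.

Fact dnat_id_nat (X : diagram k n) t s (u : thom t s) :
  dcomp (did (X s)) (dmap X u) = dcomp (dmap X u) (did (X t)).
Proof. by apply: dhom_ext => i; apply: lin_ext. Qed.
Definition dnat_id (X : diagram k n) : dnat X X := DNat (@dnat_id_nat X).
End DiagramConstructions.

Lemma diag_cofibrant_projective (Q : dgdiagram k n) : diag_cofibrant Q -> hom_projective Q.
Proof.
move=> cofQ Z aZ e s ss f fn fd.
pose Y := shift_dg e s Z; pose P := cone_dg (dnat_id Y).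
have gd t i j : lcomp (f t j (j + e)) (dif (Q t) i j) = lcomp (dif (Y t) i j) (f t i (i + e)).
  by apply: lin_ext => x; rewrite !lcompE (fd t i (i + e)).
pose g0 t : dhom (Q t) (Y t) := @DHom k (Q t) (Y t) (fun p => f t p (p + e)) (gd t).
have gn t r (u : thom t r) : dcomp (g0 r) (dmap Q u) = dcomp (dmap Y u) (g0 t).
  by apply: dhom_ext => i; apply: lin_ext => x; rewrite [LHS]lcompE [RHS]lcompE /= [RHS]fn.
have aY t : acyclic (Y t) by apply: shift_acyclic.
have aP t : acyclic (P t).
  apply: cone_acyclic; [exact: dg_diagram_sq0|exact: dg_diagram_sq0|exact: id_quasi_iso].
have [h hE] := cofQ P Y (cone_dg_proj (dnat_id Y)) (fun t => @cone_proj_fibration _ _ _ _)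
  (fun t => acyclic_quasi_iso _ (aP t) (aY t)) (DNat gn).
have fst_lin t p : linear (fun x : Q t p => (h t p x).1).
  by move=> a x y; rewrite lin_appP.
exists (fun t p q => lcomp (gcast (Z t) (p + 1 + e) q) (mklin (fst_lin t p))); split.
  move=> t r u p q x; rewrite !lcompE !linE dhom_gcast; congr (gcast _ _ _ _).
  exact: (esym (congr1 (fun z : dhom (Q t) (P r) =>
    (z p x : cone (dnat_id Y r) p).1) (dn_nat h u))).
move=> t p q _ _ x qE -> ->; rewrite !lcompE !linE -path_homotopy//.
have -> : (h t p x).2 = f t p (p + e) x.
  exact: (congr1 (fun h : dhom _ _ => h p x) (hE t)).
by subst q; rewrite gcast_id.
Qed.

End Projective.

(** * Uniqueness of resolutions up to homotopy *)

Section Homotopy.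
Context (k : comPzRingType) (n : nat).
Implicit Types F G H : diagram k n.

Lemma dnatE F G (f : dnat F G) t s (u : thom t s) p x :
  dmap G u p (f t p x) = f s p (dmap F u p x).
Proof. exact: (congr1 (fun h : dhom _ _ => h p x) (esym (dn_nat f u))). Qed.

Fact dnat_comp_nat F G H (g : dnat G H) (f : dnat F G) t s (u : thom t s) :
  dcomp (dcomp (g s) (f s)) (dmap F u) = dcomp (dmap H u) (dcomp (g t) (f t)).
Proof.
apply: dhom_ext => p; apply: lin_ext => x.
by rewrite !lcompE /= !dnatE.
Qed.
Definition dnat_comp F G H (g : dnat G H) (f : dnat F G) : dnat F H :=
  DNat (dnat_comp_nat g f).

Definition homotopic F G (f g : dnat F G) := exists h : forall t p q, lin (F t p) (G t q),
  natural h /\ forall t p q p' x, q = p + 1 -> p' = p - 1 ->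
    f t p x - g t p x = dif (G t) q p (h t p q x) + h t p' p (dif (F t) p p' x).

Lemma homotopic_trans F G (f g j : dnat F G) : homotopic f g -> homotopic g j -> homotopic f j.
Proof.
case=> h [hn hE] [h' [hn' hE']]; exists (fun t p q => h t p q + h' t p q).
split=> [t s u p q x|t p q p' x qE p'E]; first by rewrite !linDE linearD /= hn hn'.
rewrite !linDE linearD /= addrACA -(hE _ _ _ _ _ qE p'E) -(hE' _ _ _ _ _ qE p'E).
by rewrite addrA subrK.
Qed.

Lemma homotopic_compr F G H (f g : dnat G H) (j : dnat F G) :
  homotopic f g -> homotopic (dnat_comp f j) (dnat_comp g j).
Proof.
case=> h [hn hE]; exists (fun t p q => lcomp (h t p q) (j t p)).
split=> [t s u p q x|t p q p' x qE p'E]; first by rewrite !lcompE hn dnatE.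
by rewrite !lcompE dhomE -(hE _ _ _ _ _ qE p'E).
Qed.

Section Projective.
Context (F : diagram k n) (projF : hom_projective F).
Context (X Y : dgdiagram k n) (q : dnat X Y) (qq : forall t, quasi_iso (q t)).

Let Z := cone_dg q.
Let aZ t : acyclic (Z t).
Proof. by apply: cone_acyclic; [exact: dg_diagram_sq0|exact: dg_diagram_sq0|exact: qq]. Qed.

Lemma cone_eq t m (z z' : cone (q t) m) : z.1 = z'.1 -> z.2 = z'.2 -> z = z'.
Proof. by case: z z' => a b [c d] /= -> ->. Qed.

Let nn1 : (-1 : k) * -1 = 1.
Proof. by rewrite mulrNN mulr1. Qed.

Lemma projective_lift (f : dnat F Y) : exists g : dnat F X, homotopic (dnat_comp q g) f.
Proof.
have f_lin t p p' : linear (fun x : F t p => (gcast (Y t) p (p' + 1) (f t p x), 0) : cone (q t) p').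
  by move=> a x y; apply: cone_eq; rewrite /= ?lin_appP// scaler0 addr0.
(* The degree is -1 because the cone holds [Y (m + 1)] in degree m, and the sign is -1 because the
   differential of Y is negated there. *)
have [||h [hn hE]] := @projF Z aZ (-1) (-1) nn1 (fun t p p' => mklin (f_lin t p p')).
- move=> t s u p p' x; apply: cone_eq => /=; last exact: lin_app0.
  by rewrite dhom_gcast dnatE.
- move=> t p p1 p' p1' x -> ->; rewrite !linE /cone_dif_fun /= !lin_app0.
  apply: cone_eq; rewrite /= ?scaler0//.
  rewrite sub0r scalerN scaleN1r opprK dhomE; apply/esym/dif_gcast; lia.
have snd_lin t p : linear (fun x : F t p => - (h t p p x).2).
  by move=> a x y; rewrite lin_appP /= opprD scalerN.
have fst_lin t p : linear (fun x : F t p => - (h t p p x).1).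
  by move=> a x y; rewrite lin_appP /= opprD scalerN.
have h2 t p p' x : p' = p - 1 -> (h t p' p' (dif (F t) p p' x)).2 = dif (X t) p p' (h t p p x).2.
  move=> p'E; have := hE t p p' p' p x _ p'E; rewrite linE => /(_ _ _)/(congr1 snd) /= e.
  have {e} := e p'E _; rewrite scaleN1r => /(_ _)/esym e.
  by apply/eqP; rewrite -subr_eq0 addrC; apply/eqP/e; lia.
have gd t i j : lcomp (mklin (snd_lin t j)) (dif (F t) i j) =
    lcomp (dif (X t) i j) (mklin (snd_lin t i)).
  apply: lin_ext => x; rewrite !lcompE !linE linearN /=; congr (- _).
  have [ij|ij] := eqVneq i (j + 1); first by apply: h2; lia.
  by rewrite !dif_shape// !lin0E lin_app0.
pose g0 t : dhom (F t) (X t) := @DHom k (F t) (X t) (fun p => mklin (snd_lin t p)) (gd t).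
have gn t s (u : thom t s) : dcomp (g0 s) (dmap F u) = dcomp (dmap X u) (g0 t).
  apply: dhom_ext => p; apply: lin_ext => x; rewrite [LHS]lcompE [RHS]lcompE !linE /= -hn.
  by rewrite linearN.
exists (DNat gn).
exists (fun t p p' => lcomp (gcast (Y t) (p + 1) p') (mklin (fst_lin t p))); split.
  move=> t s u p p' x; rewrite !lcompE !linE dhom_gcast linearN -hn.
  by congr (gcast _ _ _ _).
move=> t p q1 p' x -> p'E; have pE : p = p' + 1 by lia.
move: x p'E; subst p => x p'E; rewrite !lcompE !linE !gcast_id.
have := hE t (p' + 1) p' p' (p' + 1) x p'E p'E erefl; rewrite linE => /(congr1 fst) /=.
rewrite !gcast_id => e; have {e} fE : f t (p' + 1) x =
    -1 *: (q t (p' + 1) (h t (p' + 1) (p' + 1) x).2 -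
      dif (Y t) (p' + 1 + 1) (p' + 1) (h t (p' + 1) (p' + 1) x).1) +
    (h t p' p' (dif (F t) (p' + 1) p' x)).1 by exact: e.
rewrite fE !linearN /= scaleN1r opprD opprK addrA; congr (_ - _).
exact: addKr.
Qed.

(** With h the given homotopy, (h, f - f') is a chain map into the cone of q; the X-component of its
    contraction is a homotopy from f to f'. *)
Lemma projective_unique (f f' : dnat F X) :
  homotopic (dnat_comp q f) (dnat_comp q f') -> homotopic f f'.
Proof.
case=> h [hn hE].
have f_lin t p p' : linear (fun x : F t p =>
    (gcast (Y t) (p + 1) (p' + 1) (h t p (p + 1) x), gcast (X t) p p' (f t p x - f' t p x)) : cone (q t) p').
  move=> a x y; apply: cone_eq; rewrite /= ?lin_appP// opprD addrACA -scalerBr lin_appP//.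
have [||h' [hn' hE']] := @projF Z aZ 0 1 (mulr1 1) (fun t p p' => mklin (f_lin t p p')).
- move=> t s u p p' x; apply: cone_eq => /=; rewrite dhom_gcast ?hn//.
  by rewrite lin_app_sub !dnatE.
- move=> t p p1 p' p1' x; rewrite !addr0 => -> ->; rewrite !linE /cone_dif_fun /= scale1r !gcast_id.
  apply: cone_eq => /=; last by rewrite !dhomE linearB.
  have [pp|pp] := eqVneq p (p' + 1); last first.
    by rewrite gcast_neq// !dif_shape ?lin0E ?lin_app0 ?subr0//; lia.
  move: x; subst p => x; rewrite gcast_id.
  have := hE t (p' + 1) (p' + 1 + 1) p' x erefl; rewrite addrK => /(_ erefl) /= e.
  by rewrite lin_app_sub e addrAC subrr add0r.
exists (fun t p q1 => lcomp (cone_proj_at (q t) q1) (h' t p q1)); split.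
  by move=> t s u p p' x; rewrite !lcompE !linE -hn'.
move=> t p q1 p' x qE p'E; have := hE' t p p p' q1 x (esym (addr0 p)) p'E qE.
by rewrite linE => /(congr1 snd) /=; rewrite gcast_id scale1r.
Qed.
End Projective.

Lemma homotopy_inverse (F G : dgdiagram k n) (S : dgdiagram k n)
    (pF : hom_projective F) (pG : hom_projective G) (f : dnat F S) (g : dnat G S) :
  (forall t, quasi_iso (f t)) -> (forall t, quasi_iso (g t)) ->
  exists (a : dnat F G) (b : dnat G F),
    homotopic (dnat_comp b a) (dnat_id F) /\ homotopic (dnat_comp a b) (dnat_id G).
Proof.
move=> qf qg; have [a aE] := projective_lift pF qg f; have [b bE] := projective_lift pG qf g.
(* Bracketings and units are compared by the zero homotopy instead of an equality of dependent
   records. *)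
have dA (A B C D : diagram k n) (x : dnat C D) (y : dnat B C) (z : dnat A B) :
    homotopic (dnat_comp x (dnat_comp y z)) (dnat_comp (dnat_comp x y) z).
  exists (fun _ _ _ => 0); split=> [t s u p q x0|t p q p' x0 _ _].
    by rewrite !lin0E lin_app0.
  by rewrite !lin0E lin_app0 addr0 /= subrr.
have d1 (A B : diagram k n) (x : dnat A B) : homotopic x (dnat_comp x (dnat_id A)).
  exists (fun _ _ _ => 0); split=> [t s u p q x0|t p q p' x0 _ _].
    by rewrite !lin0E lin_app0.
  by rewrite !lin0E lin_app0 addr0 /= subrr.
exists a, b; split.
  apply: (projective_unique pF qf).
  apply: homotopic_trans (dA _ _ _ _ _ _ _) _.
  apply: homotopic_trans (homotopic_compr _ bE) _.
  by apply: homotopic_trans aE _; exact: d1.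
apply: (projective_unique pG qg).
apply: homotopic_trans (dA _ _ _ _ _ _ _) _.
apply: homotopic_trans (homotopic_compr _ aE) _.
by apply: homotopic_trans bE _; exact: d1.
Qed.

End Homotopy.

(** * Homotopy invariance of Hom(-, T) *)

Section Precomposition.
Context (k : comPzRingType) (n : nat).

Section Map.
Context (F G T : diagram k n) (f : dnat F G).

Section Degree.
Context (d : int).
Definition precomp_hom (t : tree n) (phi : hom_gr (G t) (T t) d) : hom_fam (F t) (T t) :=
  fun p q => lcomp (hom_at phi p q) (f t p).
Fact precomp_deg t (phi : hom_gr (G t) (T t) d) : hom_deg d (precomp_hom phi).
Proof. by move=> p q pq; rewrite /precomp_hom hom_at0// lcomp0l. Qed.
Definition precomp_fam (phi : nat_gr G T d) : nat_fam F T d :=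
  fun t => hom_mk (precomp_deg (nat_at phi t)).
Fact precomp_end (phi : nat_gr G T d) : is_end (precomp_fam phi).
Proof.
move=> t s u p q; apply: lin_ext => x.
have e := congr1 (fun h : lin _ _ => h (f t p x)) (sub_valP phi t s u p q).
by rewrite [LHS]e [RHS]lcompE [RHS]lcompE -dnatE.
Qed.
Fact precomp_linear : linear (fun phi : nat_gr G T d => nat_mk (precomp_end phi)).
Proof.
move=> a phi psi; apply: val_inj; apply: functional_extensionality_dep => t.
by apply: hom_ext => p q; apply: lin_ext.
Qed.
Definition precomp_at : lin (nat_gr G T d) (nat_gr F T d) := mklin precomp_linear.

Lemma precompE (phi : nat_gr G T d) t p q x :
  hom_at (nat_at (precomp_at phi) t) p q x = hom_at (nat_at phi t) p q (f t p x).
Proof. by []. Qed.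
End Degree.

Lemma nat_gr_ext (A B : diagram k n) d (phi psi : nat_gr A B d) :
  (forall t p q x, q = p + d -> hom_at (nat_at phi t) p q x = hom_at (nat_at psi t) p q x) ->
  phi = psi.
Proof.
move=> e; apply: val_inj; apply: functional_extensionality_dep => t.
apply: hom_ext => p q; apply: lin_ext => x.
have [pq|pq] := eqVneq q (p + d); first exact: e.
by rewrite !hom_at0.
Qed.

Lemma nat_difE (A B : diagram k n) d e (phi : nat_gr A B d) t p q x : d = e + 1 ->
  hom_at (nat_at (nat_dif A B d e phi) t) p q x =
  dif (B t) (q + 1) q (hom_at (nat_at phi t) p (q + 1) x)
  - sg k d *: hom_at (nat_at phi t) (p - 1) q (dif (A t) p (p - 1) x).
Proof.
move=> de; rewrite {1}/hom_at /= /hom_dif_fam; case: eqP => // _.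
Qed.

Fact precomp_dif d e : lcomp (precomp_at e) (nat_dif G T d e) =
  lcomp (nat_dif F T d e) (precomp_at d).
Proof.
apply: lin_ext => phi; rewrite !lcompE.
have [de|de] := eqVneq d (e + 1); last first.
  by rewrite !nat_dif_shape// !lin0E lin_app0.
apply: nat_gr_ext => t p q x _.
by rewrite precompE !nat_difE// !precompE dhomE.
Qed.
Definition precomp : dhom (hom_diag G T) (hom_diag F T) :=
  @DHom k (hom_diag G T) (hom_diag F T) precomp_at precomp_dif.
End Map.

(* If f = 1 + dh + hd then phi f - phi is, up to a sign, the boundary of phi h. *)
Lemma precomp_homotopic (G T : diagram k n) (f : dnat G G) d (phi : hom_diag G T d) :
  homotopic f (dnat_id G) -> is_cycle phi -> boundary (precomp T f d phi - phi).
Proof.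
case=> h [hn hE] cphi.
pose psi0 t : hom_fam (G t) (T t) := fun p q =>
  sg k d *: lcomp (hom_at (nat_at phi t) (p + 1) q) (h t p (p + 1)).
have psi_deg t : hom_deg (d + 1) (psi0 t).
  move=> p q pq; rewrite /psi0 hom_at0 ?lcomp0l ?scaler0//.
  by apply: contra pq => /eqP ->; rewrite -addrA [1 + d]addrC.
pose psi1 : nat_fam G T (d + 1) := fun t => hom_mk (psi_deg t).
have psi_end : is_end psi1.
  move=> t s u p q; rewrite /hom_at /= /psi0 lcompZr lcompZl; congr (_ *: _).
  apply: lin_ext => x; rewrite !lcompE.
  have e := congr1 (fun h0 : lin _ _ => h0 (h t p (p + 1) x)) (sub_valP phi t s u (p + 1) q).
  by rewrite [LHS]e [LHS]lcompE hn.
exists (nat_mk psi_end).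
apply: nat_gr_ext => t p q x qE.
rewrite [RHS]nat_difE//.
have psiE p1 q1 y : hom_at (nat_at (nat_mk psi_end) t) p1 q1 y =
    sg k d *: hom_at (nat_at phi t) (p1 + 1) q1 (h t p1 (p1 + 1) y) by [].
have phi_eq p1 q1 p2 q2 y : p2 = p1 - 1 -> q2 = q1 + 1 ->
    dif (T t) q2 q1 (hom_at (nat_at phi t) p1 q2 y) =
    sg k d *: hom_at (nat_at phi t) p2 q1 (dif (G t) p1 p2 y).
  move=> -> ->; have := congr1 (fun z : nat_gr G T (d - 1) => hom_at (nat_at z t) p1 q1 y) cphi.
  rewrite nat_difE ?subrK// => e; apply/eqP; rewrite -subr_eq0; apply/eqP; exact: e.
rewrite !psiE lin_appZ (phi_eq _ _ p) ?addrK//.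
rewrite sgS scaleNr opprK !scalerA sg_sq !scale1r.
by rewrite -lin_appD -(hE t p (p + 1) (p - 1))// lin_app_sub.
Qed.

Lemma hom_diag_iso (F G T : diagram k n) (a : dnat F G) (b : dnat G F) d :
  homotopic (dnat_comp b a) (dnat_id F) -> homotopic (dnat_comp a b) (dnat_id G) ->
  lmod_iso (homology (hom_diag F T) d) (homology (hom_diag G T) d).
Proof.
move=> ba ab; exists (homology_map (precomp T b) d).
have inv (A B : diagram k n) (x : dnat A B) (y : dnat B A) :
    homotopic (dnat_comp y x) (dnat_id A) ->
    cancel (homology_map (precomp T y) d) (homology_map (precomp T x) d).
  move=> yx z; have [phi [cphi ->]] := homology_surj z.
  rewrite homology_mapE; first exact: dhom_cycle (cycleP cphi).
  move=> c; rewrite homology_mapE; first exact: (dhom_cycle (precomp T x) c).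
  move=> c'; apply/homology_eq.
  have -> : precomp T x d (precomp T y d phi) = precomp T (dnat_comp y x) d phi.
    by apply: nat_gr_ext => t p q w _; rewrite !precompE.
  exact: precomp_homotopic.
by exists (homology_map (precomp T a) d); apply: inv.
Qed.

End Precomposition.

(** * Contractions out of the Koszul diagram *)

Section KoszulProjective.
Context (k : comPzRingType) (n : nat) (S : dgdiagram k n).
Local Notation K := (koszul_diagram S).
Local Notation gen := (gen S).

(** The differential of a generator involves its own cell and cells of smaller deg u only. *)
Lemma dif_gen_agree phi m m' (U : lmodType k) (A B : lin (K phi m') U) t (f : factor t phi) q y (d : int) :
  hdeg (finner f) <= d ->
  (forall t' (f' : factor t' phi) q' y', hdeg (finner f') < d ->
     A (gen m' f' q' y') = B (gen m' f' q' y')) ->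
  (forall q' y', A (gen m' f q' y') = B (gen m' f q' y')) ->
  A (dif (K phi) m m' (gen m f q y)) = B (dif (K phi) m m' (gen m f q y)).
Proof.
case: f => r v u ud AB ABf; have {}ud : hdeg u <= d by exact: ud.
have [mm|mm] := eqVneq m (m' + 1); last first.
  by rewrite dif_shape// !lin0E !lin_app0.
have [qE|qE] := eqVneq q (m - hdeg u); last first.
  by rewrite gen_degree// !lin0E !lin_app0.
rewrite (dif_gen _ _ mm qE) !lin_appD !lin_appZ !lin_app_sum; congr (_ + _ + _).
- by rewrite ABf.
- apply: eq_big_seq => g /outs_hdeg [_ dg]; rewrite !lin_appZ AB// [finner _]/= dg; lia.
congr (_ *: _); apply: eq_big_seq => g /ins_hdeg [_ dg]; rewrite !lin_appZ AB// [finner _]/= dg; lia.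
Qed.

Hypothesis cofS : dg_cofibrant S.
Context (Z : dgdiagram k n) (aZ : forall t, acyclic (Z t)) (e : int) (s : k) (ss : s * s = 1).
Context (f : forall t p q, lin (K t p) (Z t q)) (fn : natural f).
Hypothesis fd : forall t p q p' q' x, q = p + e -> q' = p' + e ->
  f t p' q' (dif (K t) p p' x) = s *: dif (Z t) q q' (f t p q x).

(* A natural map out of K is determined by its values on 1 (x) {u} (x) y. *)
Definition values := forall t r (u : thom t r) (p q : int), lin (S t p) (Z r q).

Definition extend (a : values) phi m q : lin (K phi m) (Z phi q) :=
  klift m (fun t c p => lcomp (dmap Z (fouter c) q) (a t (fmid c) (finner c) p q)).

Lemma extendE (a : values) phi m q t r (v : thom r phi) (u : thom t r) p y : p = m - hdeg u ->
  extend a phi m q (gen m (Factor v u) p y) = dmap Z v q (a t r u p q y).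
Proof. by move=> pE; rewrite /extend kliftE. Qed.

Lemma extend_natural a : natural (fun phi => @extend a phi).
Proof.
move=> t r u p q x; rewrite -!lcompE; congr (lin_fun _ x).
apply: gen_ext => t' [r' v' u'] q' y q'E; rewrite !lcompE dmap_gen !extendE//.
by rewrite dmap_comp.
Qed.

(** The failure of [extend a] to contract f. It commutes with the differentials as f does, so that
    it can itself be contracted. *)
Definition residual (a : values) phi p q : lin (K phi p) (Z phi q) :=
  f phi p q - (s *: lcomp (dif (Z phi) (q + 1) q) (extend a phi p (q + 1))
    + lcomp (extend a phi (p - 1) q) (dif (K phi) p (p - 1))).

Lemma residualE a phi p q x : residual a phi p q x =
  f phi p q x - (s *: dif (Z phi) (q + 1) q (extend a phi p (q + 1) x)
    + extend a phi (p - 1) q (dif (K phi) p (p - 1) x)).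
Proof. by rewrite /residual linDE linNE linDE linZE !lcompE. Qed.

Lemma residual_natural a : natural (fun phi => @residual a phi).
Proof.
move=> t r u p q x; rewrite !residualE lin_app_sub lin_appD lin_appZ fn.
rewrite (dhomE (dmap Z u)) (extend_natural a u (q + 1) x) (extend_natural a u q).
by rewrite (dhomE (dmap K u)).
Qed.

Lemma residual_cycle a phi p q p' q' x : q = p + e -> q' = p' + e ->
  residual a phi p' q' (dif (K phi) p p' x) = s *: dif (Z phi) q q' (residual a phi p q x).
Proof.
move=> qE q'E.
have [pp|pp] := eqVneq p (p' + 1); last first.
  by rewrite !dif_shape ?lin0E ?lin_app0 ?scaler0//; lia.
have qq : q = q' + 1 by lia.
move: qE; rewrite qq => qE.
move: x; subst p q => x; rewrite !residualE (fd _ qE q'E).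
rewrite lin_app_sub scalerBr; congr (_ - _).
rewrite lin_appD lin_appZ (dif_dif (dg_diagram_sq0 Z phi)) scaler0 add0r.
rewrite (dif_dif (koszul_complex S phi)) lin_app0 addr0; congr (_ *: dif _ _ _ _).
have cast a0 : a0 = p' -> extend a phi p' (q' + 1) (dif (K phi) (p' + 1) p' x) =
    extend a phi a0 (q' + 1) (dif (K phi) (p' + 1) a0 x) by move=> ->.
by apply: cast; rewrite addrK.
Qed.

Definition vanishes (N : nat) (a : values) := forall phi t (c : factor t phi) m q p y,
  hdeg (finner c) < N%:Z -> q = m + e -> residual a phi m q (gen m c p y) = 0.

Lemma vanishes_ext N (a a' : values) :
  (forall t r (u : thom t r) p q, hdeg u < N%:Z -> a t r u p q = a' t r u p q) ->
  vanishes N a -> vanishes N a'.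
Proof.
move=> aa' va phi t c m q p y cN qE; rewrite -[RHS](va phi t c m q p y cN qE) !residualE.
have agree m1 q1 t1 (c1 : factor t1 phi) p1 y1 : hdeg (finner c1) < N%:Z ->
    extend a' phi m1 q1 (gen m1 c1 p1 y1) = extend a phi m1 q1 (gen m1 c1 p1 y1).
  case: c1 => r v u uN; have {}uN : hdeg u < N%:Z by exact: uN.
  have [pE|pE] := eqVneq p1 (m1 - hdeg u); last first.
    by rewrite gen_degree// !lin0E !lin_app0.
  by rewrite !extendE// aa'.
rewrite agree//; congr (_ - (_ + _)).
apply: (@dif_gen_agree phi _ _ _ _ _ _ _ _ _ (hdeg (finner c))) => // [t' f' q' y' lt|q' y'].
  by apply: agree; apply: lt_trans cN.
exact: agree.
Qed.

(** For deg u = N the residual restricts to a chain map out of S(t), up to sign: the twisting terms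
    lower deg u, where it vanishes. A contraction of this map corrects a in degree N and nowhere
    else. *)
Lemma vanishes_step N (a : values) : vanishes N a -> exists a' : values, vanishes N.+1 a' /\
  forall t r (u : thom t r) p q, hdeg u <> N%:Z -> a t r u p q = a' t r u p q.
Proof.
move=> va.
pose g t r (u : thom t r) p q : lin (S t p) (Z r q) :=
  lcomp (residual a r (p + N%:Z) q) (gen (p + N%:Z) (Factor (tid r) u) p).
have gE t r (u : thom t r) p q y : g t r u p q y =
    residual a r (p + N%:Z) q (gen (p + N%:Z) (Factor (tid r) u) p y) by [].
have exh t r (u : thom t r) : exists h : forall p q, lin (S t p) (Z r q), hdeg u = N%:Z ->
    forall p q y, q = p + (e + N%:Z) -> g t r u p q y =
      s * sg k N%:Z *: dif (Z r) (q + 1) q (h p (q + 1) y) + h (p - 1) q (dif (S t) p (p - 1) y).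
  have [uN|uN] := eqVneq (hdeg u) N%:Z; last first.
    by exists (fun _ _ => 0) => /eqP; rewrite (negbTE uN).
  (* The sign (-1)^N accounts for moving the differential of S past {u}. *)
  have s2 : (s * sg k N%:Z) * (s * sg k N%:Z) = 1.
    by rewrite mulrACA ss sg_sq mulr1.
  have [|h hE] := cofibrant_contraction (@cofS t) (dg_diagram_sq0 Z r) (@aZ r) s2 (f := g t r u) (e := e + N%:Z).
    move=> p q p' q' y qE q'E.
    have [pp|pp] := eqVneq p (p' + 1); last first.
      by rewrite !dif_shape ?lin0E ?lin_app0 ?scaler0//; lia.
    rewrite !gE mulrC -scalerA -(residual_cycle a (p' := p' + N%:Z)); try lia.
    rewrite (dif_gen (m' := p' + N%:Z)); [|lia|lia].
    rewrite !lin_appD !lin_appZ !lin_app_sum big1_seq; last first.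
      by move=> c /andP[_ /outs_hdeg [_ dc]]; rewrite lin_appZ va ?scaler0//; [rewrite /= dc uN|]; lia.
    rewrite big1_seq; last first.
      by move=> c /andP[_ /ins_hdeg [_ dc]]; rewrite lin_appZ va ?scaler0//; [rewrite /= dc uN|]; lia.
    rewrite scaler0 !addr0 uN scalerA sg_sq scale1r.
    by have -> : p' = p - 1 by lia.
  by exists h.
pose h t r u := projT1 (cid (exh t r u)).
have hE t r u : hdeg u = N%:Z -> forall p q y, q = p + (e + N%:Z) -> g t r u p q y =
    s * sg k N%:Z *: dif (Z r) (q + 1) q (h t r u p (q + 1) y)
      + h t r u (p - 1) q (dif (S t) p (p - 1) y) := projT2 (cid (exh t r u)).
pose a' : values := fun t r u p q =>
  if hdeg u == N%:Z then a t r u p q + sg k N%:Z *: h t r u p q else a t r u p q.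
have a'_ne t r (u : thom t r) p q : hdeg u <> N%:Z -> a t r u p q = a' t r u p q.
  by move=> /eqP/negbTE uN; rewrite /a' uN.
exists a'; split=> // phi t [r v u] m q p y uN qE; have {}uN : hdeg u < N.+1%:Z by exact: uN.
have va' : vanishes N a'.
  apply: (vanishes_ext _ va) => t' r' u' p' q' u'N; apply: a'_ne.
  by move=> e1; rewrite e1 ltxx in u'N.
have [lt|ge] := ltP (hdeg u) N%:Z; first exact: va'.
have {ge}uN : hdeg u = N%:Z by lia.
(* By naturality of the residual, generators whose left factor is an identity suffice. *)
have -> : Factor v u = Factor (tcomp v (tid r)) u by rewrite tcomp_idr.
rewrite -dmap_gen -(residual_natural a').
suff -> : residual a' r m q (gen m (Factor (tid r) u) p y) = 0 by rewrite lin_app0.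
have [pE|pE] := eqVneq p (m - hdeg u); last first.
  by rewrite gen_degree// !lin0E !lin_app0.
have id_ext (b : values) m1 q1 t1 (u1 : thom t1 r) p1 y1 : p1 = m1 - hdeg u1 ->
    extend b r m1 q1 (gen m1 (Factor (tid r) u1) p1 y1) = b t1 r u1 p1 q1 y1.
  by move=> p1E; rewrite extendE// dmap_id.
have a'E p1 q1 y1 : a' t r u p1 q1 y1 = a t r u p1 q1 y1 + sg k N%:Z *: h t r u p1 q1 y1.
  by rewrite /a' uN eqxx linDE linZE.
have e1 : extend a' r m (q + 1) (gen m (Factor (tid r) u) p y) =
    extend a r m (q + 1) (gen m (Factor (tid r) u) p y) + sg k N%:Z *: h t r u p (q + 1) y.
  by rewrite !id_ext// a'E.
have e2 : extend a' r (m - 1) q (dif (K r) m (m - 1) (gen m (Factor (tid r) u) p y)) =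
    extend a r (m - 1) q (dif (K r) m (m - 1) (gen m (Factor (tid r) u) p y))
    + h t r u (p - 1) q (dif (S t) p (p - 1) y).
  have mm : m = m - 1 + 1 by rewrite subrK.
  rewrite (dif_gen _ _ mm pE) !lin_appD !lin_appZ !id_ext; try lia.
  rewrite a'E scalerDr scalerA uN sg_sq scale1r.
  have agree q1 t1 (c1 : factor t1 r) p1 y1 : hdeg (finner c1) < N%:Z ->
      extend a' r (m - 1) q1 (gen (m - 1) c1 p1 y1) = extend a r (m - 1) q1 (gen (m - 1) c1 p1 y1).
    case: c1 => r1 v1 u1 u1N; have {}u1N : hdeg u1 < N%:Z by exact: u1N.
    have [p1E|p1E] := eqVneq p1 (m - 1 - hdeg u1); last first.
      by rewrite gen_degree// !lin0E !lin_app0.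
    rewrite !extendE// a'_ne//; lia.
  have s1 : extend a' r (m - 1) q (\sum_(c <- outs u) sgn k (fouter c) *:
        gen (m - 1) (Factor (tcomp (tid r) (fouter c)) (finner c)) p y) =
      extend a r (m - 1) q (\sum_(c <- outs u) sgn k (fouter c) *:
        gen (m - 1) (Factor (tcomp (tid r) (fouter c)) (finner c)) p y).
    rewrite !lin_app_sum; apply: eq_big_seq => c /outs_hdeg [_ dc].
    by rewrite !lin_appZ agree// [finner _]/= dc; lia.
  have s2 : extend a' r (m - 1) q (\sum_(c <- ins u) sgn k (finner c) *:
        gen (m - 1) (Factor (tid r) (fouter c)) p (dmap S (finner c) p y)) =
      extend a r (m - 1) q (\sum_(c <- ins u) sgn k (finner c) *:
        gen (m - 1) (Factor (tid r) (fouter c)) p (dmap S (finner c) p y)).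
    rewrite !lin_app_sum; apply: eq_big_seq => c /ins_hdeg [_ dc].
    by rewrite !lin_appZ agree// [finner _]/= dc; lia.
  by rewrite s1 s2; set H := h t r u _ _ _; rewrite (addrAC _ H) (addrAC _ H).
have g0 : g t r u p q y = residual a r m q (gen m (Factor (tid r) u) p y).
  by rewrite gE; have -> : p + N%:Z = m by lia.
move: g0; rewrite (hE t r u uN); last by lia.
rewrite !residualE e1 e2 => g0.
rewrite lin_appD lin_appZ scalerDr addrACA opprD addrA -g0 scalerA.
by rewrite subrr.
Qed.

Lemma vanishes0 a : vanishes 0 a.
Proof.
by move=> phi t c m q p y; have [d [-> _]] := hdegE (finner c).
Qed.

Definition vanishing_values : forall N, {a : values | vanishes N a} :=
  fix F N := match N with
  | 0 => exist _ (fun _ _ _ _ _ => 0) (vanishes0 _)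
  | N'.+1 => let x := cid (vanishes_step (proj2_sig (F N'))) in
             exist _ (projT1 x) (proj1 (projT2 x))
  end.

Lemma vanishing_values_stable N M t r (u : thom t r) p q : hdeg u < N%:Z ->
  proj1_sig (vanishing_values (N + M)) t r u p q = proj1_sig (vanishing_values N) t r u p q.
Proof.
move=> uN; elim: M => [|M IH]; first by rewrite addn0.
rewrite addnS -IH /=; case: (cid _) => a' [_ aE] /=.
by rewrite -aE// => uNM; lia.
Qed.

Lemma koszul_contraction : exists h : forall t p q, lin (K t p) (Z t q), natural h /\
   forall t p q p' q' x, q = p + e -> p' = p - 1 -> q' = q + 1 ->
    f t p q x = s *: dif (Z t) q' q (h t p q' x) + h t p' q (dif (K t) p p' x).
Proof.
(* The values at u are final from stage deg u + 1 on. The degrees are unbounded, hence the diagonal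
   choice. *)
pose a : values := fun t r u => proj1_sig (vanishing_values (`|hdeg u|%N).+1) t r u.
have va N : vanishes N a.
  apply: vanishes_ext (proj2_sig (vanishing_values N)) => t r u p q uN.
  have [d [dE _]] := hdegE u; rewrite /a dE /=.
  have -> : N = (d.+1 + (N - d.+1))%N by lia.
  by rewrite vanishing_values_stable//; lia.
exists (fun t => @extend a t); split; first exact: extend_natural.
move=> phi p q p' q' x qE -> ->.
suff : residual a phi p q = 0.
  move=> /(congr1 (fun z : lin _ _ => z x)); rewrite residualE lin0E => /eqP.
  by rewrite subr_eq0 => /eqP.
apply: gen_ext => t c r y _; rewrite lin0E.
have [d [dE _]] := hdegE (finner c).
by apply: (va d.+1) => //; lia.
Qed.

End KoszulProjective.

Lemma koszul_projective (k : comPzRingType) (n : nat) (S : dgdiagram k n) :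
  dg_cofibrant S -> hom_projective (koszul_diagram S).
Proof.
by move=> cofS Z aZ e s ss f fn fd; exact: (koszul_contraction cofS aZ ss fn fd).
Qed.

(** * The augmentation *)

Section Augmentation.
Context (k : comPzRingType) (n : nat) (S : dgdiagram k n).
Local Notation K := (koszul_diagram S).
Local Notation gen := (gen S).
Local Notation comp f := (tcomp (fouter f) (finner f)).

Lemma outs_nil (t s : tree n) (u : thom t s) : hdeg u = 0 -> outs u = [::].
Proof.
move=> u0; apply/eqP; rewrite -size_eq0 -leqn0 leqNgt -has_predT; apply/hasP => -[g].
move=> /outs_hdeg [_ dg] _; have [d [dE _]] := hdegE (finner g); lia.
Qed.
Lemma ins_nil (t s : tree n) (u : thom t s) : hdeg u = 0 -> ins u = [::].
Proof.
move=> u0; apply/eqP; rewrite -size_eq0 -leqn0 leqNgt -has_predT; apply/hasP => -[g].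
move=> /ins_hdeg [_ dg] _; have [d [dE _]] := hdegE (fouter g); lia.
Qed.
Lemma hdeg_id (t : tree n) : hdeg (tid t) = 0.
Proof. exact: subrr. Qed.

Lemma outs_one (t s : tree n) (u : thom t s) : hdeg u = 1 -> perm_eq (outs u) [:: Factor u (tid t)].
Proof.
move=> u1; apply: uniq_perm; rewrite ?outs_uniq// => g; rewrite inE.
apply/outsP/eqP => [[gu g1]|->]; last by rewrite tcomp_idr.
apply: factor_deg0 => //; have := hdeg_comp (fouter g) (finner g); rewrite gu u1 g1 /hdeg; lia.
Qed.
Lemma ins_one (t s : tree n) (u : thom t s) : hdeg u = 1 -> perm_eq (ins u) [:: Factor (tid s) u].
Proof.
move=> u1; apply: uniq_perm; rewrite ?ins_uniq// => g; rewrite inE.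
apply/insP/eqP => [[gu g1]|->]; last by rewrite tcomp_idl.
apply: factor_outer0 => //; have := hdeg_comp (fouter g) (finner g); rewrite gu u1 g1 /hdeg; lia.
Qed.

Definition aug_at phi m : lin (K phi m) (S phi m) := klift m (fun t c q =>
  if hdeg (finner c) == 0 then lcomp (gcast (S phi) q m) (dmap S (comp c) q) else 0).

Lemma aug_gen phi m t r (v : thom r phi) (u : thom t r) q y : q = m - hdeg u ->
  aug_at phi m (gen m (Factor v u) q y) =
  if hdeg u == 0 then gcast (S phi) q m (dmap S (tcomp v u) q y) else 0.
Proof. by move=> qE; rewrite /aug_at kliftE//=; case: eqP. Qed.

Fact aug_dif phi m m' : lcomp (aug_at phi m') (dif (K phi) m m') =
  lcomp (dif (S phi) m m') (aug_at phi m).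
Proof.
have [mm|mm] := eqVneq m (m' + 1); last first.
  by rewrite [dif (K phi) m m']dif_shape// dif_shape// lcomp0l lcomp0r.
apply: gen_ext => t [r v u] q y qE; have {}qE : q = m - hdeg u by exact: qE.
rewrite !lcompE aug_gen// (dif_gen _ _ mm qE) !lin_appD !lin_appZ.
rewrite aug_gen; last by lia.
have [u0|u0] := eqVneq (hdeg u) 0.
  rewrite (outs_nil u0) (ins_nil u0) !big_nil !lin_app0 scaler0 !addr0 u0 sg0 scale1r.
  by rewrite (dif_gcast (l := q - 1)) -?dhomE//; lia.
rewrite lin_app0 scaler0 add0r.
have [u1|u1] := eqVneq (hdeg u) 1.
  (* In degree one, the outer and the inner part have one term each; both map to the image of y
     under v u, with opposite signs. *)
  rewrite (perm_big _ (outs_one u1)) (perm_big _ (ins_one u1)) !big_seq1.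
  rewrite ![fouter _]/= ![finner _]/= !lin_appZ !aug_gen ?hdeg_id ?eqxx ?subr0; try lia.
  rewrite !tcomp_idr u1 dmap_comp [sg k 1]expr1 scaleN1r.
  by rewrite subrr.
rewrite !lin_app_sum big1_seq; last first.
  move=> c /andP[_ /outs_hdeg[_ dc]]; rewrite lin_appZ aug_gen; last by rewrite dc; lia.
  by rewrite dc subr_eq0 (negbTE u1) scaler0.
rewrite big1_seq ?scaler0 ?addr0//.
move=> c /andP[_ /ins_hdeg[_ dc]]; rewrite lin_appZ aug_gen; last by rewrite dc; lia.
by rewrite dc subr_eq0 (negbTE u1) scaler0.
Qed.
Definition aug phi : dhom (K phi) (S phi) := DHom (@aug_dif phi).

Fact aug_nat phi psi (w : thom phi psi) : dcomp (aug psi) (dmap K w) = dcomp (dmap S w) (aug phi).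
Proof.
apply: dhom_ext => m; apply: gen_ext => t [r v u] q y qE; have {}qE : q = m - hdeg u by exact: qE.
rewrite [LHS]lcompE [RHS]lcompE dmap_gen.
rewrite [LHS](aug_gen _ _ qE) [X in _ = dmap S w m X](aug_gen _ _ qE).
case: eqP => _; last by rewrite lin_app0.
by rewrite dhom_gcast -tcompA dmap_comp.
Qed.
Definition augmentation : dnat K S := DNat aug_nat.

Definition unit_gen phi m : lin (S phi m) (K phi m) := gen m (Factor (tid phi) (tid phi)) m.

Lemma aug_unit phi m y : aug_at phi m (unit_gen phi m y) = y.
Proof.
rewrite /unit_gen aug_gen hdeg_id ?eqxx ?subr0// gcast_id tcomp_idl dmap_id.
by [].
Qed.

Lemma dif_gen0 (phi : tree n) m m' t (f : factor t phi) q y : m = m' + 1 -> hdeg (finner f) = 0 ->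
  q = m - hdeg (finner f) ->
  dif (K phi) m m' (gen m f q y) = gen m' f (q - 1) (dif (S t) q (q - 1) y).
Proof.
case: f => r v u mm u0 qE; have {}u0 : hdeg u = 0 by exact: u0.
rewrite (dif_gen _ _ mm)// outs_nil ?ins_nil// !big_nil u0 scaler0 !addr0 sg0 scale1r.
by [].
Qed.

Lemma unit_dif phi m m' y : m = m' + 1 ->
  dif (K phi) m m' (unit_gen phi m y) = unit_gen phi m' (dif (S phi) m m' y).
Proof.
move=> mm; rewrite /unit_gen dif_gen0 ?hdeg_id ?subr0//.
by have -> : m' = m - 1 by lia.
Qed.

(** * The Morse argument at a fixed tree phi *)

Section Morse.
Context (phi : tree n).

Lemma mkcell_inj t (f g : factor t phi) : mkcell f = mkcell g -> f = g.
Proof. by move=> /eqP; rewrite eq_Tagged /= => /eqP. Qed.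

Lemma matched_deg t (f g : factor t phi) : comp g = comp f -> matched f g ->
  (tdeg phi < tdeg t)%N.
Proof.
move=> e /(matched_facet e) [v [_ _ d]].
by have := leq_tdeg (fouter g); have := leq_tdeg (finner f); lia.
Qed.

(* A matched pair (f, g) is a bottom cell f and a top cell g, the differential of g
   having an invertible coefficient at f. *)
Definition bottom t (f : factor t phi) := exists g, comp g = comp f /\ matched f g.

(** The internal part stays at g, which is not a bottom cell. The outer part is controlled by
    acyclicity of the matching, and the inner part has a smaller source, hence smaller rank. *)
Lemma coord_dif_top (m : int) t (f g : factor t phi) q y t' (h : factor t' phi) :
  comp g = comp f -> matched f g -> bottom h -> q = m + 1 - hdeg (finner g) ->
  gcoord h (dif (K phi) (m + 1) m (gen (m + 1) g q y)) <> 0 ->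
  mkcell h = mkcell f \/ (rank h < rank f)%N.
Proof.
move=> gf fg [h' [h'h hh']] qE ne; apply: contrapT => /not_orP[hf hr]; apply: ne.
have {hr} rh : ~~ (rank h < rank f)%N by apply/negP.
rewrite -[gcoord h _]/(lcoord S m h _).
case: g gf fg qE => r v u gf fg qE; have {}qE : q = m + 1 - hdeg u by exact: qE.
rewrite (dif_gen _ _ erefl qE) !lin_appD !lin_appZ !lin_app_sum.
have zero t1 (f1 : factor t1 phi) q1 y1 : mkcell f1 <> mkcell h -> lcoord S m h (gen m f1 q1 y1) = 0.
  by move=> n1; exact: coord_gen_neq.
rewrite zero; last first.
  move=> e; have tt : t = t' by exact: (congr1 tag e).
  case: _ / tt h h' h'h hh' hf rh zero e => h h' h'h hh' hf rh zero /mkcell_inj e.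
  rewrite -e in h'h hh'.
  by apply: (matched_excl (f := Factor v u) h'h _ hh' fg); rewrite gf.
rewrite scaler0 add0r big1_seq ?add0r; last first.
  move=> c /andP[_ /outsP[cu dc]]; rewrite lin_appZ zero ?scaler0// => e.
  have tt : t = t' by exact: (congr1 tag e).
  case: _ / tt h h' h'h hh' hf rh zero e => h h' h'h hh' hf rh zero /mkcell_inj e.
  have hc : comp h = comp f by rewrite -e /= -tcompA cu gf.
  have := matched_rank (f := f) (g := Factor v u) (h := Factor (tcomp v (fouter c)) (finner c))
    (h' := h') (v := fouter c) gf _ _ fg _ cu.
  rewrite e hc h'h => /(_ erefl hc hh') [].
  - by rewrite -e; move: dc; rewrite /hdeg /=; lia.
  - by move=> lt; rewrite lt in rh.
  by move=> fh; apply: hf; rewrite fh.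
rewrite big1_seq ?scaler0// => c /andP[_ /insP[cu dc]]; rewrite lin_appZ zero ?scaler0// => e.
have tt : fmid c = t' by exact: (congr1 tag e).
move/negP: rh; apply; apply: rank_tdeg.
- by have := matched_deg gf fg; lia.
- by rewrite -tt; move: dc; rewrite /hdeg; lia.
by have := matched_deg h'h hh'; lia.
Qed.

(** Exactly one outer term lands on f, and its coefficient is the sign of the merge from f to g. *)
Lemma coord_dif_match (m : int) t (f g : factor t phi) : comp g = comp f -> matched f g ->
  exists c : k, c * c = 1 /\ forall q y, q = m + 1 - hdeg (finner g) ->
  gcoord f (dif (K phi) (m + 1) m (gen (m + 1) g q y)) = c *: gcast (S t) q (m - hdeg (finner f)) y.
Proof.
move=> gf fg; have [v1 [v1u v1v d1]] := matched_facet gf fg.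
exists (sgn k v1); split.
  by rewrite /sgn -exprD -signr_odd addnn odd_double.
move=> q y qE; rewrite -[gcoord f _]/(lcoord S m f _).
case: g gf fg v1 v1u v1v d1 qE => r v u gf fg v1 v1u v1v d1 qE; have {}qE : q = m + 1 - hdeg u by exact: qE.
rewrite (dif_gen _ _ erefl qE) !lin_appD !lin_appZ !lin_app_sum.
have zero t1 (f1 : factor t1 phi) q1 y1 : mkcell f1 <> mkcell f -> lcoord S m f (gen m f1 q1 y1) = 0.
  by move=> n1; exact: coord_gen_neq.
rewrite zero ?scaler0 ?add0r; last first.
  move=> /mkcell_inj e; move: d1; rewrite -e /=; lia.
rewrite [X in _ + _ *: X]big1_seq ?scaler0 ?addr0; last first.
  move=> c /andP[_ /insP[cu dc]]; rewrite lin_appZ zero ?scaler0// => e.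
  have tt : fmid c = t by exact: (congr1 tag e).
  by move: dc; rewrite /hdeg tt subrr.
have cin : Factor v1 (finner f) \in outs u.
  apply/outsP; split=> //=; rewrite /hdeg; move: d1 => /=; lia.
rewrite (bigD1_seq _ cin (outs_uniq u)) big1_seq ?addr0; last first.
  move=> c /andP[cn /outsP[cu dc]]; rewrite lin_appZ zero ?scaler0// => /mkcell_inj e.
  move/eqP: cn; apply; apply: (@factor_ext _ _ _ u c (Factor v1 (finner f)) cu v1u) => i x.
  exact: (congr1 (fun z : factor t phi => finner z i x : nat) e).
rewrite lin_appZ.
have fE : Factor (tcomp v v1) (finner f) = f by rewrite (_ : tcomp v v1 = fouter f)//; case: (f).
rewrite fE [LHS]addr0; congr (_ *: _); apply: coord_gen.
by rewrite qE /hdeg; move: d1 => /=; lia.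
Qed.

Local Notation lc m c := (lcoord S m (tagged c)).
Definition top (t : tree n) (g : factor t phi) := exists f, comp g = comp f /\ matched f g.

Lemma kill_bottom (m : int) (c : cell phi) (y : coord_mod S m c) : bottom (tagged c) ->
  exists z : K phi (m + 1), lc m c (dif (K phi) (m + 1) m z) = y /\
    forall h : cell phi, bottom (tagged h) -> h <> c ->
      (rank (tagged c) <= rank (tagged h))%N -> lc m h (dif (K phi) (m + 1) m z) = 0.
Proof.
case: c y => t f y [g [gf fg]].
have [a [aa fE]] := coord_dif_match m gf fg.
pose q := m + 1 - hdeg (finner g).
exists (gen (m + 1) g q (a *: gcast (S t) (m - hdeg (finner f)) q y)); split.
  rewrite -[LHS]/(gcoord f _) fE// lin_appZ scalerA aa scale1r gcastK//.
  have [v [_ _ d]] := matched_facet gf fg; rewrite /q /hdeg; lia.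
move=> [t' h] bh hc le; apply: contrapT => ne.
have [e|lt] := coord_dif_top gf fg bh (erefl q) ne; first exact: hc.
by move: lt; rewrite ltnNge le.
Qed.

(** Induction on a bound for the ranks of the bottom cells present. All cells of the highest rank
    are killed together, and [kill_bottom] creates only bottom cells of smaller rank. *)
Lemma clear_bottoms (m : int) (x : K phi m) : exists z : K phi (m + 1),
  forall c : cell phi, bottom (tagged c) -> lc m c (x - dif (K phi) (m + 1) m z) = 0.
Proof.
have [N] : exists N, forall c : cell phi, bottom (tagged c) ->
    (N <= rank (tagged c))%N -> lc m c x = 0.
  have [A [Ax _]] := coord_sum x.
  exists (\sum_(c <- A) rank (tagged c)).+1 => -[t f] _ lt; apply: Ax; apply/negP => fA.
  move: lt; rewrite (big_fsetD1 _ fA) /= ltnNge => /negP; apply; exact: leq_addr.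
elim: N x => [|N IHN] x xN.
  by exists 0 => c bc; rewrite lin_app0 subr0 xN.
have [A [Ax _]] := coord_sum x.
have {}Ax (c : cell phi) : c \notin A -> lc m c x = 0 by case: c => t f; exact: Ax.
(* The last clause keeps cells of other ranks out of the sum [Z]. *)
pose P (c : cell phi) (z : K phi (m + 1)) :=
  [/\ bottom (tagged c) -> rank (tagged c) = N ->
      lc m c (dif (K phi) (m + 1) m z) = lc m c x &
    forall h : cell phi, bottom (tagged h) -> h <> c ->
      (N <= rank (tagged h))%N -> lc m h (dif (K phi) (m + 1) m z) = 0] /\
    (rank (tagged c) <> N -> z = 0).
have /choice[z zP] : forall c, exists z, P c z.
  move=> c; have [[bc rc]|nc] := pselect (bottom (tagged c) /\ rank (tagged c) = N).
    have [z [z1 z2]] := kill_bottom (lc m c x) bc.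
    by exists z; split; [split=> // h bh hc; rewrite -rc; exact: z2|].
  exists 0; split=> //; split=> [bc rc|h _ _ _]; last by rewrite !lin_app0.
  by case: nc.
pose Z := \sum_(c <- A) z c.
have [|z' z'P] := IHN (x - dif (K phi) (m + 1) m Z).
  move=> h bh Nh; rewrite lin_app_sub (lin_app_sum _ _ z) (lin_app_sum _ _ _ (lc m h)).
  have off c : c <> h -> lc m h (dif (K phi) (m + 1) m (z c)) = 0.
    by move=> ch; apply: (zP c).1.2 => // e; apply: ch.
  suff -> : \sum_(c <- A) lc m h (dif (K phi) (m + 1) m (z c)) = lc m h x by exact: subrr.
  have [rh|/eqP rh] := eqVneq (rank (tagged h)) N; last first.
    rewrite xN//; last by rewrite ltn_neqAle eq_sym; apply/andP; split=> //; apply/eqP.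
    apply: big1 => c _; have [->|/eqP/off//] := eqVneq c h.
    by rewrite ((zP h).2 rh) !lin_app0.
  have [hA|hA] := boolP (h \in A); last first.
    rewrite Ax//; apply: big1_seq => c /andP[_ cA]; apply: off => ch.
    by rewrite -ch cA in hA.
  rewrite (big_fsetD1 _ hA) -[RHS]addr0; congr (_ + _); first exact: (zP h).1.1.
  by apply: big1_seq => c /andP[_]; rewrite !inE => /andP[/eqP ch _]; apply: off.
exists (Z + z') => c bc.
have -> : x - dif (K phi) (m + 1) m (Z + z') =
    x - dif (K phi) (m + 1) m Z - dif (K phi) (m + 1) m z' by rewrite lin_appD -addrA -opprD.
exact: z'P.
Qed.

Lemma top_bound (A : {fset cell phi}) : exists B, forall t (f g : factor t phi),
  comp g = comp f -> matched f g -> mkcell g \in A -> (rank f <= B)%N.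
Proof.
have /choice[b bP] : forall c : cell phi, exists b, forall f,
    comp (tagged c) = comp f -> matched f (tagged c) -> (rank f <= b)%N.
  move=> c; have [[f [fc mf]]|no] := pselect (top (tagged c)).
    by exists (rank f) => f' fc' mf'; rewrite (matched_inj (esym fc') (esym fc) mf' mf).
  by exists 0%N => f fc mf; case: no; exists f.
exists (\sum_(c <- A) b c)%N => t f g gf fg gA.
rewrite (big_fsetD1 _ gA) /=; apply: leq_trans (leq_addr _ _); exact: (bP (mkcell g)).
Qed.

Lemma critical_deg (c : cell phi) : ~ bottom (tagged c) -> ~ top (tagged c) ->
  tdeg (tag c) = tdeg phi.
Proof.
case: c => t f nb nt; apply: contrapT => d.
have [g [gf [fg|gf']]] := matched_total f d; first by apply: nb; exists g.
by apply: nt; exists g; split.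
Qed.

(** Descending induction on the rank of the partner f. At f the differential of x sees g alone: top
    cells with partners of higher rank are already excluded, and an unmatched cell contributes only
    to itself. *)
Lemma no_bottoms (m : int) (x : K phi (m + 1)) : dif (K phi) (m + 1) m x = 0 ->
  (forall c : cell phi, bottom (tagged c) -> lc (m + 1) c x = 0) ->
  forall c : cell phi, top (tagged c) -> lc (m + 1) c x = 0.
Proof.
move=> dx xb; have [A [Ax xE]] := coord_sum x; have [B BA] := top_bound A.
(* [d] bounds how far the rank of f may lie below the threshold [B], above which the support
   contains no top cell. *)
suff H d t (f g : factor t phi) : comp g = comp f -> matched f g -> (B < rank f + d)%N ->
    lcoord S (m + 1) g x = 0.
  by move=> [t g] [f [gf fg]]; apply: (H B.+1 t f g gf fg); rewrite addnS ltnS leq_addl.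
elim: d t f g => [|d IHd] t f g gf fg lt.
  rewrite addn0 in lt; apply: Ax; apply/negP => gA.
  by have := BA _ _ _ gf fg gA; rewrite leqNgt lt.
have [gA|/Ax//] := boolP (mkcell g \in A).
pose D (c : cell phi) := lcoord S m f (dif (K phi) (m + 1) m
  (gen (m + 1) (tagged c) (m + 1 - hdeg (finner (tagged c))) (gcoord (tagged c) x))).
have DA : \sum_(c <- A) D c = 0.
  rewrite -[RHS](lin_app0 (lcoord S m f)) -dx {1}xE [dif _ _ _ _]lin_app_sum.
  by rewrite (lin_app_sum _ _ _ (lcoord S m f)).
have D0 c : c \in A -> c <> mkcell g -> D c = 0; last first.
  have : D (mkcell g) = 0.
    rewrite -[RHS]DA (big_fsetD1 _ gA) -[LHS]addr0; congr (_ + _); symmetry.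
    by apply: big1_seq => c /andP[_]; rewrite !inE => /andP[/eqP cg cA]; exact: D0.
  have [a [aa fE]] := coord_dif_match m gf fg.
  rewrite -[D _]/(gcoord f _) fE// => /(congr1 ( *:%R a)).
  rewrite scaler0 scalerA aa scale1r => /(congr1 (gcast (S t) _ (m + 1 - hdeg (finner g)))).
  rewrite gcastK ?lin_app0//.
  have [v [_ _ dd]] := matched_facet gf fg; rewrite /hdeg; lia.
move=> cA cg; rewrite /D.
have [bc|nb] := pselect (bottom (tagged c)).
  by rewrite [gcoord _ _](xb c bc) !lin_app0.
have [[f' [cf' mf']]|nt] := pselect (top (tagged c)).
  apply: contrapT => ne.
  have bf : bottom f by exists g.
  have [e|lt'] := coord_dif_top cf' mf' bf erefl ne.
    case: c f' cg cA nb cf' mf' ne e => t' c f' cg cA nb cf' mf' ne e.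
    have tt : t = t' by exact: (congr1 tag e).
    case: _ / tt c f' cg cA nb cf' mf' ne e => c f' cg cA nb cf' mf' ne /mkcell_inj e.
    by rewrite -e in cf' mf'; apply: cg; rewrite (matched_fun gf cf' fg mf').
  apply: ne; rewrite [gcoord _ _](IHd _ f' (tagged c) cf' mf') ?lin_app0//.
  by rewrite addnS in lt; apply: leq_trans lt _; rewrite -addSn leq_add2r.
have dc := critical_deg nb nt.
have u0 : hdeg (finner (tagged c)) = 0.
  have := leq_tdeg (finner (tagged c)); have := leq_tdeg (fouter (tagged c)); rewrite /hdeg; lia.
have -> := dif_gen0 (gcoord (tagged c) x) (erefl (m + 1)) u0 erefl.
apply: coord_gen_neq => e.
have tt : tag c = t by exact: (congr1 tag e).
by have := matched_deg gf fg; rewrite -tt dc ltnn.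
Qed.

Lemma critical_cell t (f : factor t phi) : tdeg t = tdeg phi ->
  mkcell f = mkcell (Factor (tid phi) (tid phi)).
Proof.
(* The composite factors with an identity on either side. In degree 0 these factorizations coincide,
   and comparing their middle trees gives t = phi. *)
move=> d; have ed : factorization (comp f) (Factor (tid phi) (comp f)) by exact: tcomp_idl.
have tp : phi = t.
  by have := congr1 (@fmid _ _ _) (factor_deg0 ed (esym d)).
case: _ / tp f d {ed} => f _; congr mkcell.
have fmid_deg : tdeg (fmid f) = tdeg phi.
  by have := leq_tdeg (finner f); have := leq_tdeg (fouter f); lia.
rewrite (factor_deg0 (f := f) (erefl (comp f)) fmid_deg); congr Factor.
by apply: thom_ext => i x; apply: val_inj; exact: tdeg0_id.
Qed.

(** Once the bottom cells are cleared, being a cycle excludes the top cells, so only the unmatched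
    cell remains. *)
Lemma cycle_unit (m : int) (x : K phi m) : is_cycle x ->
  exists (z : K phi (m + 1)) y, x - dif (K phi) (m + 1) m z = unit_gen phi m y.
Proof.
have [m' e] : exists m', m = m' + 1 by exists (m - 1); rewrite subrK.
subst m; rewrite /is_cycle addrK => cx.
have [z zb] := clear_bottoms x; exists z.
set x' := x - _ in zb *.
have cx' : dif (K phi) (m' + 1) m' x' = 0.
  by rewrite lin_app_sub cx (dif_dif (koszul_complex S phi)) subr0.
have zt := no_bottoms cx' zb.
pose c0 := mkcell (Factor (tid phi) (tid phi)).
have xc0 c : c <> c0 -> lc (m' + 1) c x' = 0.
  have [/zb//|nb] := pselect (bottom (tagged c)).
  have [/zt//|nt] := pselect (top (tagged c)).
  case; transitivity (mkcell (tagged c)); first by case: (c).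
  exact: critical_cell (critical_deg nb nt).
have [A [_ x'E]] := coord_sum x'.
have unit q y : q = m' + 1 -> exists y',
    gen (m' + 1) (Factor (tid phi) (tid phi)) q y = unit_gen phi (m' + 1) y'.
  by move=> qE; subst q; exists y.
have zero c : c <> c0 ->
    gen (m' + 1) (tagged c) (m' + 1 - hdeg (finner (tagged c))) (gcoord (tagged c) x') = 0.
  by move=> /xc0 c0E; rewrite [gcoord _ _]c0E lin_app0.
have [c0A|c0A] := boolP (c0 \in A).
  have [|y' y'E] := unit (m' + 1 - hdeg (tid phi)) (gcoord (Factor (tid phi) (tid phi)) x').
    by rewrite hdeg_id subr0.
  exists y'; rewrite -y'E {1}x'E (big_fsetD1 _ c0A) -[RHS]addr0; congr (_ + _).
  by apply: big1_seq => c /andP[_]; rewrite !inE => /andP[/eqP cc _]; exact: zero.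
exists 0; rewrite lin_app0 x'E; apply: big1_seq => c /andP[_ cA]; apply: zero => cc.
by rewrite -cc cA in c0A.
Qed.

(** [unit_gen] is a chain section of the augmentation, and by [cycle_unit] it reaches every homology
    class. *)
Lemma aug_quasi_iso : quasi_iso (aug phi).
Proof.
apply/quasi_isoP; split=> [m x cx [w wE]|m y cy]; last first.
  exists (unit_gen phi m y); split.
    by rewrite /is_cycle unit_dif ?subrK// cy lin_app0.
  by rewrite [aug phi m _]aug_unit subrr; exists 0; rewrite lin_app0.
have [z [y xz]] := cycle_unit cx.
have yE : y = dif (S phi) (m + 1) m (w - aug phi (m + 1) z).
  rewrite -[LHS]aug_unit -xz lin_app_sub [RHS]lin_app_sub; congr (_ - _); first exact: wE.
  exact: (dhomE (aug phi)).
exists (z + unit_gen phi (m + 1) (w - aug phi (m + 1) z)).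
by rewrite lin_appD (unit_dif _ erefl) -yE -xz addrC subrK.
Qed.

End Morse.
End Augmentation.

Theorem mainTheorem3 (k : comPzRingType) (n : nat) (n_gt0 : (0 < n)%N)
    (S T : dgdiagram k n) (cofS : dg_cofibrant S) (cofT : dg_cofibrant T)
    (Q : cofibrant_replacement S) (d : int) :
  lmod_iso (Ext Q T d) (homology (hom_diag (koszul_diagram S) T) (- d)).
Proof.
pose K := DGDiagram (dg_diagram := koszul_diagram S) (koszul_complex S).
have [a [b [ba ab]]] := homotopy_inverse (F := crep Q) (G := K)
  (diag_cofibrant_projective (@crep_cofibrant _ _ _ Q)) (koszul_projective cofS)
  (f := crep_map Q) (g := augmentation S) (@crep_weq _ _ _ Q) (@aug_quasi_iso _ _ S).
exact: hom_diag_iso ba ab.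
Qed.
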